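(* Let $d\ge 2$ be an integer and suppose that $$F(s)=H(s)\prod_{\substack{a=1\\ (d,a)=1}}^{d-1}\zeta_{d,a}(s)^{e_a},$$ with the $e_a$ rational numbers and $H(s)$ a Dirichlet series that is holomorphic, non-zero and uniformly bounded in $\Re(s)>1-\varepsilon$ for some $\varepsilon>0$. Then $$\gamma_F=\frac{H'(1)}{H(1)}+\sum_{\substack{a=1\\ (d,a)=1}}^{d-1}e_a\,\gamma(d,a).$$
   Context: The letter $p$ always denotes a prime number and $\varphi$ is Euler's totient function. For coprime $a,d$ and $\Re(s)>1$ define $$\zeta_{d,a}(s)=\prod_{p\equiv a\ (\mathrm{mod}\ d)}\frac{1}{1-p^{-s}},$$ and define the Euler constant $$\gamma(d,a)=\lim_{s\to 1^+}\Bigl(\frac{\zeta_{d,a}'(s)}{\zeta_{d,a}(s)}+\frac{1}{\varphi(d)(s-1)}\Bigr).$$ Rational powers of $\zeta_{d,a}(s)$ are $\zeta_{d,a}(s)^{e}=\exp(e\log\zeta_{d,a}(s))$ with $\log\zeta_{d,a}(s)=-\sum_{p\equiv a\ (\mathrm{mod}\ d)}\log(1-p^{-s})$ for $\Re(s)>1$. For a Dirichlet series $F$, the Euler constant associated to $F$ is $$\gamma_F=\lim_{s\to1^+}\Bigl(\frac{F'(s)}{F(s)}+\frac{\alpha}{s-1}\Bigr),$$ whenever this limit exists (and is finite) for an appropriate choice of the constant $\alpha$ (such an $\alpha$ is unique if it exists). The conclusion includes that $\gamma_F$ exists. *)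

(* Defs.v *)
(* R and C are those of Stdlib and Coquelicot; MathComp provides the arithmetic
   of nat and bigop, and comes last so that nat_scope has its notations. *)
From Stdlib Require Export Reals Qreals Lra.
From Coquelicot Require Export Coquelicot.
From mathcomp Require Export all_boot.

Local Open Scope R_scope.

(* Total limit in C along a filter: meaningful when the limit exists. *)
Definition Clim {T : Type} (G : (T -> Prop) -> Prop) (f : T -> C) : C :=
  @lim C_R_CompleteNormedModule (filtermap f G).

Lemma Clim_unique {T : Type} (G : (T -> Prop) -> Prop) {FG : ProperFilter G}
  (f : T -> C) (l : C) : filterlim f G (locally l) -> Clim G f = l.
Proof.
move=> fl.
have FF : ProperFilter (filtermap f G) by exact: filtermap_proper_filter.
have cF : @cauchy C_R_CompleteNormedModule (filtermap f G).
  by move=> eps; exists l; apply: fl; exists eps.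
have lF := @complete_cauchy C_R_CompleteNormedModule _ FF cF.
apply: (filterlim_locally_unique (K := R_AbsRing) (V := C_R_NormedModule) f
          _ _ _ fl).
by move=> P [eps HP]; apply: filter_imp (lF eps); exact: HP.
Qed.

Definition Cexp (z : C) : C :=
  (exp (Re z) * cos (Im z), exp (Re z) * sin (Im z)).

(* Principal argument, in (-PI, PI]; junk value at 0. *)
Definition Carg (z : C) : R :=
  if Rle_dec 0 (Im z) then acos (Re z / Cmod z) else - acos (Re z / Cmod z).

Definition Clog (z : C) : C := (ln (Cmod z), Carg z).

(* n^z for n >= 1 *)
Definition nat_Cpow (n : nat) (z : C) : C := Cexp (z * ln (INR n))%C.

Definition is_Dirichlet_series_at (c : nat -> C) (s l : C) : Prop :=
  @is_series C_AbsRing C_NormedModule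
    (fun n : nat => (c n.+1 * nat_Cpow n.+1 (- s))%C) l.

(* F is (a continuation of) the sum of a Dirichlet series that converges
   somewhere, i.e. on some half-plane. *)
Definition is_Dirichlet_series (F : C -> C) : Prop :=
  exists (c : nat -> C) (sigma : R),
    forall s : C, sigma < Re s -> is_Dirichlet_series_at c s (F s).

Definition holomorphic_on (D : C -> Prop) (f : C -> C) : Prop :=
  forall z : C, D z -> @ex_derive C_AbsRing C_NormedModule f z.

Definition prime_mod (d a p : nat) : bool := prime p && (p == a %[mod d]).

(* zeta_{d,a}(s) and its logarithm, for Re s > 1; both limits are over the
   primes below N as N tends to infinity. *)
Definition zeta_da (d a : nat) (s : C) : C :=
  Clim eventually (fun N : nat =>
    \big[Cmult/RtoC 1]_(0 <= p < N | prime_mod d a p)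
      (1 / (1 - nat_Cpow p (- s)))%C).

Definition log_zeta_da (d a : nat) (s : C) : C :=
  (- Clim eventually (fun N : nat =>
    \big[Cplus/RtoC 0]_(0 <= p < N | prime_mod d a p)
      Clog (1 - nat_Cpow p (- s))))%C.

Definition zeta_da_pow (d a : nat) (e : Q) (s : C) : C :=
  Cexp (Q2R e * log_zeta_da d a s)%C.

Definition gamma_da (d a : nat) : C :=
  Clim (at_right 1) (fun x : R =>
    (C_derive (zeta_da d a) x / zeta_da d a x
       + 1 / (INR (totient d) * (x - 1)))%C).

(* gamma_F exists and equals g; F determines both alpha and g, see
   is_Euler_constant_unique. *)
Definition is_Euler_constant (F : C -> C) (g : C) : Prop :=
  exists alpha : C,
    filterlim (fun x : R => (C_derive F x / F x + alpha / (x - 1))%C)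
      (at_right 1) (locally g).

Lemma is_Euler_constant_unique (F : C -> C) (g1 g2 : C) :
  is_Euler_constant F g1 -> is_Euler_constant F g2 -> g1 = g2.
Proof.
move=> [a1 h1] [a2 h2].
set f := fun x : R => (C_derive F x / F x)%C.
pose V := C_R_NormedModule.
have hne (x : R) : 1 < x -> ((x - 1)%C <> RtoC 0).
  by move=> x1; rewrite -RtoC_minus => /RtoC_inj; lra.
have gt1 : at_right 1 (fun x : R => 1 < x).
  by exists (mkposreal _ Rlt_0_1).
have h12 : filterlim (fun x : R => ((a1 - a2) / (x - 1))%C)
    (at_right 1) (@locally V (minus (G := V) g1 g2)).
  have lm : filterlim (fun x : R => plus (G := V) (f x + a1 / (x - 1))%C
        (opp (G := V) (f x + a2 / (x - 1))%C))
      (at_right 1) (@locally V (minus (G := V) g1 g2)).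
    apply: filterlim_comp_2 (filterlim_plus (V := V) g1 (opp (G := V) g2)).
      exact: h1.
    by apply: filterlim_comp (filterlim_opp (V := V) g2); exact: h2.
  apply: (filterlim_ext_loc _ _ _ lm).
  apply: filter_imp gt1 => x /hne x1.
  change ((f x + a1 / (x - 1)) + - (f x + a2 / (x - 1))
    = (a1 - a2) / (x - 1))%C.
  by field.
have lim0 : filterlim (fun x : R => x - 1) (at_right 1) (locally 0).
  move=> P [r HP]; exists r => x x1 _; apply: HP.
  move: x1; rewrite /ball /= /AbsRing_ball /abs /minus /plus /opp /= => x1.
  by have -> : x - 1 + - 0 = x + - 1 by lra.
have lims : filterlim
    (fun x : R => scal (V := V) (x - 1) ((a1 - a2) / (x - 1))%C) (at_right 1)
    (@locally V (scal (V := V) 0 (minus (G := V) g1 g2))).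
  by apply: filterlim_comp_2 lim0 h12 _; exact: (filterlim_scal (V := V)).
have lima : filterlim (fun _ : R => (a1 - a2)%C) (at_right 1)
    (@locally V (scal (V := V) 0 (minus (G := V) g1 g2))).
  apply: (filterlim_ext_loc _ _ _ lims).
  apply: filter_imp gt1 => x /hne x1.
  rewrite scal_R_Cmult RtoC_minus.
  change ((x - 1) * ((a1 - a2) / (x - 1)) = a1 - a2)%C; by field.
have a12 : (a1 - a2)%C = zero (G := V).
  rewrite -(scal_zero_l (V := V) (minus (G := V) g1 g2)).
  apply: (filterlim_locally_unique (V := V) (F := at_right 1) _ _ _ _ lima).
  exact: filterlim_const.
have ea : a1 = a2.
  have -> : a1 = ((a1 - a2) + a2)%C by ring.
  by rewrite a12; exact: Cplus_0_l.
rewrite -ea in h2.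
exact: (filterlim_locally_unique (V := V) (F := at_right 1) _ _ _ h1 h2).
Qed.

(* Main.v *)
From HB Require Import structures.
From mathcomp Require Import all_algebra all_fingroup all_solvable all_field all_character.
Require Import Defs.
Local Open Scope R_scope.

(** Only real points s > 1 matter: an Euler constant is a limit at real s, and the
    derivative [C_derive f s] at a real point is computed along the real axis. There
    F = H exp (sum_a e_a log zeta_{d,a}), so

      F'/F = H'/H + sum_a e_a zeta_{d,a}'/zeta_{d,a},

    and with alpha = (sum_a e_a) / phi(d) the theorem follows termwise from two facts.

    The first is that H' is continuous at 1 along the real axis
    ([C_derive_right_cont]). Differentiability on a half-plane implies it by Cauchy's
    theory, of which only the following is needed. Goursat's theorem on rectangles
    ([goursat]), applied to (H(z0 + e^w) - H(z0)) e^(-w) in the coordinate w, shows that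
    the integral over a vertical segment of length 2 pi does not depend on Re w; as
    Re w tends to -oo this integral tends to 2 pi H'(z0) ([derivative_circle_int]).
    Thus H'(z0) is an average of values of H on a circle of fixed radius. Since H is
    bounded, so is H' on a smaller half-plane; hence H is Lipschitz there, and the same
    formula makes H' Lipschitz at 1.

    The second is that zeta_{d,a}'/zeta_{d,a} + 1 / (phi(d) (s - 1)) has a limit as
    s -> 1+ ([gamma_da_limit]). This is Dirichlet's theorem on primes in a residue class,
    with a constant term: -zeta_{d,a}'/zeta_{d,a} is the sum of ln p / (p^s - 1) over the
    primes p = a mod d. Up to a function that has a limit at 1, orthogonality of
    characters ([residue_orthogonality]) turns it into an average of the functions
    Q_chi = -L'/L(s, chi), written as sums over primes ([Lser_mul_Qser]). The principal
    character has the same pole as zeta, which is read off from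
    (1 - 2^(1-s)) zeta(s) = sum_n (-1)^(n-1) n^(-s) ([Qser_one_pole]). For every other
    character, Abel summation shows that L and L' have limits at 1, so Q_chi has one
    provided that L(1, chi) <> 0.

    For the latter, if chi^2 is not principal then 3 + 4 cos x + cos 2x >= 0 makes
    |zeta|^6 |L(s, chi)|^8 |L(s, chi^2)|^2 decrease in s, which excludes a zero at 1
    ([nonvanish_complex]). If chi is real, a zero at 1 would bound the Lambert series
    sum_n chi(n) t^n / (1 - t^n) as t -> 1, whereas its power series coefficients
    sum_{d | n} chi(d) are nonnegative, and at least 1 at squares ([nonvanish_real]). *)

(** * Limits and sums of complex numbers *)

HB.instance Definition _ :=
  Monoid.isComLaw.Build R 0 Rplus (fun x y z => esym (Rplus_assoc x y z)) Rplus_comm Rplus_0_l.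
HB.instance Definition _ :=
  Monoid.isComLaw.Build C (RtoC 0) Cplus Cplus_assoc Cplus_comm Cplus_0_l.
HB.instance Definition _ :=
  Monoid.isComLaw.Build C (RtoC 1) Cmult Cmult_assoc Cmult_comm Cmult_1_l.
HB.instance Definition _ :=
  Monoid.isMulLaw.Build C (RtoC 0) Cmult Cmult_0_l Cmult_0_r.
HB.instance Definition _ :=
  Monoid.isAddLaw.Build C Cmult Cplus Cmult_plus_distr_r Cmult_plus_distr_l.

Notation "\rsum_ ( m <= i < n ) F" := (\big[Rplus/0]_(m <= i < n) F)
  (at level 41, F at level 41, i, m, n at level 50).
Notation "\csum_ ( m <= i < n ) F" := (\big[Cplus/RtoC 0]_(m <= i < n) F)
  (at level 41, F at level 41, i, m, n at level 50).

Lemma im_le_Cmod (z : C) : Rabs (Im z) <= Cmod z.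
Proof.
by have := Rmax_Cmod z; have := Rmax_r (Rabs (Re z)) (Rabs (Im z)); rewrite /Re /Im; lra.
Qed.

(** [C] carries several normed structures that share one topology; all limits below are
    taken in this one, through the [Cmod] characterisation [CcvgP]. *)
Definition Ccvg {T : Type} (F : (T -> Prop) -> Prop) (f : T -> C) (l : C) :=
  filterlim f F (locally l).

Lemma CcvgP {T : Type} (F : (T -> Prop) -> Prop) {FF : Filter F} f (l : C) :
  Ccvg F f l <-> forall eps, 0 < eps -> F (fun x => Cmod (f x - l) < eps).
Proof.
split=> [fl eps eps0|fl].
  move/(@filterlim_locally_ball_norm _ _ C_R_NormedModule _ FF): fl => fl.
  by apply: filter_imp (fl (mkposreal eps eps0)) => x; rewrite Cmod_norm.
apply/(@filterlim_locally_ball_norm _ _ C_R_NormedModule _ FF) => -[eps eps0].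
by apply: filter_imp (fl eps eps0) => x; rewrite Cmod_norm.
Qed.

Section CcvgTheory.
Context {T : Type} {F : (T -> Prop) -> Prop} {FF : Filter F}.

Lemma Ccvg_const (c : C) : Ccvg F (fun _ => c) c.
Proof. exact: filterlim_const. Qed.

Lemma Ccvg_ext (f g : T -> C) (l : C) :
  F (fun x => f x = g x) -> Ccvg F f l -> Ccvg F g l.
Proof. by move=> fg; apply: filterlim_ext_loc. Qed.

Lemma Ccvg_plus (f g : T -> C) (a b : C) :
  Ccvg F f a -> Ccvg F g b -> Ccvg F (fun x => f x + g x)%C (a + b)%C.
Proof.
move=> fa gb.
pose V := C_R_NormedModule.
change (filterlim (fun x => plus (G := V) (f x) (g x)) F (locally (T := V) (plus (G := V) a b))).
by apply: filterlim_comp_2 (filterlim_plus (V := V) a b).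
Qed.

Lemma Ccvg_opp (f : T -> C) (a : C) : Ccvg F f a -> Ccvg F (fun x => - f x)%C (- a)%C.
Proof.
move=> fa.
by apply: filterlim_comp (filterlim_opp (V := C_R_NormedModule) a).
Qed.

Lemma Ccvg_minus (f g : T -> C) (a b : C) :
  Ccvg F f a -> Ccvg F g b -> Ccvg F (fun x => f x - g x)%C (a - b)%C.
Proof. by move=> fa gb; apply: Ccvg_plus fa _; apply: Ccvg_opp. Qed.

Lemma Ccvg_mult (f g : T -> C) (a b : C) :
  Ccvg F f a -> Ccvg F g b -> Ccvg F (fun x => f x * g x)%C (a * b)%C.
Proof.
move=> /CcvgP fa /CcvgP gb; apply/CcvgP => eps e0.
have Ca := Cmod_ge_0 a; have Cb := Cmod_ge_0 b.
pose K := Cmod a + Cmod b + 1.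
have K0 : 0 < K by rewrite /K; lra.
pose dl := Rmin 1 (eps / K / 2).
have ek : 0 < eps / K by apply: Rdiv_lt_0_compat.
have dl0 : 0 < dl by apply: Rmin_glb_lt; lra.
have dl1 : dl <= 1 by apply: Rmin_l.
have dl2 : dl <= eps / K / 2 by apply: Rmin_r.
apply: filter_imp (filter_and _ _ (fa _ dl0) (gb _ dl0)) => x [fx gx].
have -> : (f x * g x - a * b = (f x - a) * (g x - b) + a * (g x - b) + (f x - a) * b)%C by ring.
have h1 := Cmod_triangle ((f x - a) * (g x - b) + a * (g x - b)) ((f x - a) * b).
have h2 := Cmod_triangle ((f x - a) * (g x - b)) (a * (g x - b)).
move: h1 h2; rewrite !Cmod_mult.
set u := Cmod (f x - a) in fx *; set v := Cmod (g x - b) in gx *.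
have u0 : 0 <= u by apply: Cmod_ge_0.
have v0 : 0 <= v by apply: Cmod_ge_0.
move=> h1 h2.
have h3 : u * v <= dl * 1 by apply: Rmult_le_compat; lra.
have h4 : Cmod a * v <= Cmod a * dl by apply: Rmult_le_compat_l; lra.
have h5 : u * Cmod b <= dl * Cmod b by apply: Rmult_le_compat_r; lra.
have h6 : dl * K <= eps / K / 2 * K by apply: Rmult_le_compat_r; lra.
have h7 : eps / K / 2 * K = eps / 2 by field; lra.
rewrite /K in h6 h7; nra.
Qed.

Lemma Ccvg_RtoC (f : T -> R) (l : R) :
  filterlim f F (locally l) -> Ccvg F (fun x => RtoC (f x)) (RtoC l).
Proof.
move=> /filterlim_locally fl; apply/CcvgP => eps e0.
apply: filter_imp (fl (mkposreal eps e0)) => x.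
by rewrite -RtoC_minus Cmod_R.
Qed.

Lemma Ccvg_proj (f : T -> C) (l : C) : Ccvg F f l ->
  filterlim (fun x => Re (f x)) F (locally (Re l)) /\
  filterlim (fun x => Im (f x)) F (locally (Im l)).
Proof.
move=> /CcvgP fl; split; apply/filterlim_locally => -[eps e0];
  apply: filter_imp (fl _ e0) => x fx; apply: Rle_lt_trans fx => /=.
  exact: (re_le_Cmod (f x - l)).
exact: (im_le_Cmod (f x - l)).
Qed.

Lemma Ccvg_inv (f : T -> C) (l : C) :
  l <> 0%C -> Ccvg F f l -> Ccvg F (fun x => / f x)%C (/ l)%C.
Proof.
move=> l0 /[dup] /CcvgP fl fl'; apply/CcvgP => eps e0.
have ml : 0 < Cmod l by apply/Cmod_gt_0.
pose dl := Rmin (Cmod l / 2) (eps * (Cmod l * Cmod l) / 2).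
have dl0 : 0 < dl.
  apply: Rmin_glb_lt; first lra.
  by apply: Rdiv_lt_0_compat; last lra; do ! apply: Rmult_lt_0_compat.
have d1 : dl <= Cmod l / 2 by apply: Rmin_l.
have d2 : dl <= eps * (Cmod l * Cmod l) / 2 by apply: Rmin_r.
apply: filter_imp (fl _ dl0) => x fx.
have hl := Cmod_triangle (f x) (l - f x).
rewrite (_ : f x + (l - f x) = l)%C in hl; last by ring.
rewrite (_ : l - f x = - (f x - l))%C in hl; last by ring.
rewrite Cmod_opp in hl.
have fx0 : f x <> 0%C by apply/Cmod_gt_0; lra.
have -> : (/ f x - / l = - (f x - l) / (f x * l))%C by field.
have fl0 : (f x * l)%C <> 0%C by exact: Cmult_neq_0.
rewrite Cmod_div // Cmod_opp Cmod_mult.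
have p0 : 0 < Cmod (f x) * Cmod l by apply: Rmult_lt_0_compat; lra.
apply: (Rmult_lt_reg_r (Cmod (f x) * Cmod l)) => //.
rewrite /Rdiv Rmult_assoc Rinv_l ?Rmult_1_r; last by lra.
have : eps * (Cmod l / 2 * Cmod l) <= eps * (Cmod (f x) * Cmod l).
  apply: Rmult_le_compat_l; first lra.
  by apply: Rmult_le_compat_r; lra.
lra.
Qed.

Lemma Ccvg_sum (I : Type) (r : seq I) (P : pred I) (f : I -> T -> C) (l : I -> C) :
  (forall i, P i -> Ccvg F (f i) (l i)) ->
  Ccvg F (fun x => \big[Cplus/RtoC 0]_(i <- r | P i) f i x) (\big[Cplus/RtoC 0]_(i <- r | P i) l i).
Proof.
move=> fl; elim: r => [|i r IH].
  by rewrite big_nil; apply: Ccvg_ext (Ccvg_const _); apply: filter_forall => x; rewrite big_nil.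
rewrite big_cons; case: ifP => Pi; last first.
  by apply: Ccvg_ext IH; apply: filter_forall => x; rewrite big_cons Pi.
apply: Ccvg_ext (Ccvg_plus _ _ _ _ (fl i Pi) IH).
by apply: filter_forall => x; rewrite big_cons Pi.
Qed.

End CcvgTheory.

Lemma Ccvg_unique {T : Type} {F : (T -> Prop) -> Prop} {FF : ProperFilter F}
    (f : T -> C) (a b : C) :
  Ccvg F f a -> Ccvg F f b -> a = b.
Proof.
exact: (@filterlim_locally_unique _ _ C_R_NormedModule F _).
Qed.

Definition Csum_to (a : nat -> C) (l : C) := Ccvg eventually (fun N => \csum_(0 <= i < N) a i) l.
(** Total sum, whose meaning is given by [Csum_to]: partial sums are big operators, so
    that finite sums can be exchanged and reindexed as such. *)
Definition Csum (a : nat -> C) : C := Clim eventually (fun N => \csum_(0 <= i < N) a i).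
Definition Csummable (a : nat -> C) := ex_series (fun n => Cmod (a n)).

Lemma sum_n_rsum (a : nat -> R) N : sum_n a N = \rsum_(0 <= i < N.+1) a i.
Proof.
elim: N => [|N IH]; first by rewrite sum_O big_nat1.
by rewrite sum_Sn IH [in RHS]big_nat_recr.
Qed.

Lemma sum_n_csum (a : nat -> C_R_NormedModule) N : sum_n a N = \csum_(0 <= i < N.+1) a i.
Proof.
elim: N => [|N IH]; first by rewrite sum_O big_nat1.
by rewrite sum_Sn IH [in RHS]big_nat_recr.
Qed.

Lemma Ccvg_shift (u : nat -> C) l :
  Ccvg eventually (fun n => u n.+1) l <-> Ccvg eventually u l.
Proof.
split=> /CcvgP ul; apply/CcvgP => eps /ul [N HN].
  exists N.+1 => -[|n] /leP //; rewrite ltnS => /leP Nn.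
  exact: HN.
by exists N => n Nn; apply: HN; apply: Nat.le_trans Nn _; apply: Nat.le_succ_diag_r.
Qed.

Lemma Csum_to_is_series (a : nat -> C) (l : C) :
  Csum_to a l <-> is_series (V := C_R_NormedModule) a l.
Proof.
rewrite /Csum_to -Ccvg_shift.
by split=> h; apply: filterlim_ext h => n; rewrite sum_n_csum.
Qed.

Lemma Csum_unique a l : Csum_to a l -> Csum a = l.
Proof. exact: Clim_unique. Qed.

Lemma Csum_to_unique a l m : Csum_to a l -> Csum_to a m -> l = m.
Proof. by move=> /Csum_unique <- /Csum_unique. Qed.

Lemma Csum_to_ext a b l : (forall n, a n = b n) -> Csum_to a l -> Csum_to b l.
Proof.
move=> ab; apply: Ccvg_ext; apply: filter_forall => N.
by apply: eq_bigr => i _.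
Qed.

Lemma Csum_to_plus a b l m :
  Csum_to a l -> Csum_to b m -> Csum_to (fun n => a n + b n)%C (l + m)%C.
Proof.
move=> al bm; apply: Ccvg_ext (Ccvg_plus _ _ _ _ al bm).
by apply: filter_forall => N; rewrite big_split.
Qed.

Lemma Csum_to_scal c a l : Csum_to a l -> Csum_to (fun n => c * a n)%C (c * l)%C.
Proof.
move=> al; apply: Ccvg_ext (Ccvg_mult _ _ _ _ (Ccvg_const c) al).
by apply: filter_forall => N; rewrite big_distrr.
Qed.

Lemma Csum_to_minus a b l m :
  Csum_to a l -> Csum_to b m -> Csum_to (fun n => a n - b n)%C (l - m)%C.
Proof.
move=> al bm.
have -> : (l - m = l + (- (1)) * m)%C by ring.
apply: Csum_to_ext (Csum_to_plus _ _ _ _ al (Csum_to_scal (- (1))%C _ _ bm)) => n.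
by ring.
Qed.

Lemma Csum_to_sum (I : Type) (r : seq I) (P : pred I) (f : I -> nat -> C) (l : I -> C) :
  (forall i, P i -> Csum_to (f i) (l i)) ->
  Csum_to (fun n => \big[Cplus/RtoC 0]_(i <- r | P i) f i n)
    (\big[Cplus/RtoC 0]_(i <- r | P i) l i).
Proof.
move=> fl; apply: Ccvg_ext (Ccvg_sum _ _ _ _ _ fl).
by apply: filter_forall => N; rewrite exchange_big.
Qed.

(** Absolute convergence implies convergence because [C] is complete as a real normed
    module. *)
Lemma Csummable_ex a : Csummable a -> Csum_to a (Csum a).
Proof.
move=> /(@ex_series_le _ C_R_CompleteNormedModule a) h.
have [n|l al] := h; first by rewrite Cmod_norm; apply: Rle_refl.
by move/Csum_to_is_series: al => al; rewrite (Csum_unique _ _ al).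
Qed.

Lemma Csummable_le (a : nat -> C) (M : nat -> R) :
  (forall n, Cmod (a n) <= M n) -> ex_series M -> Csummable a.
Proof.
move=> aM; apply: (@ex_series_le _ R_CompleteNormedModule) => n.
by rewrite /norm /= /abs /= Rabs_pos_eq //; apply: Cmod_ge_0.
Qed.

Lemma Cmod_sum (I : Type) (r : seq I) (P : pred I) (a : I -> C) :
  Cmod (\big[Cplus/RtoC 0]_(i <- r | P i) a i) <= \big[Rplus/0]_(i <- r | P i) Cmod (a i).
Proof.
elim/big_rec2: _ => [|i x y _ yx]; first by rewrite Cmod_0; lra.
by have := Cmod_triangle (a i) y; lra.
Qed.

Lemma rsum_le (I : Type) (r : seq I) (P : pred I) (a b : I -> R) :
  (forall i, P i -> a i <= b i) ->
  \big[Rplus/0]_(i <- r | P i) a i <= \big[Rplus/0]_(i <- r | P i) b i.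
Proof.
move=> ab; elim/big_rec2: _ => [|i x y Pi yx]; first by lra.
by have := ab _ Pi; lra.
Qed.

Lemma rsum_ge0 (I : Type) (r : seq I) (P : pred I) (a : I -> R) :
  (forall i, P i -> 0 <= a i) -> 0 <= \big[Rplus/0]_(i <- r | P i) a i.
Proof.
move=> a0; elim/big_rec: _ => [|i x Pi]; first by lra.
by have := a0 _ Pi; lra.
Qed.

Lemma rsum_le_Series (M : nat -> R) N :
  (forall n, 0 <= M n) -> ex_series M -> \rsum_(0 <= i < N) M i <= Series M.
Proof.
move=> M0 /Series_correct sM.
have h : is_lim_seq (fun N => \rsum_(0 <= i < N.+1) M i) (Series M).
  by apply: filterlim_ext sM => n; rewrite sum_n_rsum.
have mono n : \rsum_(0 <= i < n) M i <= \rsum_(0 <= i < n.+1) M i.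
  by rewrite big_nat_recr //=; have := M0 n; lra.
apply: Rle_trans (mono N) _.
by apply: (is_lim_seq_incr_compare _ _ h) => n; apply: mono.
Qed.

Lemma Ccvg_le_locally (f : nat -> C) l c (K : R) N :
  Ccvg eventually f l -> (forall n, (N <= n)%N -> Cmod (f n - c) <= K) -> Cmod (l - c) <= K.
Proof.
move=> /CcvgP fl fK; apply: Rnot_lt_le => Kl.
have [N' HN] := fl (Cmod (l - c) - K) ltac:(lra).
have h1 := HN (maxn N N') (elimT leP (leq_maxr _ _)).
have h2 := fK (maxn N N') (leq_maxl _ _).
have := Cmod_triangle (l - f (maxn N N')) (f (maxn N N') - c).
have -> : (l - f (maxn N N') + (f (maxn N N') - c) = l - c)%C by ring.
have -> : (l - f (maxn N N') = - (f (maxn N N') - l))%C by ring.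
rewrite Cmod_opp; lra.
Qed.

(** The triangle inequality between two partial sums, passed to the limit; it is the
    uniform tail estimate behind [tannery]. *)
Lemma Csum_tail (a : nat -> C) (M : nat -> R) l N :
  (forall n, Cmod (a n) <= M n) -> ex_series M -> Csum_to a l ->
  Cmod (l - \csum_(0 <= i < N) a i) <= Series M - \rsum_(0 <= i < N) M i.
Proof.
move=> aM sM al.
have M0 n : 0 <= M n by apply: Rle_trans (aM n); apply: Cmod_ge_0.
apply: (Ccvg_le_locally _ _ _ _ N al) => n Nn.
have hM := rsum_le_Series M n M0 sM.
rewrite (big_cat_nat (n := N)) //= in hM.
rewrite (big_cat_nat (n := N)) //=.
set A := \csum_(0 <= i < N) _ in hM *; set B := \csum_(N <= i < n) _.
have -> : (A + B - A = B)%C by ring.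
have : Cmod B <= \rsum_(N <= i < n) M i.
  by apply: Rle_trans (Cmod_sum _ _ _ _) _; apply: rsum_le => i _.
lra.
Qed.

Lemma Csum_bound (a : nat -> C) (M : nat -> R) l :
  (forall n, Cmod (a n) <= M n) -> ex_series M -> Csum_to a l -> Cmod l <= Series M.
Proof.
move=> aM sM al; have := Csum_tail a M l 0 aM sM al.
by rewrite !big_nil Rminus_0_r; have -> : (l - 0 = l)%C by ring.
Qed.

(** Dominated convergence for series (Tannery): up to a tail that [M] makes uniformly
    small, both sums are finite sums, whose limit is clear. The filter is arbitrary because
    it is used for s -> 1+, for difference quotients, and for truncations at infinity, where
    it serves as Fubini's theorem. *)
Lemma tannery {T : Type} {F : (T -> Prop) -> Prop} {FF : ProperFilter F}
    (M : nat -> R) (h : T -> nat -> C) (g : nat -> C) (S : T -> C) :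
  ex_series M ->
  F (fun x => forall n, Cmod (h x n) <= M n) ->
  (forall n, Ccvg F (h^~ n) (g n)) ->
  F (fun x => Csum_to (h x) (S x)) ->
  Csummable g /\ Ccvg F S (Csum g).
Proof.
move=> sM hM hg hS.
have gM n : Cmod (g n) <= M n.
  apply: Rnot_lt_le => lt.
  have /CcvgP/(_ (Cmod (g n) - M n)) := hg n; case/(_ _)/Wrap; first lra.
  move=> near.
  have [x [h1 h2]] := filter_ex _ (filter_and _ _ hM near).
  have := Cmod_triangle (h x n) (- (h x n - g n)).
  have -> : (h x n + - (h x n - g n) = g n)%C by ring.
  by rewrite Cmod_opp; have := h1 n; lra.
have sg : Csummable g by apply: Csummable_le gM sM.
split=> //; apply/CcvgP => eps e0.
have M0 n : 0 <= M n by apply: Rle_trans (gM n); apply: Cmod_ge_0.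
have [N HN] : exists N, Series M - \rsum_(0 <= i < N) M i < eps / 3.
  have /Series_correct/filterlim_locally sM' := sM.
  have [N HN] := sM' (mkposreal (eps / 3) ltac:(lra)).
  exists N.+1; have := HN N (Nat.le_refl N).
  rewrite sum_n_rsum /ball /= /AbsRing_ball /abs /minus /plus /opp /=.
  by move/Rabs_def2; lra.
have fin : Ccvg F (fun x => \csum_(0 <= i < N) h x i) (\csum_(0 <= i < N) g i).
  by apply: Ccvg_sum => i _.
have /CcvgP/(_ (eps / 3) ltac:(lra)) fin' := fin.
apply: filter_imp (filter_and _ _ hM (filter_and _ _ hS fin')) => x [h1 [h2 h3]].
have t1 := Csum_tail _ _ _ N h1 sM h2.
have t2 := Csum_tail _ _ _ N gM sM (Csummable_ex _ sg).
set A := \csum_(0 <= i < N) h x i in t1 h3 *; set B := \csum_(0 <= i < N) g i in t2 h3 *.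
have -> : (S x - Csum g = (S x - A) + ((A - B) + - (Csum g - B)))%C by ring.
have := Cmod_triangle (S x - A) ((A - B) + - (Csum g - B)).
have := Cmod_triangle (A - B) (- (Csum g - B)).
rewrite Cmod_opp; lra.
Qed.

(** The partial sum of [a] up to [K] consists of the first ceil(K/m) terms of the
    subsequence along the multiples of [m]. *)
Lemma Csum_multiples (m : nat) (a : nat -> C) (l : C) : (0 < m)%N ->
  (forall n, ~~ (m %| n)%N -> a n = 0%C) ->
  Csum_to (fun k => a (m * k)%N) l -> Csum_to a l.
Proof.
move=> m0 a0 al.
have fin K : \csum_(0 <= i < K) a i = \csum_(0 <= k < (K + m.-1) %/ m) a (m * k)%N.
  elim: K => [|K IH].
    by rewrite add0n divn_small ?big_nil // -ltnS prednK.
  have -> : ((K.+1 + m.-1) %/ m = (K %/ m).+1)%N.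
      by rewrite addSn -addnS prednK // divnDr ?dvdnn // divnn m0 addn1.
  rewrite big_nat_recr //= IH.
  case: (boolP (m %| K)%N) => [/dvdnP [k ->]|mK].
    have -> : ((k * m + m.-1) %/ m = k)%N.
      by rewrite divnMDl // divn_small ?addn0 // -ltnS prednK.
    by rewrite mulnK // big_nat_recr //= mulnC.
  rewrite a0 // Cplus_0_r; congr (bigop _ _ _); congr (index_iota 0 _).
  have Kr : (0 < K %% m)%N by rewrite lt0n.
  have Kl : (K %% m < m)%N by rewrite ltn_mod.
  rewrite {1}(divn_eq K m) -addnA divnMDl //.
  have -> : (K %% m + m.-1 = m + (K %% m).-1)%N.
    by rewrite -{1}(prednK Kr) addSn -addnS prednK // addnC.
  rewrite divnDl ?dvdnn // divnn m0 (divn_small (m := (K %% m).-1)) ?addn1 //.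
  exact: leq_ltn_trans (leq_pred _) Kl.
move/CcvgP: al => al; apply/CcvgP => eps /al [N HN].
exists (m * N)%N => K /leP NK; rewrite fin; apply: HN; apply/leP.
rewrite leq_divRL // mulnC; exact: leq_trans NK (leq_addr _ _).
Qed.

(** * The powers n^(-s) *)

(** n^(-s) for real s. Since [ln 0 = 0], the value at n = 0 is 1; this is harmless
    because the sequences summed against it vanish at 0, and many estimates then need no
    exception for n = 0. *)
Definition npow (n : nat) (s : R) : R := Rpower (INR n) (- s).

Lemma INR_ge1 n : (0 < n)%N -> 1 <= INR n.
Proof. by move=> /leP n0; apply: (le_INR 1). Qed.

Lemma INR_gt0 n : (0 < n)%N -> 0 < INR n.
Proof. by move=> /INR_ge1; lra. Qed.

Lemma ln_INR_ge0 n : 0 <= ln (INR n).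
Proof.
case: n => [|n]; last by rewrite -ln_1; apply: ln_le; [lra|apply: INR_ge1].
by rewrite /ln /=; case: Rlt_dec => [h|_]; last lra; have := Rlt_irrefl 0.
Qed.

Lemma npow_gt0 n s : 0 < npow n s.
Proof. exact: exp_pos. Qed.

Lemma npowE n s : npow n s = exp (- s * ln (INR n)).
Proof. by []. Qed.

Lemma npow_mult m n s : (0 < m)%N -> (0 < n)%N -> npow (m * n) s = npow m s * npow n s.
Proof.
move=> m0 n0; rewrite /npow mult_INR Rpower_mult_distr //; exact: INR_gt0.
Qed.

Lemma exp_mono x y : x <= y -> exp x <= exp y.
Proof. by case=> [h|->]; [left; apply: exp_increasing|right]. Qed.

Lemma npow_le n s t : s <= t -> npow n t <= npow n s.
Proof.
move=> st; rewrite !npowE; apply: exp_mono.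
have := ln_INR_ge0 n; nra.
Qed.

Lemma npow1 s : npow 1 s = 1.
Proof. by rewrite npowE /= ln_1 Rmult_0_r exp_0. Qed.

Lemma npow_s1 n : (0 < n)%N -> npow n 1 = / INR n.
Proof.
move=> n0; rewrite npowE (_ : - (1) * ln (INR n) = - ln (INR n)); last by ring.
rewrite exp_Ropp exp_ln //; exact: INR_gt0.
Qed.

Lemma npow_add n s t : npow n (s + t) = npow n s * npow n t.
Proof. by rewrite !npowE -exp_plus; congr exp; ring. Qed.

Lemma npow_anti m n s : 0 <= s -> (0 < m)%N -> (m <= n)%N -> npow n s <= npow m s.
Proof.
move=> s0 m0 mn; rewrite !npowE; apply: exp_mono.
have : ln (INR m) <= ln (INR n).
  by apply: ln_le; [apply: INR_gt0|apply: le_INR; apply/leP].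
nra.
Qed.

Lemma npow_derive n s : is_derive (npow n) s (- ln (INR n) * npow n s).
Proof. by rewrite /npow /Rpower; auto_derive => //; ring. Qed.

Lemma mvt_bound (f df : R -> R) (a b K : R) : a <= b ->
  (forall x, a <= x <= b -> is_derive f x (df x)) ->
  (forall x, a <= x <= b -> Rabs (df x) <= K) -> Rabs (f b - f a) <= K * (b - a).
Proof.
move=> ab fd dK.
have [x|x|c] := MVT_gen f a b df; rewrite ?Rmin_left ?Rmax_right //.
- by move=> h; apply: fd; lra.
- move=> h; apply: derivable_continuous_pt.
  by apply: ex_derive_Reals_0; exists (df x); apply: fd.
- case=> h ->; rewrite Rabs_mult (Rabs_pos_eq (b - a)); last by lra.
  by apply: Rmult_le_compat_r; [lra|apply: dK].
Qed.

Lemma ex_series_bounded (a : nat -> R) (K : R) :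
  (forall n, 0 <= a n) -> (forall N, \rsum_(0 <= i < N) a i <= K) -> ex_series a.
Proof.
move=> a0 aK.
have : ex_finite_lim_seq (fun n => \rsum_(0 <= i < n.+1) a i).
  apply: (ex_finite_lim_seq_incr _ K) => n; last exact: aK.
  by rewrite [X in _ <= X]big_nat_recr //=; have := a0 n.+1; lra.
by case=> l hl; exists l; apply: filterlim_ext hl => n; rewrite sum_n_rsum.
Qed.

Lemma ex_series_leR (a b : nat -> R) :
  (forall n, 0 <= a n <= b n) -> ex_series b -> ex_series a.
Proof.
move=> ab; apply: (@ex_series_le _ R_CompleteNormedModule) => n.
by rewrite /norm /= /abs /= Rabs_pos_eq; case: (ab n).
Qed.

Lemma ex_series_telescope (a u : nat -> R) (K : R) :
  (forall n, 0 <= a n <= u n - u n.+1) -> (forall n, K <= u n) -> ex_series a.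
Proof.
move=> au u0; apply: (ex_series_bounded _ (u 0%N - K)) => [n|N]; first by case: (au n).
suff : \rsum_(0 <= i < N) a i <= u 0%N - u N by have := u0 N; lra.
elim: N => [|N IH]; first by rewrite big_nil; lra.
by rewrite big_nat_recr //=; have := au N; lra.
Qed.

Lemma ex_series_shift (a : nat -> R) : ex_series (fun n => a n.+1) -> ex_series a.
Proof. by move=> h; apply/ex_series_incr_1. Qed.

Lemma ex_series_scalR (c : R) (a : nat -> R) : ex_series a -> ex_series (fun n => c * a n).
Proof. exact: (ex_series_scal (V := R_NormedModule)). Qed.

(** Comparison with the telescoping series of (n^(1-s) - (n+1)^(1-s))/(s-1): by
    convexity of exp each difference dominates (n+1)^(-s). *)
Lemma ex_series_npow s : 1 < s -> ex_series (fun n => npow n s).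
Proof.
move=> s1; do 2 apply: ex_series_shift.
pose u n := / (s - 1) * npow n.+1 (s - 1).
have d0 : 0 < / (s - 1) by apply: Rinv_0_lt_compat; lra.
apply: (ex_series_telescope _ u 0) => n; last first.
  by rewrite /u; apply: Rmult_le_pos; [lra|left; apply: npow_gt0].
split; first by left; apply: npow_gt0.
rewrite /u -Rmult_minus_distr_l.
apply: (Rmult_le_reg_l (s - 1)); first lra.
rewrite -Rmult_assoc Rinv_r ?Rmult_1_l; last lra.
set m := n.+1; have m0 : 0 < INR m by apply: INR_gt0.
have m1 : 0 < INR m.+1 by apply: INR_gt0.
have -> : npow m (s - 1) = npow m.+1 (s - 1) * exp ((s - 1) * ln (INR m.+1 / INR m)).
  rewrite !npowE -exp_plus; congr exp; rewrite ln_div //; ring.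
have -> : npow m.+1 s = npow m.+1 (s - 1) * / INR m.+1.
  by rewrite -npow_s1 // -npow_add; congr npow; ring.
have h1 := exp_ineq1_le ((s - 1) * ln (INR m.+1 / INR m)).
have h2 : / INR m.+1 <= ln (INR m.+1 / INR m).
  have := exp_ineq1_le (- / INR m.+1).
  have -> : ln (INR m.+1 / INR m) = - ln (INR m / INR m.+1) by rewrite !ln_div //; ring.
  have e1 : 1 + - / INR m.+1 = INR m / INR m.+1 by rewrite S_INR; field; rewrite -S_INR; lra.
  rewrite e1 => h.
  have := exp_ln (INR m / INR m.+1) ltac:(by apply: Rdiv_lt_0_compat) => e2.
  apply: Ropp_le_cancel; rewrite Ropp_involutive.
  by apply: Rnot_lt_le => /exp_increasing; lra.
have p := npow_gt0 m.+1 (s - 1).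
have h3 : (s - 1) * / INR m.+1 <= (s - 1) * ln (INR m.+1 / INR m).
  by apply: Rmult_le_compat_l; lra.
nra.
Qed.

(** With delta = (s-1)/2, ln n <= n^delta / delta, and the exponent s - delta is still
    greater than 1. *)
Lemma ex_series_ln_npow s : 1 < s -> ex_series (fun n => ln (INR n) * npow n s).
Proof.
move=> s1; pose dl := (s - 1) / 2; have d0 : 0 < dl by rewrite /dl; lra.
apply: (ex_series_leR _ (fun n => / dl * npow n (s - dl))) => [n|].
  split; first by apply: Rmult_le_pos; [apply: ln_INR_ge0|left; apply: npow_gt0].
  have -> : npow n s = npow n (s - dl) * npow n dl by rewrite -npow_add; congr npow; ring.
  rewrite [_ * npow n dl]Rmult_comm -Rmult_assoc; apply: Rmult_le_compat_r.
    by left; apply: npow_gt0.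
  have h := exp_ineq1_le (dl * ln (INR n)).
  have e : exp (dl * ln (INR n)) * npow n dl = 1.
    by rewrite npowE -exp_plus -exp_0; congr exp; ring.
  apply: (Rmult_le_reg_l dl) => //; rewrite -Rmult_assoc Rinv_r; last lra.
  rewrite -e; apply: Rmult_le_compat_r; [left; apply: npow_gt0|lra].
apply: ex_series_scalR; apply: ex_series_npow; rewrite /dl; lra.
Qed.

(** * The logarithmic derivative of a completely multiplicative series *)

(** The Dirichlet series L(s) of [f], at a real point: complex values of s play no role
    in limits at 1+. *)
Definition Lser (f : nat -> C) (s : R) : C := Csum (fun n => f n * npow n s)%C.
(** -L'(s), see [Lser_derive]. *)
Definition Dser (f : nat -> C) (s : R) : C := Csum (fun n => f n * RtoC (ln (INR n) * npow n s))%C.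

Definition Qterm (f : nat -> C) (s : R) (p : nat) : C :=
  if prime p then (ln (INR p) * (f p * npow p s / (1 - f p * npow p s)))%C else 0%C.
(** -L'(s)/L(s), as the logarithmic derivative of the Euler product. It makes sense for
    every [f] bounded by 1, and for the indicator of a residue class it is
    -zeta_{d,a}'/zeta_{d,a}. *)
Definition Qser (f : nat -> C) (s : R) : C := Csum (Qterm f s).

(** Dirichlet characters, and the constant sequence 1 with its value at 0 replaced by 0. *)
Record cmul (f : nat -> C) : Prop := Cmul {
  cmul0 : f 0%N = 0%C;
  cmul1 : f 1%N = 1%C;
  cmulM : forall m n, f (m * n)%N = (f m * f n)%C;
  cmul_le1 : forall n, Cmod (f n) <= 1 }.

Lemma Cmod_le1_mult (z : C) (r : R) : Cmod z <= 1 -> 0 <= r -> Cmod (z * r)%C <= r.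
Proof.
move=> z1 r0; rewrite Cmod_mult Cmod_R Rabs_pos_eq //.
have := Cmod_ge_0 z; nra.
Qed.

Lemma npow_ge0 n s : 0 <= npow n s.
Proof. by left; apply: npow_gt0. Qed.

Lemma ln_npow_ge0 n s : 0 <= ln (INR n) * npow n s.
Proof. by apply: Rmult_le_pos; [apply: ln_INR_ge0|apply: npow_ge0]. Qed.

Section Bounded.
Variables (f : nat -> C) (f1 : forall n, Cmod (f n) <= 1).

Lemma Lser_summable s : 1 < s -> Csummable (fun n => f n * npow n s)%C.
Proof.
move=> s1; apply: Csummable_le (ex_series_npow s s1) => n.
by apply: Cmod_le1_mult; [apply: f1|apply: npow_ge0].
Qed.

Lemma Dser_summable s : 1 < s -> Csummable (fun n => f n * RtoC (ln (INR n) * npow n s))%C.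
Proof.
move=> s1; apply: Csummable_le (ex_series_ln_npow s s1) => n.
by apply: Cmod_le1_mult; [apply: f1|apply: ln_npow_ge0].
Qed.

Lemma npow_prime_half p s : prime p -> 1 <= s -> npow p s <= / 2.
Proof.
move=> /prime_gt1 p2 s1; apply: Rle_trans (npow_le p _ _ s1) _.
rewrite npow_s1; last exact: ltnW.
apply: Rinv_le_contravar; first lra.
by apply: (le_INR 2); apply/leP.
Qed.

Lemma Cmod_fp p s : prime p -> 1 <= s -> Cmod (f p * npow p s)%C <= / 2.
Proof.
move=> pp s1; apply: Rle_trans (npow_prime_half p s pp s1).
by apply: Cmod_le1_mult; [apply: f1|apply: npow_ge0].
Qed.

Lemma one_minus_ge (w : C) : Cmod w <= / 2 -> / 2 <= Cmod (1 - w)%C.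
Proof.
move=> w2; have := Cmod_triangle (1 - w) w.
rewrite (_ : 1 - w + w = 1)%C; last by ring.
rewrite Cmod_1; lra.
Qed.

Lemma one_minus_neq0 (w : C) : Cmod w <= / 2 -> (1 - w)%C <> 0%C.
Proof. by move=> /one_minus_ge h; apply/Cmod_gt_0; lra. Qed.

Lemma Qterm_bound s p : 1 <= s -> Cmod (Qterm f s p) <= 2 * (ln (INR p) * npow p s).
Proof.
move=> s1; rewrite /Qterm; case: ifP => pp; last first.
  by rewrite Cmod_0; have := ln_npow_ge0 p s; lra.
have h := Cmod_fp p s pp s1; have h2 := one_minus_ge _ h.
have h3 : Cmod (f p * npow p s)%C <= npow p s.
  by apply: Cmod_le1_mult; [apply: f1|apply: npow_ge0].
have l0 := ln_INR_ge0 p.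
rewrite Cmod_mult Cmod_R Rabs_pos_eq // Cmod_div; last exact: one_minus_neq0.
have -> : 2 * (ln (INR p) * npow p s) = ln (INR p) * (npow p s / / 2) by field.
apply: Rmult_le_compat_l => //; apply: Rmult_le_compat => //.
- exact: Cmod_ge_0.
- by left; apply: Rinv_0_lt_compat; lra.
- apply: Rinv_le_contravar; lra.
Qed.

Lemma Qser_summable s : 1 < s -> Csummable (Qterm f s).
Proof.
move=> s1; apply: Csummable_le (ex_series_scalR 2 _ (ex_series_ln_npow s s1)) => n.
by apply: Qterm_bound; lra.
Qed.
End Bounded.

(** The logarithm of the prime factorisation of [n]; primes up to [K > n] include all
    prime factors, and [logn] is 0 at non-primes. *)
Lemma sum_logn_ln n K : (0 < n)%N -> (n < K)%N ->
  \rsum_(0 <= p < K) (ln (INR p) * INR (logn p n)) = ln (INR n).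
Proof.
move=> n0 nK.
have e : n = (\prod_(0 <= p < K) p ^ logn p n)%N.
  rewrite -{1}(partnT n0) /partn (big_cat_nat (n := n.+1) (p := K)) //=.
  rewrite [X in (_ * X)%N]big_nat_cond [X in (_ * X)%N]big1 ?muln1 // => i.
  rewrite andbT => /andP [ni _]; rewrite lognE; case: ifP => // /and3P [_ _ /dvdn_leq].
  by move=> /(_ n0); rewrite leqNgt ni.
have h (r : seq nat) : (forall p, p \in r -> 0 < p ^ logn p n)%N ->
  ln (INR (\prod_(p <- r) p ^ logn p n)) = \big[Rplus/0]_(p <- r) (ln (INR p) * INR (logn p n)).
  elim: r => [|p r IH] hr; first by rewrite !big_nil /= ln_1.
  have hr' : (0 < \prod_(j <- r) j ^ logn j n)%N.
    rewrite big_seq; apply: prodn_cond_gt0 => i ir; apply: hr; by rewrite inE ir orbT.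
  have hp := hr p (mem_head _ _).
  rewrite !big_cons mult_INR ln_mult; try exact: INR_gt0.
  rewrite IH; last by move=> i ir; apply: hr; rewrite inE ir orbT.
  congr Rplus; case: (posnP p) hp => [->|p0] hp.
    by rewrite lognE /= ln_1; ring.
  elim: (logn p n) => [|k IHk]; first by rewrite /= ln_1; ring.
  rewrite expnS mult_INR ln_mult ?IHk ?S_INR; try (apply: INR_gt0 => //; by rewrite expn_gt0 p0).
  ring.
rewrite {2}e h //.
Qed.

Lemma sum_logn_ln_le n K : (0 < n)%N ->
  \rsum_(0 <= p < K) (ln (INR p) * INR (logn p n)) <= ln (INR n).
Proof.
move=> n0; rewrite -(sum_logn_ln n (K + n.+1) n0); last by rewrite addnS ltnS leq_addl.
rewrite [X in _ <= X](big_cat_nat (n := K)) ?leq_addr //=.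
have : 0 <= \rsum_(K <= p < K + n.+1) (ln (INR p) * INR (logn p n)).
  by apply: rsum_ge0 => p _; apply: Rmult_le_pos; [apply: ln_INR_ge0|apply: pos_INR].
lra.
Qed.

Lemma logn_ln_le n p : (0 < n)%N -> ln (INR p) * INR (logn p n) <= ln (INR n).
Proof.
move=> n0; apply: Rle_trans (sum_logn_ln_le n p.+1 n0).
rewrite big_nat_recr //=.
have : 0 <= \rsum_(0 <= p < p) (ln (INR p) * INR (logn p n)).
  by apply: rsum_ge0 => i _; apply: Rmult_le_pos; [apply: ln_INR_ge0|apply: pos_INR].
lra.
Qed.

Section LogarithmicDerivative.
Variables (f : nat -> C) (cf : cmul f).
Let f1 := cmul_le1 f cf.

Let B (s : R) (p n : nat) : C := (f n * RtoC ((ln (INR p) * INR (logn p n)) * npow n s))%C.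

Lemma logn_series_summable s p : 1 < s -> Csummable (B s p).
Proof.
move=> s1; apply: Csummable_le (ex_series_ln_npow s s1) => n; rewrite /B.
case: (posnP n) => [->|n0].
  by rewrite cmul0 // Cmult_0_l Cmod_0; apply: ln_npow_ge0.
have l0 : 0 <= ln (INR p) * INR (logn p n).
  by apply: Rmult_le_pos; [apply: ln_INR_ge0|apply: pos_INR].
apply: Rle_trans (Cmod_le1_mult _ _ (f1 n) _) _.
  by apply: Rmult_le_pos => //; apply: npow_ge0.
by apply: Rmult_le_compat_r; [apply: npow_ge0|apply: logn_ln_le].
Qed.

(** The sum S of ln p v_p(n) f(n) n^(-s) lives on the multiples of p. With w = f(p)
    p^(-s), the identity v_p(pm) = 1 + v_p(m) and complete multiplicativity give S = w (ln p
    L(s) + S), which is solved for S. *)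
Lemma logn_series s p : 1 < s -> prime p ->
  Csum (B s p) = (Lser f s * Qterm f s p)%C.
Proof.
move=> s1 pp; rewrite /Qterm pp.
have w2 := Cmod_fp f f1 p s pp ltac:(lra).
have w0 := one_minus_neq0 _ w2.
set w := (f p * npow p s)%C in w2 w0 *.
have hB := Csummable_ex _ (logn_series_summable s p s1).
have hL := Csummable_ex _ (Lser_summable f f1 s s1); rewrite -/(Lser f s) in hL.
have hB' : Csum_to (B s p) (w * (ln (INR p) * Lser f s + Csum (B s p)))%C.
  apply: (Csum_multiples p) (prime_gt0 pp) _ _ => [n pn|].
    by rewrite /B lognE pp (negbTE pn) andbF /= Rmult_0_r Rmult_0_l Cmult_0_r.
  apply: Csum_to_ext (Csum_to_scal w _ _ (Csum_to_plus _ _ _ _ (Csum_to_scal (ln (INR p)) _ _ hL)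
    hB)) => n.
  rewrite /B cmulM //; case: (posnP n) => [->|n0].
    by rewrite cmul0 //; ring.
  rewrite npow_mult ?(prime_gt0 pp) // lognM ?(prime_gt0 pp) // (logn_prime _ pp) eqxx /w.
  by rewrite add1n S_INR !(RtoC_mult, RtoC_plus); ring.
have e := Csum_to_unique _ _ _ hB hB'.
set b := Csum (B s p) in e *.
suff e2 : (b * (1 - w) = Lser f s * (ln (INR p) * w))%C.
  have -> : b = (b * (1 - w) / (1 - w))%C by field.
  by rewrite e2; field.
have -> : (b * (1 - w) = b - w * b)%C by ring.
rewrite {1}e; ring.
Qed.

(** L'/L as a sum over primes, without Euler products: ln n is the sum of ln p v_p(n)
    over p, and [logn_series] evaluates the contribution of each prime. Summing over the
    primes below K and letting K tend to infinity is justified by [tannery]. *)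
Lemma Lser_mul_Qser s : 1 < s -> (Lser f s * Qser f s)%C = Dser f s.
Proof.
move=> s1.
(* the series of [ln n f(n) n^(-s)] restricted to primes below [K] *)
pose h K n := (\big[Cplus/RtoC 0]_(0 <= p < K | prime p) B s p n).
have h1 K : Csum_to (h K) (Lser f s * \csum_(0 <= p < K) Qterm f s p)%C.
  have -> : (Lser f s * \csum_(0 <= p < K) Qterm f s p)%C
      = \big[Cplus/RtoC 0]_(0 <= p < K | prime p) Csum (B s p).
    rewrite big_distrr /= [RHS]big_mkcond /=; apply: eq_bigr => p _.
    case: ifP => pp; first by rewrite logn_series.
    by rewrite /Qterm pp Cmult_0_r.
  by apply: Csum_to_sum => p pp; apply: Csummable_ex; apply: logn_series_summable.
pose v K n := \rsum_(0 <= p < K) (ln (INR p) * INR (logn p n)).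
have hE K n : h K n = (f n * RtoC (v K n * npow n s))%C.
  rewrite /h /v big_mkcond /=; elim: K => [|K IH].
    by rewrite !big_nil Rmult_0_l Cmult_0_r.
  rewrite !big_nat_recr //= IH /B; case: ifP => pK.
    by rewrite !(RtoC_mult, RtoC_plus); ring.
  by rewrite [logn K n]lognE pK /= !(RtoC_mult, RtoC_plus); ring.
have [] := tannery (F := eventually) _ h (fun n => f n * RtoC (ln (INR n) * npow n s))%C _
  (ex_series_ln_npow s s1) _ _ (filter_forall _ h1).
- apply: filter_forall => K n; rewrite hE.
  case: (posnP n) => [->|n0].
    by rewrite cmul0 // Cmult_0_l Cmod_0; apply: ln_npow_ge0.
  have l0 : 0 <= v K n.
    by apply: rsum_ge0 => i _; apply: Rmult_le_pos; [apply: ln_INR_ge0|apply: pos_INR].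
  apply: Rle_trans (Cmod_le1_mult _ _ (f1 n) _) _.
    by apply: Rmult_le_pos => //; apply: npow_ge0.
  by apply: Rmult_le_compat_r; [apply: npow_ge0|apply: sum_logn_ln_le].
- move=> n; apply: (Ccvg_ext _ _ (f n * RtoC (ln (INR n) * npow n s))%C _ (Ccvg_const _)).
  exists n.+1 => K /leP nK; rewrite hE.
  case: (posnP n) => [->|n0]; first by rewrite cmul0 // !Cmult_0_l.
  by rewrite /v sum_logn_ln.
move=> _ h2; apply: (Ccvg_unique (F := eventually) _ _ _ _ h2).
apply: Ccvg_mult (Ccvg_const _) _; apply: Csummable_ex; exact: Qser_summable.
Qed.
End LogarithmicDerivative.

(** * Termwise derivatives, and limits at 1 by Abel summation *)

#[global] Instance punctured_proper (x : R) : ProperFilter (locally' x).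
Proof. exact: (Rbar_locally'_filter (Rbar.Finite x)). Qed.

(** Derivative of a complex function of a real variable. [C_derive g x] at a real point
    x is such a derivative, of the restriction of [g] to the real axis ([C_derive_Cderiv]),
    so this notion carries all derivatives of the theorem. *)
Definition Cderiv (f : R -> C) (x : R) (l : C) : Prop :=
  Ccvg (locally' x) (fun t => (f t - f x) / RtoC (t - x))%C l.

Lemma locally'P (x : R) (P : R -> Prop) (dl : R) : 0 < dl ->
  (forall t, t <> x -> Rabs (t - x) < dl -> P t) -> locally' x P.
Proof. by move=> d0 h; exists (mkposreal dl d0) => t td tx; apply: h. Qed.

Lemma C_derive_Cderiv (g : C -> C) (x : R) (l : C) :
  Cderiv (fun t => g (RtoC t)) x l -> C_derive g x = l.
Proof.
move=> /Ccvg_proj [h1 h2].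
have e1 : Lim (fun t : R => Re ((g (RtoC t) - g x) / (RtoC t - x))%C) x = Re l.
  by apply: is_lim_unique; apply: filterlim_ext h1 => t; rewrite RtoC_minus.
have e2 : Lim (fun t : R => Im ((g (RtoC t) - g x) / (RtoC t - x))%C) x = Im l.
  by apply: is_lim_unique; apply: filterlim_ext h2 => t; rewrite RtoC_minus.
rewrite /C_derive /C_lim; change (RtoC x).1 with x; change (RtoC x).2 with 0.
by rewrite [RHS]surjective_pairing; congr pair; [exact: (f_equal real e1)|exact: (f_equal real e2)].
Qed.

Lemma is_derive_Cderiv (f : R -> R) (x l : R) :
  is_derive f x l -> Cderiv (fun t => RtoC (f t)) x l.
Proof.
move=> /is_derive_Reals h; apply/CcvgP => eps /h [[dl d0] hd].
apply: (locally'P _ _ dl d0) => t tx tdl.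
have := hd (t - x) ltac:(lra) tdl.
rewrite (_ : x + (t - x) = t); last by ring.
rewrite -RtoC_minus -RtoC_div; last by lra.
by rewrite -RtoC_minus Cmod_R.
Qed.

Lemma Cderiv_is_derive (f : R -> C) (x : R) (l : C) :
  Cderiv f x l -> is_derive (fun t => Re (f t)) x (Re l) /\ is_derive (fun t => Im (f t)) x (Im l).
Proof.
move=> /CcvgP h; split; apply/is_derive_Reals => eps /h [[dl d0] hd];
  exists (mkposreal dl d0) => k k0 kd;
  have := hd (x + k) _ ltac:(lra);
  (have -> : x + k - x = k by ring) => hh.
  apply: Rle_lt_trans (hh _); last first.
    by rewrite /ball /= /AbsRing_ball /abs /minus /plus /opp /=; have -> : x + k + - x = k by ring.
  apply: Rle_trans (re_le_Cmod _); right; congr Rabs.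
  by case: (f (x + k)) (f x) l {h hd hh} => [a b] [c e] [m n];
    rewrite /Re /Cminus /Cdiv /Cinv /Cmult /Cplus /Copp /RtoC /=; field.
apply: Rle_lt_trans (hh _); last first.
  by rewrite /ball /= /AbsRing_ball /abs /minus /plus /opp /=; have -> : x + k + - x = k by ring.
apply: Rle_trans (im_le_Cmod _); right; congr Rabs.
by case: (f (x + k)) (f x) l {h hd hh} => [a b] [c e] [m n];
  rewrite /Im /Cminus /Cdiv /Cinv /Cmult /Cplus /Copp /RtoC /=; field.
Qed.

Lemma Cderiv_ext_loc (f g : R -> C) x l : locally x (fun t => f t = g t) ->
  Cderiv f x l -> Cderiv g x l.
Proof.
move=> fg fl; have fx := locally_singleton _ _ fg; apply: Ccvg_ext fl.
by case: fg => dl hd; exists dl => t tb _; rewrite hd // fx.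
Qed.

Lemma Cderiv_continuous (f : R -> C) x l : Cderiv f x l -> Ccvg (locally' x) f (f x).
Proof.
move=> h.
have h0 : Ccvg (locally' x) (fun t => RtoC (t - x)) (RtoC 0).
  apply: Ccvg_RtoC; apply/filterlim_locally => -[eps e0].
  apply: (locally'P _ _ _ e0) => t _ ht.
  by rewrite /ball /= /AbsRing_ball /abs /minus /plus /opp /=;
    have -> : t - x + - 0 = t - x by ring.
pose proof (Ccvg_plus _ _ _ _ (Ccvg_const (f x)) (Ccvg_mult _ _ _ _ h h0)) as h1; move: h1.
rewrite (_ : f x + l * 0 = f x)%C; last by ring.
apply: Ccvg_ext; apply: (locally'P _ _ 1 Rlt_0_1) => t tx _; field.
by move=> /RtoC_inj; lra.
Qed.

Lemma Cderiv_mult (f g : R -> C) x a b : Cderiv f x a -> Cderiv g x b ->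
  Cderiv (fun t => f t * g t)%C x (a * g x + f x * b)%C.
Proof.
move=> fa gb.
apply: Ccvg_ext (Ccvg_plus _ _ _ _ (Ccvg_mult _ _ _ _ fa (Cderiv_continuous _ _ _ gb)) (Ccvg_mult
  _ _ _ _ (Ccvg_const (f x)) gb)).
apply: (locally'P _ _ 1 Rlt_0_1) => t tx _; field.
by move=> /RtoC_inj; lra.
Qed.

Lemma Cderiv_const (c : C) x : Cderiv (fun _ => c) x 0%C.
Proof.
apply: Ccvg_ext (Ccvg_const 0%C); apply: (locally'P _ _ 1 Rlt_0_1) => t tx _.
by rewrite /Cdiv (_ : c - c = 0)%C ?Cmult_0_l //; ring.
Qed.

(** Termwise differentiation: difference quotients are dominated by the Lipschitz
    constants [M], so [tannery] applies along [t -> x]. *)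
Lemma Cderiv_Csum (u : nat -> R -> C) (v : nat -> C) (U : R -> C) (M : nat -> R) (x dl : R) :
  0 < dl -> ex_series M ->
  (forall t, Rabs (t - x) < dl -> Csum_to (u^~ t) (U t)) ->
  (forall n, Cderiv (u n) x (v n)) ->
  (forall n t, Rabs (t - x) < dl -> Cmod (u n t - u n x)%C <= M n * Rabs (t - x)) ->
  Cderiv U x (Csum v).
Proof.
move=> d0 sM uU uv uM.
have [] := tannery (F := locally' x) M (fun t n => (u n t - u n x) / RtoC (t - x))%C v
  (fun t => (U t - U x) / RtoC (t - x))%C sM _ uv _ => //.
- apply: (locally'P _ _ _ d0) => t tx td n.
  have t0 : 0 < Rabs (t - x) by apply: Rabs_pos_lt; lra.
  rewrite Cmod_div; last by move=> /RtoC_inj; lra.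
  rewrite Cmod_R; apply: (Rmult_le_reg_r (Rabs (t - x))) => //.
  rewrite /Rdiv Rmult_assoc Rinv_l ?Rmult_1_r; last lra.
  exact: uM.
- apply: (locally'P _ _ _ d0) => t tx td.
  have x0 : Rabs (x - x) < dl by rewrite Rminus_diag Rabs_R0.
  have := Csum_to_scal (/ RtoC (t - x)) _ _ (Csum_to_minus _ _ _ _ (uU t td) (uU x x0)).
  rewrite Cmult_comm -/(Cdiv _ _).
  by apply: Csum_to_ext => n; rewrite Cmult_comm.
Qed.

(** The mean value inequality, without assuming which endpoint is smaller. *)
Lemma mvt_bound_sym (f df : R -> R) (a b K x y : R) :
  (forall x, a <= x <= b -> is_derive f x (df x)) ->
  (forall x, a <= x <= b -> Rabs (df x) <= K) ->
  a <= x <= b -> a <= y <= b -> Rabs (f y - f x) <= K * Rabs (y - x).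
Proof.
move=> fd dK hx hy; case: (Rle_dec x y) => xy.
  rewrite (Rabs_pos_eq (y - x)); last lra.
  by apply: (mvt_bound _ df) => // z hz; [apply: fd|apply: dK]; lra.
rewrite (Rabs_minus_sym (f y)) (Rabs_minus_sym y) (Rabs_pos_eq (x - y)); last lra.
by apply: (mvt_bound _ df) => [|z hz|z hz]; [lra|apply: fd|apply: dK]; lra.
Qed.

Lemma Lser_derive (f : nat -> C) s : (forall n, Cmod (f n) <= 1) -> 1 < s ->
  Cderiv (Lser f) s (- Dser f s)%C.
Proof.
move=> f1 s1; set dl := (s - 1) / 2; have d0 : 0 < dl by rewrite /dl; lra.
have -> : (- Dser f s)%C = Csum (fun n => f n * RtoC (- ln (INR n) * npow n s))%C.
  symmetry; apply: Csum_unique.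
  have := Csum_to_scal (- (1))%C _ _ (Csummable_ex _ (Dser_summable f f1 s s1)).
  rewrite -/(Dser f s) (_ : - (1) * Dser f s = - Dser f s)%C; last by ring.
  by apply: Csum_to_ext => n; rewrite !(RtoC_mult, RtoC_opp); ring.
apply: (Cderiv_Csum (fun n t => f n * npow n t)%C _ _ _ s dl d0 (ex_series_ln_npow (s - dl) _)) =>
  [|t ht|n|n t ht].
- rewrite /dl; lra.
- apply: Csummable_ex; apply: Lser_summable f1 _ _.
  by move/Rabs_def2: ht; rewrite /dl; lra.
- have := Cderiv_mult _ _ _ _ _ (Cderiv_const (f n) s) (is_derive_Cderiv _ _ _ (npow_derive n s)).
  by rewrite Cmult_0_l Cplus_0_l.
- have -> : (f n * npow n t - f n * npow n s = f n * RtoC (npow n t - npow n s))%C.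
    by rewrite RtoC_minus; ring.
  rewrite Cmod_mult Cmod_R; apply: Rle_trans (_ : 1 * Rabs (npow n t - npow n s) <= _).
    by apply: Rmult_le_compat_r; [apply: Rabs_pos|apply: f1].
  rewrite Rmult_1_l; apply: (mvt_bound_sym _ (fun s => - ln (INR n) * npow n s) (s - dl) (s + dl)).
  + by move=> x _; apply: npow_derive.
  + move=> x hx; rewrite Rabs_mult Rabs_Ropp !Rabs_pos_eq; try exact: npow_ge0;
      try exact: ln_INR_ge0.
    apply: Rmult_le_compat_l; [exact: ln_INR_ge0|apply: npow_le; lra].
  + lra.
  + move/Rabs_def2: ht; lra.
Qed.

(** The partial sums of the two series differ by (sum_{i < N} f i) b_N, which tends to
    0. The new series converges absolutely as soon as [b] has bounded variation, which makes
    it suitable for [tannery]. *)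
Lemma abel (f : nat -> C) (b : nat -> R) (K : R) (l : C) :
  (forall n, Cmod (\csum_(0 <= i < n) f i) <= K) -> is_lim_seq b 0 ->
  Csum_to (fun n => f n * b n)%C l ->
  Csum_to (fun n => (\csum_(0 <= i < n.+1) f i) * RtoC (b n - b n.+1))%C l.
Proof.
move=> fK b0 fb.
have e N : \csum_(0 <= n < N) ((\csum_(0 <= i < n.+1) f i) * RtoC (b n - b n.+1))%C
   = (\csum_(0 <= n < N) (f n * b n)%C + - ((\csum_(0 <= i < N) f i) * b N))%C.
  elim: N => [|N IH]; first by rewrite !big_nil; ring.
  by rewrite big_nat_recr //= IH ![\csum_(0 <= _ < N.+1) _]big_nat_recr //= !RtoC_minus; ring.
have h : Ccvg eventually (fun N => (\csum_(0 <= i < N) f i) * b N)%C 0%C.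
  apply/CcvgP => eps e0.
  have K0 : 0 <= K by apply: Rle_trans (fK 0%N); apply: Cmod_ge_0.
  have ek : 0 < eps / (K + 1) by apply: Rdiv_lt_0_compat; lra.
  have /filterlim_locally/(_ (mkposreal _ ek)) [N HN] := b0.
  exists N => n nN.
  have := HN n nN; rewrite /ball /= /AbsRing_ball /abs /minus /plus /opp /= Ropp_0 Rplus_0_r => h.
  rewrite (_ : forall z : C, z - 0 = z)%C; last by move=> z; ring.
  rewrite Cmod_mult Cmod_R.
  have h2 : Cmod (\csum_(0 <= i < n) f i) * Rabs (b n) <= K * Rabs (b n).
    by apply: Rmult_le_compat_r; [apply: Rabs_pos|].
  have h3 : (K + 1) * Rabs (b n) < (K + 1) * (eps / (K + 1)) by apply: Rmult_lt_compat_l; lra.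
  have h4 : (K + 1) * (eps / (K + 1)) = eps by field; lra.
  have := Rabs_pos (b n); lra.
pose proof (Ccvg_plus _ _ _ _ fb (Ccvg_opp _ _ h)) as h1; move: h1.
rewrite (_ : l + - 0 = l)%C; last by ring.
by apply: Ccvg_ext; apply: filter_forall => N; rewrite e.
Qed.

(** A summable majorant, uniform in 1 <= s <= 2, for the increments of both n^(-s) and
    ln n n^(-s). *)
Definition Mdom (n : nat) : R := 3 * npow n 2 + 2 * (ln (INR n) * npow n 2).

Lemma ex_series_Mdom : ex_series Mdom.
Proof.
apply: (ex_series_plus (V := R_NormedModule)); apply: ex_series_scalR.
  by apply: ex_series_npow; lra.
by apply: ex_series_ln_npow; lra.
Qed.

Lemma Mdom_ge0 n : 0 <= Mdom n.
Proof. by rewrite /Mdom; have := npow_ge0 n 2; have := ln_npow_ge0 n 2; lra. Qed.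

Lemma Rpower_derive (s x : R) : 0 < x ->
  is_derive (fun x => Rpower x (- s)) x (- s * Rpower x (- s - 1)).
Proof.
move=> x0; rewrite /Rpower; auto_derive => //.
rewrite (_ : (- s - 1) * ln x = - s * ln x + - ln x); last by ring.
by rewrite exp_plus exp_Ropp exp_ln //; ring.
Qed.

Lemma Rpower_ge_npow2 n s x : (0 < n)%N -> 1 <= s -> INR n <= x -> Rpower x (- s - 1) <= npow n 2.
Proof.
move=> n0 s1 nx; have := INR_ge1 n n0 => n1.
have l1 : 0 <= ln (INR n) by apply: ln_INR_ge0.
have l2 : ln (INR n) <= ln x by apply: ln_le; lra.
by rewrite npowE /Rpower; apply: exp_mono; nra.
Qed.

Lemma npow_diff n s : 1 <= s <= 2 -> Rabs (npow n s - npow n.+1 s) <= Mdom n.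
Proof.
move=> hs; case: (posnP n) => [->|n0].
  rewrite npow1 npowE /= (_ : ln 0 = 0); last first.
    by rewrite /ln; case: Rlt_dec => // h; have := Rlt_irrefl 0.
  rewrite Rmult_0_r exp_0 Rminus_diag Rabs_R0; exact: Mdom_ge0.
have n1 := INR_ge1 n n0.
have := mvt_bound (fun x => Rpower x (- s)) (fun x => - s * Rpower x (- s - 1)) (INR n) (INR
  n.+1) (2 * npow n 2).
rewrite Rabs_minus_sym -/(npow n s) -/(npow n.+1 s) => h.
apply: Rle_trans (h _ _ _) _.
- by rewrite S_INR; lra.
- by move=> x hx; apply: Rpower_derive; lra.
- move=> x hx; rewrite Rabs_mult Rabs_Ropp !Rabs_pos_eq; [|left; exact: exp_pos|lra].
  apply: Rmult_le_compat; [lra|left; exact: exp_pos|lra|].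
  by apply: Rpower_ge_npow2 => //; lra.
- rewrite S_INR /Mdom; have := npow_ge0 n 2; have := ln_npow_ge0 n 2; lra.
Qed.

Lemma lnpow_diff n s : 1 <= s <= 2 ->
  Rabs (ln (INR n) * npow n s - ln (INR n.+1) * npow n.+1 s) <= Mdom n.
Proof.
move=> hs; case: (posnP n) => [->|n0].
  rewrite /= ln_1 (_ : ln 0 = 0); last first.
    by rewrite /ln; case: Rlt_dec => // h; have := Rlt_irrefl 0.
  rewrite !Rmult_0_l Rminus_diag Rabs_R0; exact: Mdom_ge0.
have n1 := INR_ge1 n n0.
have := mvt_bound (fun x => ln x * Rpower x (- s)) (fun x =>
  (1 - s * ln x) * Rpower x (- s - 1)) (INR n) (INR n.+1) ((3 + 2 * ln (INR n)) * npow n 2).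
rewrite Rabs_minus_sym -/(npow n s) -/(npow n.+1 s) => h.
apply: Rle_trans (h _ _ _) _.
- by rewrite S_INR; lra.
- move=> x hx; have x0 : 0 < x by lra.
  have := is_derive_mult ln (fun x => Rpower x (- s)) x _ _ (is_derive_ln x x0) (Rpower_derive s
    x x0) Rmult_comm.
  rewrite /mult /= /plus /=.
  have -> : / x * Rpower x (- s) + ln x * (- s * Rpower x (- s - 1)) =
    (1 - s * ln x) * Rpower x (- s - 1) => //.
  have -> : / x * Rpower x (- s) = Rpower x (- s - 1).
    rewrite /Rpower (_ : (- s - 1) * ln x = - s * ln x + - ln x); last by ring.
    by rewrite exp_plus exp_Ropp exp_ln //; ring.
  by ring.
- move=> x hx; rewrite Rabs_mult (Rabs_pos_eq (Rpower _ _)); last by left; exact: exp_pos.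
  apply: Rmult_le_compat; [exact: Rabs_pos|left; exact: exp_pos| |]; last first.
    by apply: Rpower_ge_npow2 => //; lra.
  have lx : ln x <= ln (INR n) + 1.
    rewrite -[1]ln_exp -ln_mult; [|lra|exact: exp_pos].
    apply: ln_le; first lra.
    have := exp_ineq1_le 1; rewrite S_INR in hx; nra.
  have l0 : 0 <= ln x by rewrite -ln_1; apply: ln_le; lra.
  have l1 := ln_INR_ge0 n.
  by apply: Rabs_le; nra.
- by rewrite S_INR /Mdom; have := npow_ge0 n 2; have := ln_npow_ge0 n 2; lra.
Qed.

Section BoundedSums.
Variables (f : nat -> C) (f1 : forall n, Cmod (f n) <= 1).
Variables (K : R) (fK : forall n, Cmod (\csum_(0 <= i < n) f i) <= K).
Let A n := \csum_(0 <= i < n.+1) f i.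

(** L(1) for [f] with bounded partial sums, written after Abel summation so that the
    series converges absolutely. *)
Definition Lser_at1 : C := Csum (fun n => A n * RtoC (npow n 1 - npow n.+1 1))%C.
(** -L'(1), in the same form as [Lser_at1]. *)
Definition Dser_at1 : C :=
  Csum (fun n => A n * RtoC (ln (INR n) * npow n 1 - ln (INR n.+1) * npow n.+1 1))%C.

Let K0 : 0 <= K. Proof. by apply: Rle_trans (fK 0%N); apply: Cmod_ge_0. Qed.

Lemma abel_summable (b : nat -> R) : (forall n, Rabs (b n) <= Mdom n) ->
  Csummable (fun n => A n * b n)%C.
Proof.
move=> bM; apply: Csummable_le (ex_series_scalR K _ ex_series_Mdom) => n.
rewrite Cmod_mult Cmod_R; apply: Rmult_le_compat => //; [exact: Cmod_ge_0|exact: Rabs_pos|exact: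
  fK].
Qed.

Lemma Lser_abel s : 1 < s -> Csum_to (fun n => A n * RtoC (npow n s - npow n.+1 s))%C (Lser f s).
Proof.
move=> s1; apply: (abel f (fun n => npow n s) K _ fK).
  by apply: ex_series_lim_0; apply: ex_series_npow.
by apply: Csummable_ex; apply: Lser_summable.
Qed.

Lemma Dser_abel s : 1 < s ->
  Csum_to (fun n => A n * RtoC (ln (INR n) * npow n s - ln (INR n.+1) * npow n.+1 s))%C (Dser f s).
Proof.
move=> s1; apply: (abel f (fun n => ln (INR n) * npow n s) K _ fK).
  by apply: ex_series_lim_0; apply: ex_series_ln_npow.
by apply: Csummable_ex; apply: Dser_summable.
Qed.

(** In the series of [Lser_abel], the derivative in s of each increment of n^(-s) is an
    increment of ln n n^(-s), hence bounded by [Mdom]. *)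
Lemma Lser_lip s : 1 < s <= 2 -> Cmod (Lser f s - Lser_at1)%C <= K * Series Mdom * (s - 1).
Proof.
move=> hs; have s1 : 1 < s by lra.
have h1 : Csum_to (fun n => A n * RtoC (npow n 1 - npow n.+1 1))%C Lser_at1.
  by apply: Csummable_ex; apply: abel_summable => n; apply: npow_diff; lra.
have := Csum_to_minus _ _ _ _ (Lser_abel s s1) h1.
move=> h; have := Csum_bound _ (fun n => (K * (s - 1)) * Mdom n) _ _ _ h.
rewrite Series_scal_l (_ : K * (s - 1) * Series Mdom = K * Series Mdom * (s - 1)); last by ring.
apply; last by apply: ex_series_scalR; apply: ex_series_Mdom.
move=> n.
have -> : (A n * RtoC (npow n s - npow n.+1 s) - A n * RtoC (npow n 1 - npow n.+1 1) =
  A n * RtoC ((npow n s - npow n.+1 s) - (npow n 1 - npow n.+1 1)))%C.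
  by rewrite !RtoC_minus; ring.
rewrite Cmod_mult Cmod_R Rmult_assoc; apply: Rmult_le_compat;
  [exact: Cmod_ge_0|exact: Rabs_pos|exact: fK|].
rewrite Rmult_comm; apply: (mvt_bound (fun s => npow n s - npow n.+1 s)
  (fun s => - (ln (INR n) * npow n s - ln (INR n.+1) * npow n.+1 s))); first lra.
- move=> x hx.
  have := is_derive_minus _ _ _ _ _ (npow_derive n x) (npow_derive n.+1 x).
  rewrite /minus /plus /opp /=.
  by have -> : - ln (INR n) * npow n x + - (- ln (INR n.+1) * npow n.+1 x) =
    - (ln (INR n) * npow n x - ln (INR n.+1) * npow n.+1 x) by ring.
- by move=> x hx; rewrite Rabs_Ropp; apply: lnpow_diff; lra.
Qed.

Lemma at_right_le2 (P : R -> Prop) : (forall s, 1 < s <= 2 -> P s) -> at_right 1 P.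
Proof.
move=> h; exists (mkposreal 1 Rlt_0_1) => s /=.
rewrite /ball /= /AbsRing_ball /abs /minus /plus /opp /= => /Rabs_def2 hs s1; apply: h; lra.
Qed.

Lemma at_right_lt (e : R) : 0 < e -> at_right 1 (fun s => 1 < s < 1 + e).
Proof.
move=> e0; exists (mkposreal e e0) => s.
rewrite /ball /= /AbsRing_ball /abs /minus /plus /opp /= => /Rabs_def2 hs s1; lra.
Qed.

Lemma Lser_limit : Ccvg (at_right 1) (Lser f) Lser_at1.
Proof.
apply/CcvgP => eps e0; set c := K * Series Mdom.
have c0 : 0 <= c.
  apply: Rmult_le_pos => //; have := rsum_le_Series Mdom 0 Mdom_ge0 ex_series_Mdom.
  by rewrite big_nil.
have h : 0 < Rmin 1 (eps / (c + 1)) by apply: Rmin_glb_lt; [lra|apply: Rdiv_lt_0_compat; lra].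
apply: filter_imp (at_right_lt _ h) => s hs.
have m1 := Rmin_l 1 (eps / (c + 1)); have m2 := Rmin_r 1 (eps / (c + 1)).
apply: Rle_lt_trans (Lser_lip s ltac:(lra)) _; rewrite -/c.
have : (c + 1) * (s - 1) < (c + 1) * (eps / (c + 1)) by apply: Rmult_lt_compat_l; lra.
have -> : (c + 1) * (eps / (c + 1)) = eps by field; lra.
lra.
Qed.

Lemma continuous_at_right (g : R -> R) : ex_derive g 1 ->
  filterlim g (at_right 1) (locally (g 1)).
Proof.
move=> h; have hc := ex_derive_continuous g 1 h.
apply: filterlim_filter_le_1 hc.
by move=> P [e he]; exists e => y hy _; apply: he.
Qed.

Lemma npow_cont n : filterlim (npow n) (at_right 1) (locally (npow n 1)).
Proof. apply: continuous_at_right; exists (- ln (INR n) * npow n 1); exact: npow_derive. Qed.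

Lemma Dser_limit : Ccvg (at_right 1) (Dser f) Dser_at1.
Proof.
have [] // := tannery (F := at_right 1) (fun n => K * Mdom n)
  (fun s n => A n * RtoC (ln (INR n) * npow n s - ln (INR n.+1) * npow n.+1 s))%C
  (fun n => A n * RtoC (ln (INR n) * npow n 1 - ln (INR n.+1) * npow n.+1 1))%C (Dser f).
- by apply: ex_series_scalR; apply: ex_series_Mdom.
- apply: at_right_le2 => s hs n; rewrite Cmod_mult Cmod_R.
  apply: Rmult_le_compat; [exact: Cmod_ge_0|exact: Rabs_pos|exact: fK|apply: lnpow_diff; lra].
- move=> n; apply: Ccvg_mult (Ccvg_const _) _; apply: Ccvg_RtoC.
  apply: (continuous_at_right (fun s => ln (INR n) * npow n s - ln (INR n.+1) * npow n.+1 s)).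
  by rewrite /npow /Rpower; auto_derive.
- apply: at_right_le2 => s hs; apply: Dser_abel; lra.
Qed.
End BoundedSums.

(** * The pole of the zeta function *)

(** The value at 0 is 0 so that the sequence is completely multiplicative and the
    convention on [npow] is harmless. *)
Definition one_seq (n : nat) : C := if n == 0%N then RtoC 0 else RtoC 1.
(** (-1)^(n-1), whose bounded partial sums give access to zeta near 1. *)
Definition alt_seq (n : nat) : C :=
  if n == 0%N then RtoC 0 else if odd n then RtoC 1 else (- (1))%C.

Lemma one_cmul : cmul one_seq.
Proof.
split=> // [m n|n]; rewrite /one_seq.
  by rewrite muln_eq0; case: eqP => _ /=; [ring|case: eqP => _; ring].
by case: eqP => _; rewrite ?Cmod_0 ?Cmod_1; lra.
Qed.

Lemma alt_le1 n : Cmod (alt_seq n) <= 1.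
Proof.
by rewrite /alt_seq; case: eqP => _; [|case: odd]; rewrite ?Cmod_opp ?Cmod_0 ?Cmod_1; lra.
Qed.

Lemma alt_sum n : \csum_(0 <= i < n.+1) alt_seq i = if odd n then RtoC 1 else RtoC 0.
Proof.
elim: n => [|n IH]; first by rewrite big_nat1.
rewrite big_nat_recr //= IH /alt_seq /=.
by case: (odd n) => /=; ring.
Qed.

Lemma alt_sum_le n : Cmod (\csum_(0 <= i < n) alt_seq i) <= 1.
Proof.
case: n => [|n]; first by rewrite big_nil Cmod_0; lra.
by rewrite alt_sum; case: odd; rewrite ?Cmod_0 ?Cmod_1; lra.
Qed.

Definition zeta := Lser one_seq.

Definition even_seq (n : nat) : C := if (2 %| n)%N then one_seq n else RtoC 0.

Lemma alt_even n : alt_seq n = (one_seq n - 2 * even_seq n)%C.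
Proof.
rewrite /alt_seq /even_seq /one_seq dvdn2; case: eqP => _; first by case: odd => /=; ring.
by case: odd => /=; ring.
Qed.

(** zeta minus twice its even part, and the even part is 2^(-s) zeta(s). *)
Lemma Lser_alt s : 1 < s -> Lser alt_seq s = ((1 - 2 * npow 2 s) * zeta s)%C.
Proof.
move=> s1; apply: Csum_unique.
have h1 := Csummable_ex _ (Lser_summable _ (cmul_le1 _ one_cmul) s s1).
rewrite -/(Lser _ _) -/zeta in h1.
have h2 : Csum_to (fun n => even_seq n * npow n s)%C (npow 2 s * zeta s)%C.
  apply: (Csum_multiples 2) => [//|n /negbTE n2|].
    by rewrite /even_seq n2; ring.
  apply: Csum_to_ext (Csum_to_scal (npow 2 s) _ _ h1) => n.
  rewrite /even_seq dvdn_mulr // /one_seq muln_eq0 /=; case: (posnP n) => [->|n0] /=; first ring.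
  by rewrite npow_mult // RtoC_mult; ring.
have := Csum_to_minus _ _ _ _ h1 (Csum_to_scal 2 _ _ h2).
rewrite (_ : zeta s - 2 * (npow 2 s * zeta s) = (1 - 2 * npow 2 s) * zeta s)%C; last by ring.
by apply: Csum_to_ext => n; rewrite alt_even; ring.
Qed.

Lemma Dser_alt s : 1 < s -> Dser alt_seq s =
  ((1 - 2 * npow 2 s) * Dser one_seq s - 2 * npow 2 s * ln 2 * zeta s)%C.
Proof.
move=> s1; apply: Csum_unique.
have h1 := Csummable_ex _ (Lser_summable _ (cmul_le1 _ one_cmul) s s1).
rewrite -/(Lser _ _) -/zeta in h1.
have h2 := Csummable_ex _ (Dser_summable _ (cmul_le1 _ one_cmul) s s1).
rewrite -/(Dser _ _) in h2.
have h3 : Csum_to (fun n => even_seq n * RtoC (ln (INR n) * npow n s))%C (npow 2 s * (ln 2 * zeta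
  s + Dser one_seq s))%C.
  apply: (Csum_multiples 2) => [//|n /negbTE n2|].
    by rewrite /even_seq n2; ring.
  apply: Csum_to_ext (Csum_to_scal (npow 2 s) _ _ (Csum_to_plus _ _ _ _ (Csum_to_scal (ln 2) _ _
    h1) h2)) => n.
  rewrite /even_seq dvdn_mulr // /one_seq muln_eq0 /=; case: (posnP n) => [->|n0] /=; first ring.
  rewrite npow_mult // mult_INR ln_mult; [|by rewrite /=; lra|exact: INR_gt0].
  rewrite (_ : INR 2 = 2) // !(RtoC_mult, RtoC_plus); ring.
have := Csum_to_minus _ _ _ _ h2 (Csum_to_scal 2 _ _ h3).
rewrite (_ : Dser one_seq s - 2 * (npow 2 s * (ln 2 * zeta s + Dser one_seq s)) =
  (1 - 2 * npow 2 s) * Dser one_seq s - 2 * npow 2 s * ln 2 * zeta s)%C; last by ring.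
by apply: Csum_to_ext => n; rewrite alt_even; ring.
Qed.

(** The real parts of the partial sums increase to the real part of the sum. *)
Lemma Csum_Re_ge (a : nat -> C) (l : C) (N : nat) : (forall n, 0 <= Re (a n)) ->
  Csum_to a l -> Re (\csum_(0 <= i < N) a i) <= Re l.
Proof.
move=> a0 /(@Ccvg_proj _ _ _ _ _) [h _].
have mono n : Re (\csum_(0 <= i < n) a i) <= Re (\csum_(0 <= i < n.+1) a i).
  rewrite [X in _ <= Re X]big_nat_recr //=; have := a0 n.
  by rewrite /Re /Cplus /=; lra.
exact: (is_lim_seq_incr_compare _ _ h mono).
Qed.

(** Grouped by Abel summation, the alternating harmonic series has nonnegative terms,
    and its term at n = 1 is 1/2. *)
Lemma Lser_alt_at1_neq0 : Lser_at1 alt_seq <> 0%C.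
Proof.
move=> e.
have h : Csum_to (fun n => (\csum_(0 <= i < n.+1) alt_seq i) * RtoC (npow n 1 - npow n.+1 1))%C
  (Lser_at1 alt_seq).
  apply: Csummable_ex; apply: (abel_summable _ 1 alt_sum_le) => n; apply: npow_diff; lra.
have nn n : 0 <= Re ((\csum_(0 <= i < n.+1) alt_seq i) * RtoC (npow n 1 - npow n.+1 1))%C.
  case: (posnP n) => [->|n0]; first by rewrite alt_sum /= Rmult_0_l; lra.
  have : npow n.+1 1 <= npow n 1 by apply: npow_anti => //; lra.
  by rewrite alt_sum; case: odd => /=; lra.
have := Csum_Re_ge _ _ 2 nn h.
rewrite e big_nat_recr // big_nat1 !alt_sum npow1 (npow_s1 2) //=.
lra.
Qed.

Lemma exp_taylor2 u : 0 <= u <= 1 -> Rabs (exp u - 1 - u - u * u / 2) <= 3 * u * u * u.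
Proof.
move=> hu.
have h1 v : 0 <= v <= u -> Rabs (exp v - 1) <= 3 * u.
  move=> hv; rewrite -{1}exp_0; apply: Rle_trans (mvt_bound exp exp 0 v 3 _ _ _) _; try lra.
    by move=> x _; apply: is_derive_exp.
  move=> x hx; rewrite Rabs_pos_eq; last by left; exact: exp_pos.
  by apply: Rle_trans exp_le_3; apply: exp_mono; lra.
have h2 v : 0 <= v <= u -> Rabs (exp v - 1 - v) <= 3 * u * u.
  move=> hv; have := mvt_bound (fun v => exp v - 1 - v) (fun v => exp v - 1) 0 v (3 * u).
  rewrite exp_0 (_ : exp v - 1 - v - (1 - 1 - 0) = exp v - 1 - v); last by ring.
  move=> h; apply: Rle_trans (h _ _ _) _; [lra| | |].
  - by move=> x _; auto_derive => //; ring.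
  - by move=> x hx; apply: h1; lra.
  - by apply: Rmult_le_compat_l; lra.
have := mvt_bound (fun v => exp v - 1 - v - v * v / 2) (fun v => exp v - 1 - v) 0 u (3 * u * u).
rewrite exp_0 (_ : exp u - 1 - u - u * u / 2 - (1 - 1 - 0 - 0 * 0 / 2) =
  exp u - 1 - u - u * u / 2); last by field.
move=> h; apply: Rle_trans (h _ _ _) _; [lra| | |lra].
- by move=> x _; auto_derive => //; field.
- by move=> x hx; apply: h2; lra.
Qed.

(** 1/(e^u - 1) = 1/u - 1/2 + O(u), the regular part of the pole of the factor 2^(1-s) /
    (1 - 2^(1-s)) below. *)
Lemma bernoulli_limit u : 0 < u <= 1 -> Rabs (/ (exp u - 1) - / u + / 2) <= 5 * u.
Proof.
move=> hu; have := exp_taylor2 u ltac:(lra).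
have E := exp_ineq1_le u.
set r := exp u - 1 - u - u * u / 2 => hr.
have e : exp u - 1 = u + u * u / 2 + r by rewrite /r; field.
rewrite e in E *; set D := u + u * u / 2 + r.
have D0 : u <= D by rewrite /D -e; lra.
have -> : / D - / u + / 2 = (- 2 * r + u * u * u / 2 + u * r) / (2 * u * D).
  by rewrite /D; field; split; rewrite /D in D0; lra.
have p : 0 < 2 * u * D by apply: Rmult_lt_0_compat; lra.
rewrite Rabs_div; last lra.
rewrite (Rabs_pos_eq (2 * u * D)); last lra.
apply: (Rmult_le_reg_r (2 * u * D)) => //.
rewrite /Rdiv Rmult_assoc Rinv_l ?Rmult_1_r; last lra.
have u2 : 0 < u * u by nra.
have u3 : 0 < u * u * u by nra.
move/Rabs_le_between: hr => hr.
have ur : - (u * u * u * 3) <= u * r <= u * u * u * 3 by nra.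
apply: Rle_trans (_ : 10 * (u * u * u) <= _); first by apply: Rabs_le; lra.
have : u * u * u <= u * u * D by apply: Rmult_le_compat_l; lra.
lra.
Qed.

(** At 1+, [phi] has a simple pole of residue [kappa] (none if [kappa = 0]) and a
    constant term; this is the form in which Euler constants exist. *)
Definition has_pole (kappa : C) (phi : R -> C) : Prop :=
  exists l : C, Ccvg (at_right 1) (fun s => phi s - kappa / RtoC (s - 1))%C l.

Lemma ln2_bounds : / 2 < ln 2 < 1.
Proof.
split; first exact: ln_lt_2.
rewrite -[X in _ < X]ln_exp; apply: ln_increasing; first lra.
by have := exp_ineq1 1; lra.
Qed.

Lemma npow2_exp s : 2 * npow 2 s = / exp ((s - 1) * ln 2).
Proof.
rewrite -{1}(exp_ln 2); last lra.
rewrite npowE /= -exp_plus -exp_Ropp; congr exp; rewrite (_ : 1 + 1 = 2) //; ring.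
Qed.

(** From (1-q) zeta = L(alt) and its derivative, with q = 2^(1-s): -zeta'/zeta =
    D(alt)/L(alt) + ln 2 q/(1-q). The first term has a limit at 1 since L(alt) does not
    vanish there, and the second equals ln 2 / (e^u - 1) with u = (s-1) ln 2. *)
Lemma Qser_one_pole : has_pole 1 (Qser one_seq).
Proof.
exists (Dser_at1 alt_seq / Lser_at1 alt_seq + RtoC (ln 2 * - / 2))%C.
have hL := Lser_limit alt_seq alt_le1 1 alt_sum_le.
have hD := Dser_limit alt_seq alt_le1 1 alt_sum_le.
have hq : filterlim (fun s => ln 2 * (/ (exp ((s - 1) * ln 2) - 1) - / ((s - 1) * ln 2)))
  (at_right 1) (locally (ln 2 * - / 2)).
  apply/filterlim_locally => -[eps e0].
  have h : 0 < Rmin 1 (eps / 5) by apply: Rmin_glb_lt; lra.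
  apply: filter_imp (at_right_lt _ h) => s hs.
  have m1 := Rmin_l 1 (eps / 5); have m2 := Rmin_r 1 (eps / 5).
  rewrite /ball /= /AbsRing_ball /abs /minus /plus /opp /= -Ropp_mult_distr_r Ropp_involutive
    -Rmult_plus_distr_l Rabs_mult.
  have l2 := ln2_bounds.
  have := bernoulli_limit ((s - 1) * ln 2) ltac:(nra).
  rewrite (Rabs_pos_eq (ln 2)); last lra.
  set X := Rabs _ => hX; have X0 : 0 <= X by apply: Rabs_pos.
  nra.
have := Ccvg_plus _ _ _ _ (Ccvg_mult _ _ _ _ hD (Ccvg_inv _ _ Lser_alt_at1_neq0 hL)) (Ccvg_RtoC _
  _ hq).
move=> h; apply: Ccvg_ext (h _ _ _ _).
have /CcvgP/(_ (Cmod (Lser_at1 alt_seq)) (proj1 (Cmod_gt_0 _) Lser_alt_at1_neq0)) near := hL.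
apply: filter_imp (filter_and _ _ near (at_right_lt 1 Rlt_0_1)) => s [hs s1].
have L0 : Lser alt_seq s <> 0%C.
  move=> e; move: hs; rewrite e (_ : 0 - Lser_at1 alt_seq = - Lser_at1 alt_seq)%C; last by ring.
  by rewrite Cmod_opp; lra.
have eL := Lser_alt s ltac:(lra); have eD := Dser_alt s ltac:(lra).
have eQ := Lser_mul_Qser one_seq one_cmul s ltac:(lra); rewrite -/zeta in eQ.
have l2 := ln2_bounds.
set E := exp ((s - 1) * ln 2).
have E1 : 1 < E by have := exp_ineq1 ((s - 1) * ln 2); rewrite -/E; nra.
have eq : (2 * npow 2 s = / E)%C.
  by rewrite -RtoC_mult npow2_exp -/E RtoC_inv //; lra.
rewrite eq in eL eD.
have E0 : RtoC E <> 0%C by move/RtoC_inj; lra.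
have E10 : (RtoC E - 1)%C <> 0%C by rewrite -RtoC_minus; move/RtoC_inj; lra.
have z0 : zeta s <> 0%C by move=> z0; apply: L0; rewrite eL z0; ring.
have -> : RtoC (ln 2 * (/ (E - 1) - / ((s - 1) * ln 2))) =
  (ln 2 * (/ (RtoC E - 1) - / (RtoC (s - 1) * ln 2)))%C.
  rewrite RtoC_mult RtoC_minus RtoC_inv; last lra.
  by rewrite RtoC_inv ?RtoC_mult ?RtoC_minus //; nra.
rewrite eD eL -eQ.
have s10 : RtoC (s - 1) <> 0%C by move/RtoC_inj; lra.
have ln20 : RtoC (ln 2) <> 0%C by move/RtoC_inj; lra.
field; do ! split=> //.
Qed.

(** (1 - 2^(1-s)) zeta(s) is bounded near 1, while 1 - 2^(1-s) is at least a multiple of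
    s-1. *)
Lemma zeta_bound : exists K, forall s, 1 < s <= 2 -> (s - 1) * Cmod (zeta s) <= K.
Proof.
pose K := Cmod (Lser_at1 alt_seq) + Series Mdom.
exists (4 * K) => s hs.
have eL := Lser_alt s ltac:(lra).
have h := Lser_lip alt_seq alt_le1 1 alt_sum_le s hs.
have S0 : 0 <= Series Mdom.
  by have := rsum_le_Series Mdom 0 Mdom_ge0 ex_series_Mdom; rewrite big_nil.
have hK : Cmod (Lser alt_seq s) <= K.
  have := Cmod_triangle (Lser alt_seq s - Lser_at1 alt_seq) (Lser_at1 alt_seq).
  rewrite (_ : Lser alt_seq s - Lser_at1 alt_seq + Lser_at1 alt_seq = Lser alt_seq s)%C;
    last by ring.
  rewrite /K; nra.
rewrite eL Cmod_mult -RtoC_mult -RtoC_minus npow2_exp Cmod_R in hK.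
have l2 := ln2_bounds.
set u := (s - 1) * ln 2 in hK.
have u0 : 0 < u <= 1 by rewrite /u; nra.
have e1 := exp_ineq1_le u.
have h1 : u / 2 <= 1 - / exp u.
  have : / exp u <= / (1 + u) by apply: Rinv_le_contravar; lra.
  have : / (1 + u) <= 1 - u / 2.
    apply: (Rmult_le_reg_l (1 + u)); first lra.
    by rewrite Rinv_r; nra.
  lra.
have h2 : (s - 1) / 4 <= 1 - / exp u.
  have : (s - 1) / 2 <= u by rewrite /u; nra.
  lra.
rewrite Rabs_pos_eq in hK; last lra.
have := Rmult_le_compat_r _ _ _ (Cmod_ge_0 (zeta s)) h2; lra.
Qed.

(** * Nonvanishing at 1: non-real characters *)

Lemma Csum_geom (w : C) : Cmod w < 1 -> Csum_to (fun k => Cpow w k.+1) (w / (1 - w))%C.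
Proof.
move=> w1.
have w0 : (1 - w)%C <> 0%C.
  move=> e; have : w = 1%C by rewrite -[w]Cplus_0_r -e; ring.
  by move=> ew; rewrite ew Cmod_1 in w1; lra.
have e N : \csum_(0 <= k < N) Cpow w k.+1 = (w / (1 - w) - w / (1 - w) * Cpow w N)%C.
  elim: N => [|N IH]; first by rewrite big_nil /=; field.
  by rewrite big_nat_recr //= IH; field.
have h : Ccvg eventually (fun N => Cpow w N) 0%C.
  apply/CcvgP => eps e0.
  have /is_lim_seq_geom/filterlim_locally/(_ (mkposreal eps e0)) [N HN] : Rabs (Cmod w) < 1.
    by rewrite Rabs_pos_eq //; apply: Cmod_ge_0.
  exists N => n nN; have -> : (Cpow w n - 0 = Cpow w n)%C by ring.
  rewrite Cmod_pow; have := HN n nN.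
  rewrite /ball /= /AbsRing_ball /abs /minus /plus /opp /= Ropp_0 Rplus_0_r Rabs_pos_eq //.
  by apply: pow_le; apply: Cmod_ge_0.
pose proof (Ccvg_minus _ _ _ _ (Ccvg_const (w / (1 - w))%C) (Ccvg_mult _ _ _ _ (Ccvg_const (w /
  (1 - w))%C) h)) as h1.
rewrite (_ : w / (1 - w) - w / (1 - w) * 0 = w / (1 - w))%C in h1; last by ring.
by apply: Ccvg_ext h1; apply: filter_forall => N; rewrite e.
Qed.

Lemma Re_plus (a b : C) : Re (a + b)%C = Re a + Re b. Proof. by []. Qed.
Lemma Re_scal (r : R) (a : C) : Re (r * a)%C = r * Re a.
Proof. by rewrite /Re /Cmult /RtoC /=; ring. Qed.

Lemma Re_csum_recr (g : nat -> C) n :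
  Re (\csum_(0 <= i < n.+1) g i) = Re (\csum_(0 <= i < n) g i) + Re (g n).
Proof. by rewrite big_nat_recr. Qed.

Lemma cmul_sqr f : cmul f -> cmul (fun n => f n * f n)%C.
Proof.
move=> cf; split.
- by rewrite cmul0 //; ring.
- by rewrite cmul1 //; ring.
- by move=> m n; rewrite cmulM //; ring.
- by move=> n; rewrite Cmod_mult; have := cmul_le1 f cf n; have := Cmod_ge_0 (f n); nra.
Qed.

(** For w = z^k in the unit disc, 3 + 4 Re w + Re w^2 >= 2 (1 + Re w)^2. *)
Lemma three_four_one (z : C) (k : nat) : Cmod z <= 1 ->
  0 <= 3 + 4 * Re (Cpow z k) + Re (Cpow (z * z) k).
Proof.
move=> z1; rewrite Cpow_mult_l.
have : Cmod (Cpow z k) <= 1.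
  rewrite Cmod_pow; rewrite -[X in _ <= X](pow1 k); apply: pow_incr; split=> //; exact: Cmod_ge_0.
set w := Cpow z k => w1; have w0 := Cmod_ge_0 w.
have := Cmod2_alt w; rewrite /Re /Im /Cmult [fst (_, _)]/=.
set x := fst w; set y := snd w => e.
have h : x * x + y * y <= 1 by have : Cmod w ^ 2 <= 1; [nra|rewrite e; lra].
have := pow2_ge_0 (x + 1); nra.
Qed.

Section ThreeFourOne.
Variables (f : nat -> C) (cf : cmul f).
Let g := (fun n => f n * f n)%C.
Let cg : cmul g := cmul_sqr f cf.

(** Expanding w/(1-w) as a geometric series exhibits the powers f(p)^k to which
    [three_four_one] applies. *)
Lemma Qterm_series h s p : (forall n, Cmod (h n) <= 1) -> prime p -> 1 <= s ->
  Csum_to (fun k => RtoC (ln (INR p) * npow p s ^ k.+1) * Cpow (h p) k.+1)%C (Qterm h s p).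
Proof.
move=> h1 pp s1; rewrite /Qterm pp.
have w := Cmod_fp h h1 p s pp s1.
apply: Csum_to_ext (Csum_to_scal (ln (INR p)) _ _ (Csum_geom (h p * npow p s) _)) => [n|]; last lra.
by rewrite RtoC_mult RtoC_pow Cpow_mult_l; ring.
Qed.

Lemma Qterm_three_four_one s p : 1 <= s ->
  0 <= Re (3 * Qterm one_seq s p + (4 * Qterm f s p + Qterm g s p))%C.
Proof.
move=> s1; case: (boolP (prime p)) => pp; last first.
  by rewrite /Qterm (negbTE pp) /=; lra.
have o1 := cmul_le1 _ one_cmul; have f1 := cmul_le1 _ cf; have g1 := cmul_le1 _ cg.
have := Csum_to_plus _ _ _ _ (Csum_to_scal 3 _ _ (Qterm_series _ s p o1 pp s1))
  (Csum_to_plus _ _ _ _ (Csum_to_scal 4 _ _ (Qterm_series _ s p f1 pp s1)) (Qterm_series _ s p g1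
    pp s1)).
move=> h; have := Csum_Re_ge _ _ 0 _ h; rewrite big_nil; apply=> k.
have -> : one_seq p = 1%C by rewrite /one_seq; case: eqP pp => // ->.
rewrite Cpow_1_l !Re_plus !Re_scal.
set c := ln (INR p) * npow p s ^ k.+1.
have c0 : 0 <= c by apply: Rmult_le_pos; [apply: ln_INR_ge0|apply: pow_le; apply: npow_ge0].
have := three_four_one (f p) k.+1 (f1 p); rewrite /g -[Re (RtoC 1)]/1; nra.
Qed.

Lemma Qser_three_four_one s : 1 < s ->
  0 <= 3 * Re (Qser one_seq s) + 4 * Re (Qser f s) + Re (Qser g s).
Proof.
move=> s1; have o1 := cmul_le1 _ one_cmul; have f1 := cmul_le1 _ cf; have g1 := cmul_le1 _ cg.
have h a (a1 : forall n, Cmod (a n) <= 1) := Csummable_ex _ (Qser_summable a a1 s s1).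
have := Csum_to_plus _ _ _ _ (Csum_to_scal 3 _ _ (h _ o1)) (Csum_to_plus _ _ _ _ (Csum_to_scal 4
  _ _ (h _ f1)) (h _ g1)).
move=> hh; have := Csum_Re_ge _ _ 0 _ hh; rewrite big_nil => /(_ _)/Wrap [n|].
  by apply: Qterm_three_four_one; lra.
by rewrite !Re_plus !Re_scal -/(Qser _ _) -/(Qser _ _) -/(Qser _ _) -[Re (RtoC 0)]/0; lra.
Qed.
End ThreeFourOne.

(** The derivative of |L|^2 is -2 Re (conj(L) D), and D = L Q; no division by L is
    involved, so zeros of L are allowed. *)
Lemma Cmod_sqr_derive f s : cmul f -> 1 < s ->
  is_derive (fun t => Cmod (Lser f t) ^ 2) s (- 2 * Re (Qser f s) * Cmod (Lser f s) ^ 2).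
Proof.
move=> cf s1.
have [h1 h2] := Cderiv_is_derive _ _ _ (Lser_derive f s (cmul_le1 f cf) s1).
have e := Lser_mul_Qser f cf s s1.
have eq t : Re (Lser f t) * Re (Lser f t) + Im (Lser f t) * Im (Lser f t) = Cmod (Lser f t) ^ 2.
  by rewrite Cmod2_alt; ring.
apply: (is_derive_ext _ _ _ _ eq).
rewrite (_ : - 2 * Re (Qser f s) * Cmod (Lser f s) ^ 2 =
  (Re (- Dser f s) * Re (Lser f s) + Re (Lser f s) * Re (- Dser f s)) +
  (Im (- Dser f s) * Im (Lser f s) + Im (Lser f s) * Im (- Dser f s))).
  apply: (is_derive_plus (V := R_NormedModule)); exact: (Derive.is_derive_mult _ _ _ _ _ _ _).
rewrite -e Cmod2_alt; move: (Lser f s) (Qser f s) => [a b] [c d].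
rewrite /Re /Im /Cmult /Copp /=; ring.
Qed.

(** 1/n^2 <= 1/(n - 1/2) - 1/(n + 1/2), so that the sum telescopes. *)
Lemma npow2_sum N : \rsum_(2 <= i < N.+2) npow i 2 <= 2 / 3 - / (INR N + 3 / 2).
Proof.
elim: N => [|N IH]; first by rewrite big_geq //= Rplus_0_l; lra.
rewrite big_nat_recr //=; apply: Rle_trans (Rplus_le_compat_r _ _ _ IH) _.
have -> : npow N.+2 2 = / INR N.+2 * / INR N.+2.
  by rewrite (_ : 2 = 1 + 1) // npow_add npow_s1.
rewrite S_INR S_INR -/(INR N.+1) S_INR.
have n0 := pos_INR N; set n := INR N in n0 *.
suff : / (n + 1 + 1) * / (n + 1 + 1) <= / (n + 3 / 2) - / (n + 1 + 3 / 2) by lra.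
have -> : / (n + 3 / 2) - / (n + 1 + 3 / 2) = / ((n + 3 / 2) * (n + 1 + 3 / 2)) by field; lra.
rewrite -Rinv_mult; apply: Rinv_le_contravar; nra.
Qed.

(** |L(2) - 1| <= zeta(2) - 1 < 1. *)
Lemma Lser2_neq0 f : cmul f -> 0 < Cmod (Lser f 2).
Proof.
move=> cf.
have h := Csummable_ex _ (Lser_summable f (cmul_le1 f cf) 2 ltac:(lra)).
have := Ccvg_le_locally _ _ 1%C (2 / 3) 2 h _; rewrite -/(Lser f 2).
move=> /(_ _)/Wrap [[//|[//|n]] _|hL].
  rewrite big_ltn // big_ltn // cmul0 // cmul1 // npow1.
  set X := \csum_(2 <= i < n.+2) _.
  have -> : (0 * npow 0 2 + (1 * 1 + X) - 1 = X)%C by ring.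
  apply: Rle_trans (Cmod_sum _ _ _ _) _.
  apply: Rle_trans (rsum_le _ _ _ _ (fun i => npow i 2) _) _ => [i _|].
    by apply: Cmod_le1_mult; [apply: (cmul_le1 f cf)|apply: npow_ge0].
  apply: Rle_trans (npow2_sum n) _.
  have : 0 < / (INR n + 3 / 2) by apply: Rinv_0_lt_compat; have := pos_INR n; lra.
  lra.
have := Cmod_triangle (Lser f 2) (- (Lser f 2 - 1)).
have -> : (Lser f 2 + - (Lser f 2 - 1) = 1)%C by ring.
rewrite Cmod_opp Cmod_1; lra.
Qed.

(** P = |zeta|^6 |L(f)|^8 |L(f^2)|^2 has logarithmic derivative -2 Re (3 Q_1 + 4 Q_f +
    Q_{f^2}) <= 0, so P(s) >= P(2) > 0 for 1 < s <= 2. If L(f) vanished at 1 it would be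
    O(s-1); as zeta is O(1/(s-1)) and L(f^2) is bounded, P would be O((s-1)^2). *)
Lemma nonvanish_complex f K K2 : cmul f ->
  (forall n, Cmod (\csum_(0 <= i < n) f i) <= K) ->
  (forall n, Cmod (\csum_(0 <= i < n) (f i * f i)%C) <= K2) ->
  Lser_at1 f <> 0%C.
Proof.
move=> cf fK gK L0.
have cg := cmul_sqr f cf; set g := (fun n => f n * f n)%C in cg gK.
pose P s := (Cmod (zeta s) ^ 2) ^ 3 * ((Cmod (Lser f s) ^ 2) ^ 4 * Cmod (Lser g s) ^ 2).
have P2 : 0 < P 2.
  have o := Lser2_neq0 _ one_cmul; have a := Lser2_neq0 _ cf; have b := Lser2_neq0 _ cg.
  by rewrite /P /zeta; do ! apply: Rmult_lt_0_compat => //; try lra; do ! apply: pow_lt.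
have dP s : 1 < s -> is_derive P s (- 2 * P s * (3 * Re (Qser one_seq s) + 4 * Re (Qser f s) + Re
  (Qser g s))).
  move=> s1.
  have d1 := Cmod_sqr_derive _ s one_cmul s1; rewrite -/zeta in d1.
  have d2 := Cmod_sqr_derive _ s cf s1.
  have d3 := Cmod_sqr_derive _ s cg s1.
  rewrite /P; set a := (fun t => Cmod (zeta t) ^ 2) in d1 *.
  set b := (fun t => Cmod (Lser f t) ^ 2) in d2 *.
  set c := (fun t => Cmod (Lser g t) ^ 2) in d3 *.
  change (is_derive (fun s => a s ^ 3 * (b s ^ 4 * c s)) s
    (- 2 * (a s ^ 3 * (b s ^ 4 * c s)) * (3 * Re (Qser one_seq s) + 4 * Re (Qser f s) + Re (Qser
      g s)))).
  auto_derive; first by do ! split; eexists; eassumption.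
  have -> : Derive (fun x => a x) s = - 2 * Re (Qser one_seq s) * a s by apply: is_derive_unique.
  have -> : Derive (fun x => b x) s = - 2 * Re (Qser f s) * b s by apply: is_derive_unique.
  have -> : Derive (fun x => c x) s = - 2 * Re (Qser g s) * c s by apply: is_derive_unique.
  ring.
have P0 s : 0 <= P s.
  by rewrite /P; do ! apply: Rmult_le_pos; do ? apply: pow_le; try exact: Cmod_ge_0; lra.
have mono s : 1 < s <= 2 -> P 2 <= P s.
  move=> hs.
  have [x|x|c [hc e]] := MVT_gen P s 2 (fun s => - 2 * P s * (3 * Re (Qser one_seq s) + 4 * Re
    (Qser f s) + Re (Qser g s))); rewrite ?Rmin_left ?Rmax_right //; try lra.
  - by move=> hx; apply: dP; lra.
  - move=> hx; apply: derivable_continuous_pt; apply: ex_derive_Reals_0.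
    by eexists; apply: dP; lra.
  rewrite Rmin_left ?Rmax_right in hc; try lra.
  have := Qser_three_four_one f cf c ltac:(lra); rewrite -/g => q.
  have : 0 <= P c * (3 * Re (Qser one_seq c) + 4 * Re (Qser f c) + Re (Qser g c)) by apply:
    Rmult_le_pos.
  set X := P c * _ => X0; have -> : P s = P 2 + 2 * X * (2 - s) by rewrite /X; lra.
  have : 0 <= X * (2 - s) by apply: Rmult_le_pos; lra.
  lra.
have [Kz hz] := zeta_bound.
have hf s (hs : 1 < s <= 2) : Cmod (Lser f s) <= K * Series Mdom * (s - 1).
  have := Lser_lip f (cmul_le1 f cf) K fK s hs; rewrite L0.
  by rewrite (_ : Lser f s - 0 = Lser f s)%C; last by ring.
have S0 : 0 <= Series Mdom.
  by have := rsum_le_Series Mdom 0 Mdom_ge0 ex_series_Mdom; rewrite big_nil.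
have hg s (hs : 1 < s <= 2) : Cmod (Lser g s) <= Cmod (Lser_at1 g) + K2 * Series Mdom.
  have := Lser_lip g (cmul_le1 g cg) K2 gK s hs.
  have := Cmod_triangle (Lser g s - Lser_at1 g) (Lser_at1 g).
  rewrite (_ : Lser g s - Lser_at1 g + Lser_at1 g = Lser g s)%C; last by ring.
  have K20 : 0 <= K2 by have := gK 0%N; rewrite big_nil Cmod_0.
  have : 0 <= K2 * Series Mdom by apply: Rmult_le_pos.
  nra.
set C1 := K * Series Mdom in hf; set C2 := _ + _ in hg.
pose C := Kz ^ 6 * (C1 ^ 8 * C2 ^ 2).
have key s : 1 < s <= 2 -> P 2 <= C * (s - 1) ^ 2.
  move=> hs; apply: Rle_trans (mono s hs) _.
  apply: (Rmult_le_reg_l ((s - 1) ^ 6)); first by apply: pow_lt; lra.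
  have -> : (s - 1) ^ 6 * P s = ((s - 1) * Cmod (zeta s)) ^ 6 * (Cmod (Lser f s) ^ 8 * Cmod (Lser
    g s) ^ 2).
    by rewrite /P; ring.
  have -> : (s - 1) ^ 6 * (C * (s - 1) ^ 2) = Kz ^ 6 * ((C1 * (s - 1)) ^ 8 * C2 ^ 2).
    by rewrite /C; ring.
  have z0 : 0 <= (s - 1) * Cmod (zeta s) by apply: Rmult_le_pos; [lra|exact: Cmod_ge_0].
  have F0 := Cmod_ge_0 (Lser f s); have G0 := Cmod_ge_0 (Lser g s).
  apply: Rmult_le_compat; [exact: pow_le| | |].
  - by apply: Rmult_le_pos; apply: pow_le.
  - by apply: pow_incr; split=> //; apply: hz.
  apply: Rmult_le_compat; [exact: pow_le|exact: pow_le| |].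
  - by apply: pow_incr; split=> //; apply: hf.
  - by apply: pow_incr; split=> //; apply: hg.
have C0 : 0 < C.
  have := key 2 ltac:(lra); nra.
(* At s = 1 + dl the bound [key] is at most [P 2 / 2]. *)
pose dl := Rmin 1 (P 2 / (2 * C)).
have d0 : 0 < dl by apply: Rmin_glb_lt; [lra|apply: Rdiv_lt_0_compat; lra].
have d1 : dl <= 1 by apply: Rmin_l.
have d2 : dl <= P 2 / (2 * C) by apply: Rmin_r.
have := key (1 + dl) ltac:(lra).
have -> : 1 + dl - 1 = dl by ring.
have : C * dl <= C * (P 2 / (2 * C)) by apply: Rmult_le_compat_l; lra.
have -> : C * (P 2 / (2 * C)) = P 2 / 2 by field; lra.
have : C * dl ^ 2 <= C * dl by apply: Rmult_le_compat_l; nra.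
lra.
Qed.

(** * Divisor sums of a real character *)

Section RealCharacter.
Variables (f : nat -> C) (r : nat -> R) (cf : cmul f).
Hypothesis f_real : forall n, f n = RtoC (r n).
Hypothesis r_values : forall n, r n = 0 \/ r n = 1 \/ r n = -1.

(** The coefficient of n^(-s) in zeta L, for the real-valued sequence [r]. *)
Definition rdiv (n : nat) : R := \big[Rplus/0]_(d <- divisors n) r d.

Lemma r_mul m n : r (m * n)%N = r m * r n.
Proof. by apply: RtoC_inj; rewrite RtoC_mult -!f_real cmulM. Qed.

Lemma r_one : r 1%N = 1.
Proof. by apply: RtoC_inj; rewrite -f_real cmul1. Qed.

Lemma r_pow p k : r (p ^ k)%N = r p ^ k.
Proof. by elim: k => [|k IH]; [rewrite r_one|rewrite expnS r_mul IH]. Qed.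

(** Unique factorisation d = p^j d' of a divisor d of p^k M, with j the exponent of p in
    d. *)
Lemma divisors_pfactor p k M : prime p -> (0 < M)%N -> ~~ (p %| M)%N ->
  perm_eq (divisors (p ^ k * M)) [seq (p ^ j * d)%N | j <- iota 0 k.+1, d <- divisors M].
Proof.
move=> pp M0 pM; have p0 := prime_gt0 pp.
have pk0 i : (0 < p ^ i)%N by rewrite expn_gt0 p0.
have lg j d : d \in divisors M -> logn p (p ^ j * d)%N = j.
  rewrite -dvdn_divisors // => dM; have d0 := dvdn_gt0 M0 dM.
  rewrite lognM // pfactorK // [logn p d]lognE pp d0 /=.
  case: ifP => [pd|_]; last by rewrite addn0.
  by rewrite (dvdn_trans pd dM) in pM.
apply: uniq_perm; first exact: divisors_uniq.
  apply: allpairs_uniq; [exact: iota_uniq|exact: divisors_uniq|].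
  move=> u v hu hv; case/allpairsP: hu => -[a b] [/= _ hb ->].
  case/allpairsP: hv => -[a' b'] [/= _ hb' ->] e.
  have ej : a = a' by rewrite -(lg a b hb) e lg.
  move: e; rewrite ej => /eqP; rewrite eqn_pmul2l // => /eqP ->; by [].
move=> x; rewrite -dvdn_divisors ?muln_gt0 ?pk0 //.
apply/idP/allpairsP => [xd|[[j d] [hj hd ->]]]; last first.
  rewrite mem_iota add0n ltnS /= in hj; rewrite -dvdn_divisors //= in hd.
  by apply: dvdn_mul => //; apply: dvdn_exp2l.
have x0 : (0 < x)%N by apply: dvdn_gt0 xd; rewrite muln_gt0 pk0.
have [m mc e] := pfactor_coprime pp x0.
exists (logn p x, m); split; last by rewrite /= mulnC.
  rewrite mem_iota add0n ltnS /=.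
  have := dvdn_leq_log p _ xd; rewrite muln_gt0 pk0 M0 lognM // pfactorK // => /(_ isT).
  by rewrite [logn p M]lognE pp M0 (negbTE pM) /= addn0.
rewrite -dvdn_divisors //.
have : (m %| p ^ k * M)%N by apply: dvdn_trans xd; rewrite e dvdn_mulr.
by rewrite Gauss_dvdr // coprimeXr // coprime_sym.
Qed.

Lemma rdiv_pfactor p k M : prime p -> (0 < M)%N -> ~~ (p %| M)%N ->
  rdiv (p ^ k * M) = (\rsum_(0 <= j < k.+1) r p ^ j) * rdiv M.
Proof.
move=> pp M0 pM; rewrite /rdiv (perm_big _ (divisors_pfactor p k M pp M0 pM)).
rewrite big_allpairs_dep /index_iota subn0.
elim: (iota 0 k.+1) => [|j s IH]; first by rewrite !big_nil Rmult_0_l.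
rewrite !big_cons IH Rmult_plus_distr_r; congr Rplus.
elim: (divisors M) => [|d l IHd]; first by rewrite !big_nil Rmult_0_r.
by rewrite !big_cons IHd r_mul r_pow /=; ring.
Qed.

Lemma sign_geometric_sum x k : x = 0 \/ x = 1 \/ x = -1 ->
  0 <= \rsum_(0 <= j < k.+1) x ^ j /\ (~~ odd k -> 1 <= \rsum_(0 <= j < k.+1) x ^ j).
Proof.
case=> [->|[->|->]].
- have -> : \rsum_(0 <= j < k.+1) 0 ^ j = 1.
    rewrite big_ltn //= big1_seq ?Rplus_0_r // => j; rewrite mem_index_iota =>
      /andP [_ /andP [j0 _]].
    by rewrite pow_i //; apply/ltP.
  by split=> // *; lra.
- have h : 1 <= \rsum_(0 <= j < k.+1) 1 ^ j.
    rewrite big_ltn //=; have := rsum_ge0 _ (index_iota 1 k.+1) xpredT (fun j => 1 ^ j).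
    by move=> h; have := h ltac:(move=> i _; rewrite pow1; lra); lra.
  by split=> // *; lra.
- have -> : \rsum_(0 <= j < k.+1) (-1) ^ j = if odd k then 0 else 1.
    elim: k => [|k IH]; first by rewrite big_nat1.
    rewrite big_nat_recr //= {}IH.
    suff -> : (-1) ^ k = if odd k then -1 else 1 by case: odd => /=; lra.
    by elim: k => [|k IH] //=; rewrite IH; case: odd => /=; lra.
  by case: odd; split=> //; lra.
Qed.

Lemma pdiv_decomp n : (1 < n)%N -> exists p k M,
  [/\ prime p, (0 < M < n)%N, ~~ (p %| M)%N & n = (p ^ k * M)%N].
Proof.
move=> n1; have n0 := ltnW n1; have pp := pdiv_prime n1.
have [m mc e] := pfactor_coprime pp n0.
exists (pdiv n), (logn (pdiv n) n), m; split=> //; last by rewrite mulnC.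
- have m0 : (0 < m)%N by case: posnP e => // -> ; rewrite mul0n => e0; rewrite e0 in n0.
  rewrite m0 /= [X in (_ < X)%N]e ltn_Pmulr // -{1}(expn0 (pdiv n)) ltn_exp2l ?prime_gt1 //.
  by rewrite logn_gt0 mem_primes pp n0 pdiv_dvd.
- by rewrite -prime_coprime.
Qed.

Lemma rdiv_one : rdiv 1 = 1.
Proof. by rewrite /rdiv big_seq1 r_one. Qed.

(** By multiplicativity the sum is a product, over the primes, of factors 1 + x + ... +
    x^k where x is 0, 1 or -1. *)
Lemma rdiv_ge0 n : (0 < n)%N -> 0 <= rdiv n.
Proof.
have [b] := ubnP n; elim: b n => // b IH n nb n0.
case: (ltngtP n 1) => [|n1|->]; [by rewrite ltnS leqn0 => /eqP e;
  rewrite e in n0| |rewrite rdiv_one; lra].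
have [p [k [M [pp /andP [M0 Mn] pM e]]]] := pdiv_decomp n n1.
rewrite e rdiv_pfactor //; apply: Rmult_le_pos; first by have [] :=
  sign_geometric_sum (r p) k (r_values p).
by apply: IH => //; apply: leq_trans Mn _.
Qed.

(** For a square all exponents k are even, so that all factors are at least 1. *)
Lemma rdiv_square m : (0 < m)%N -> 1 <= rdiv (m * m).
Proof.
have [b] := ubnP m; elim: b m => // b IH n nb n0.
case: (ltngtP n 1) => [|n1|->]; [by rewrite ltnS leqn0 => /eqP e;
  rewrite e in n0| |rewrite rdiv_one; lra].
have [p [k [M [pp /andP [M0 Mn] pM e]]]] := pdiv_decomp n n1.
have -> : (n * n = p ^ (k + k) * (M * M))%N by rewrite e expnD mulnACA.
rewrite rdiv_pfactor ?muln_gt0 ?M0 //; last by rewrite Euclid_dvdM // negb_or pM.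
have [_ h1] := sign_geometric_sum (r p) (k + k) (r_values p).
have := h1 ltac:(by rewrite addnn odd_double).
have := IH M ltac:(exact: leq_trans Mn _) M0; nra.
Qed.
End RealCharacter.

(** * Nonvanishing at 1: real characters *)

(** The inequality between arithmetic and geometric means for 1, t, ..., t^n with t =
    u^2. If E_m = 1 - t^m - m u^(m-1) (1-t) then E_{m+1} - u E_m is the nonnegative product
    (1-u) (1-u^m) (1-u^(m+1)), whence the induction. Writing t as a square avoids
    half-integer powers. *)
Lemma geom_sum_amgm u n : 0 < u < 1 -> INR n.+1 * u ^ n * (1 - u * u) <= 1 - (u * u) ^ n.+1.
Proof.
move=> hu; elim: n => [|n IH]; first by rewrite /=; lra.
have v0 : 0 < u ^ n by apply: pow_lt; lra.
have v1 : u ^ n <= 1 by rewrite -[X in _ <= X](pow1 n); apply: pow_incr; lra.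
move: IH; rewrite !Rpow_mult_distr (S_INR n.+1) -!tech_pow_Rmult.
move: (INR n.+1) (u ^ n) v0 v1 => m v v0 v1 IH.
have w0 : 0 <= u * v <= 1 by nra.
have w1 : 0 <= u * (u * v) <= 1 by nra.
have h : 0 <= (1 - u) * ((1 - u * v) * (1 - u * (u * v))).
  by apply: Rmult_le_pos; [lra|apply: Rmult_le_pos; lra].
have := Rmult_le_compat_l u _ _ ltac:(lra) IH; nra.
Qed.

Lemma bernoulli_sub e n : 0 <= e <= 1 -> 1 - INR n * e <= (1 - e) ^ n.
Proof.
move=> he; elim: n => [|n IH]; first by rewrite /=; lra.
rewrite S_INR -tech_pow_Rmult.
have h := Rmult_le_compat_l (1 - e) _ _ ltac:(lra) IH.
have := pos_INR n; nra.
Qed.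

Section Lambert.
Variables (u : R) (hu : 0 < u < 1).
Let t := u * u.
Let ht : 0 < t < 1. Proof. by rewrite /t; nra. Qed.

(** Coefficient of the Lambert series sum_n f(n) t^n / (1 - t^n). *)
Definition lambert (n : nat) : R := if n == 0%N then 0 else t ^ n / (1 - t ^ n).

Lemma tpow_lt n : (0 < n)%N -> 0 < t ^ n <= t.
Proof.
case: n => // n _; split; first by apply: pow_lt; lra.
have : t ^ n <= 1 by rewrite -[X in _ <= X](pow1 n); apply: pow_incr; lra.
rewrite -tech_pow_Rmult; nra.
Qed.

Lemma lambert_bound n : 0 <= lambert n <= / (1 - t) * t ^ n.
Proof.
rewrite /lambert; have i0 : 0 < / (1 - t) by apply: Rinv_0_lt_compat; lra.
have p0 : 0 < t ^ n by apply: pow_lt; lra.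
case: eqP => [->|/eqP]; first by rewrite /= Rmult_1_r; lra.
rewrite -lt0n => /tpow_lt h; split.
  by apply: Rmult_le_pos; [lra|left; apply: Rinv_0_lt_compat; lra].
rewrite [X in _ <= X]Rmult_comm; apply: Rmult_le_compat_l; first lra.
by apply: Rinv_le_contravar; lra.
Qed.

Lemma ex_series_lambert : ex_series lambert.
Proof.
apply: (ex_series_leR _ _ lambert_bound); apply: ex_series_scalR.
by apply: ex_series_geom; rewrite Rabs_pos_eq; lra.
Qed.

Let beta n := npow n 1 / (1 - t) - lambert n.

Lemma beta_ge0 n : (0 < n)%N -> 0 <= beta n.
Proof.
move=> n0; have h := tpow_lt n n0.
case: n n0 h => // n n0 h; have := geom_sum_amgm u n hu; rewrite -/t.
rewrite /beta /lambert npow_s1 // -[(_ == _)]/false.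
cbv iota.
have m0 : 0 < INR n.+1 by apply: INR_gt0.
have v0 : 0 < u ^ n by apply: pow_lt; lra.
have v1 : u ^ n <= 1 by rewrite -[X in _ <= X](pow1 n); apply: pow_incr; lra.
have vt : t ^ n.+1 <= u ^ n.
  rewrite /t Rpow_mult_distr -!tech_pow_Rmult.
  have : u * u ^ n * u <= 1 by nra.
  nra.
move: (INR n.+1) m0 => m m0 h2.
suff : t ^ n.+1 / (1 - t ^ n.+1) <= / m / (1 - t) by lra.
have mt : 0 < m * (1 - t) by apply: Rmult_lt_0_compat; lra.
have -> : / m / (1 - t) = / (m * (1 - t)) by field; lra.
apply: (Rmult_le_reg_r (1 - t ^ n.+1)); first lra.
rewrite /Rdiv Rmult_assoc Rinv_l ?Rmult_1_r; last lra.
apply: (Rmult_le_reg_l (m * (1 - t))) => //.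
rewrite -Rmult_assoc Rinv_r ?Rmult_1_l; last lra.
have := Rmult_le_compat_l (m * (1 - t)) _ _ ltac:(lra) vt; lra.
Qed.

(** Monsky's observation: after clearing denominators the inequality reads n (n+1) t^n
    (1-t)^2 <= (1 - t^n)(1 - t^(n+1)), a product of two consecutive cases of
    [geom_sum_amgm]. *)
Lemma beta_decr n : (0 < n)%N -> beta n.+1 <= beta n.
Proof.
move=> n0; have h := tpow_lt n n0; have h' := tpow_lt n.+1 isT.
case: n n0 h h' => // n n0 h h'.
have a1 := geom_sum_amgm u n hu; have a2 := geom_sum_amgm u n.+1 hu; rewrite -/t in a1 a2.
rewrite /beta /lambert !npow_s1 //; change (n.+1 == 0%N) with false;
  change (n.+2 == 0%N) with false.
cbv iota.
have m0 : 0 < INR n.+1 by apply: INR_gt0.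
have v0 : 0 < u ^ n by apply: pow_lt; lra.
have e1 : t ^ n.+2 = t * t ^ n.+1 by [].
have e2 : t ^ n.+1 = u * u * (u ^ n * u ^ n) by rewrite /t Rpow_mult_distr -!tech_pow_Rmult; ring.
have e3 : u ^ n.+1 = u * u ^ n by [].
rewrite e3 in a2; rewrite (S_INR n.+1) in a2 *; rewrite e1 in a2 h' *.
move: (INR n.+1) (t ^ n.+1) (u ^ n) m0 v0 e2 a1 a2 h h' => m T v m0 v0 e2 a1 a2 h h'.
have x0 : 0 < 1 - T by lra.
have y0 : 0 < 1 - t * T by lra.
have xy : m * v * (1 - t) * ((m + 1) * (u * v) * (1 - t)) <= (1 - T) * (1 - t * T).
  apply: Rmult_le_compat => //; do ! apply: Rmult_le_pos; lra.
have t1 : 0 < 1 - t by lra.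
have mm : 0 < m * (m + 1) * (1 - t) by do ! apply: Rmult_lt_0_compat; lra.
have key : T * (1 - t) * (m * (m + 1) * (1 - t)) <= (1 - T) * (1 - t * T).
  apply: Rle_trans xy; rewrite e2.
  have -> : u * u * (v * v) * (1 - t) * (m * (m + 1) * (1 - t)) =
    u * (m * v * (1 - t) * ((m + 1) * (u * v) * (1 - t))) by ring.
  set X := _ * ((m + 1) * _ * _); have X0 : 0 <= X.
    by rewrite /X; do ! apply: Rmult_le_pos; lra.
  nra.
suff : T / (1 - T) - t * T / (1 - t * T) <= / m / (1 - t) - / (m + 1) / (1 - t) by lra.
have -> : T / (1 - T) - t * T / (1 - t * T) = T * (1 - t) * / ((1 - T) * (1 - t * T)).
  by field; lra.
have -> : / m / (1 - t) - / (m + 1) / (1 - t) = / (m * (m + 1) * (1 - t)) by field; lra.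
have xy0 : 0 < (1 - T) * (1 - t * T) by apply: Rmult_lt_0_compat.
apply: (Rmult_le_reg_r ((1 - T) * (1 - t * T))) => //.
rewrite Rmult_assoc Rinv_l ?Rmult_1_r; last lra.
apply: (Rmult_le_reg_l (m * (m + 1) * (1 - t))) => //.
rewrite -[X in _ <= X]Rmult_assoc Rinv_r ?Rmult_1_l; lra.
Qed.

Lemma beta1 : beta 1 = 1.
Proof. by rewrite /beta /lambert npow1 /= Rmult_1_r; field; lra. Qed.

Variables (f : nat -> C) (r : nat -> R) (cf : cmul f).
Hypothesis f_real : forall n, f n = RtoC (r n).
Hypothesis r_values : forall n, r n = 0 \/ r n = 1 \/ r n = -1.

Lemma lambert_summable : Csummable (fun n => f n * lambert n)%C.
Proof.
apply: Csummable_le ex_series_lambert => n.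
by apply: Cmod_le1_mult; [apply: (cmul_le1 f cf)|have [] := lambert_bound n].
Qed.

(** If L(1) = 0 then, after Abel summation, the Lambert series is unchanged up to sign
    when the weights [lambert n] are replaced by beta_n = 1/(n(1-t)) - t^n/(1-t^n). These
    decrease from beta_1 = 1 and stay nonnegative, so the series is at most the bound on
    partial sums, uniformly in t. *)
Lemma lambert_upper K : (forall n, Cmod (\csum_(0 <= i < n) f i) <= K) -> Lser_at1 f = 0%C ->
  Cmod (Csum (fun n => f n * lambert n)%C) <= K.
Proof.
move=> fK L0; set La := Csum _.
have h1 : Csum_to (fun n => (\csum_(0 <= i < n.+1) f i) * RtoC (lambert n - lambert n.+1))%C La.
  apply: (abel f lambert K _ fK); first exact: ex_series_lim_0 ex_series_lambert.
  exact: Csummable_ex lambert_summable.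
have h2 : Csum_to (fun n => (\csum_(0 <= i < n.+1) f i) * RtoC (npow n 1 - npow n.+1 1))%C
  (Lser_at1 f).
  apply: Csummable_ex; apply: (abel_summable _ K fK) => n; apply: npow_diff; lra.
have := Csum_to_minus _ _ _ _ (Csum_to_scal (RtoC (/ (1 - t))) _ _ h2) h1; rewrite L0.
rewrite (_ : RtoC (/ (1 - t)) * 0 - La = - La)%C; last by ring.
move=> h; rewrite -Cmod_opp (_ : - La = - La - 0)%C; last by ring.
apply: (Ccvg_le_locally _ _ _ _ 1 h) => N N1.
have K0 : 0 <= K by have := fK 0%N; rewrite big_nil Cmod_0.
set X := bigop _ _ _; have -> : (X - 0 = X)%C by ring.
apply: Rle_trans (Cmod_sum _ _ _ _) _.
rewrite big_ltn // big_nat1 cmul0 //.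
set Y := Cmod _; have -> : Y = 0.
  by rewrite /Y -[RHS]Cmod_0; congr Cmod; ring.
rewrite /= Rplus_0_l; apply: Rle_trans (_ : K * (1 - beta N) <= _); last first.
  by have := beta_ge0 N N1; nra.
case: N N1 {h X} => // N _.
rewrite -[X in K * (X - _)]beta1.
elim: N => [|N IH]; first by rewrite big_geq //; lra.
rewrite big_nat_recr //=.
set Z := Cmod _; suff : Z <= K * (beta N.+1 - beta N.+2) by lra.
rewrite /Z; set A := \csum_(_ <= _ < _) _; set B1 := RtoC (_ - _); set B2 := RtoC (_ - _).
have -> : (RtoC (/ (1 - t)) * (A * B1) - A * B2 = A * RtoC (beta N.+1 - beta N.+2))%C.
  rewrite /B1 /B2 /beta /Rdiv !(RtoC_minus, RtoC_mult); ring.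
rewrite Cmod_mult Cmod_R Rabs_pos_eq; last by have := beta_decr N.+1 isT; lra.
apply: Rmult_le_compat_r; last exact: fK.
by have := beta_decr N.+1 isT; lra.
Qed.

Lemma ex_series_ntn : ex_series (fun n => INR n * t ^ n).
Proof.
apply: (ex_series_telescope _ (fun n => (INR n / (1 - t) + t / ((1 - t) * (1 - t))) * t ^ n) 0) =>
  n.
  have p : 0 < t ^ n by apply: pow_lt; lra.
  split; first by apply: Rmult_le_pos; [apply: pos_INR|lra].
  by right; rewrite S_INR -tech_pow_Rmult; field; lra.
have i : 0 < / (1 - t) by apply: Rinv_0_lt_compat; lra.
apply: Rmult_le_pos; last by apply: pow_le; lra.
rewrite /Rdiv Rinv_mult; have := pos_INR n => n0.
by apply: Rplus_le_le_0_compat; do ! apply: Rmult_le_pos; lra.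
Qed.

Let g (N : nat) : C := if N == 0%N then RtoC 0 else RtoC (t ^ N * rdiv r N).

(** Expanding t^n/(1 - t^n) as the sum of t^N over the multiples N > 0 of n and
    collecting powers of t. *)
Lemma lambert_rearrange : Csummable g /\ Csum (fun n => f n * lambert n)%C = Csum g.
Proof.
have f0 : r 0%N = 0 by apply: RtoC_inj; rewrite -f_real cmul0.
(* the rearranged series, restricted to the terms [n < J] *)
pose h (J N : nat) : C := if N == 0%N then RtoC 0 else
  RtoC (t ^ N * \big[Rplus/0]_(0 <= n < J | (n %| N)%N) r n).
have hS J : Csum_to (h J) (\csum_(0 <= n < J) (f n * lambert n)%C).
  pose e n (N : nat) : C := if (N != 0%N) && (n %| N)%N then RtoC (r n * t ^ N) else RtoC 0.
  have he n : Csum_to (e n) (f n * lambert n)%C.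
    case: (posnP n) => [->|n0].
      rewrite cmul0 // Cmult_0_l; apply: Csum_to_ext (_ : Csum_to (fun _ => RtoC 0) 0%C) => [N|].
        by rewrite /e dvd0n; case: eqP.
      by apply: Ccvg_ext (Ccvg_const (RtoC 0)); apply: filter_forall => N; rewrite big1.
    apply: (Csum_multiples n) => // [N /negbTE nN|]; first by rewrite /e nN andbF.
    have tn := tpow_lt n n0.
    have tn1 : Cmod (RtoC (t ^ n)) < 1 by rewrite Cmod_R Rabs_pos_eq; lra.
    apply/Csum_to_is_series; apply: (is_series_decr_1 (V := C_R_NormedModule));
      apply/Csum_to_is_series.
    rewrite {2}/e muln0 eqxx /=.
    set W := (X in Csum_to _ X).
    have -> : W = (f n * (RtoC (t ^ n) / (1 - RtoC (t ^ n))))%C.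
      rewrite /W -[LHS]/(f n * lambert n + - RtoC 0)%C /lambert eqn0Ngt n0 /=.
      rewrite RtoC_div ?RtoC_minus; last lra.
      ring.
    apply: Csum_to_ext (Csum_to_scal (f n) _ _ (Csum_geom _ tn1)) => k.
    by rewrite /e muln_eq0 eqn0Ngt n0 /= dvdn_mulr // -RtoC_pow -pow_mult f_real !RtoC_mult mulnS
      -plusE -multE pow_add RtoC_mult.
  apply: Csum_to_ext (Csum_to_sum _ (index_iota 0 J) xpredT _ _ (fun n _ => he n)) => N.
  rewrite /h /e; case: eqP => [->|_] /=; first by rewrite big1.
  rewrite [in RHS]big_mkcond /=; elim: (index_iota 0 J) => [|n s IH].
    by rewrite !big_nil Rmult_0_r.
  rewrite !big_cons IH; case: ifP => _; rewrite /= !(RtoC_mult, RtoC_plus); ring.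
have hr n : Rabs (r n) <= 1 by case: (r_values n) => [->|[->|->]]; apply: Rabs_le; lra.
have cnt J N : (0 < N)%N -> Rabs (\big[Rplus/0]_(0 <= n < J | (n %| N)%N) r n) <= INR (minn J.-1 N).
  move=> N0; elim: J => [|J IH]; first by rewrite big_nil Rabs_R0; apply: pos_INR.
  rewrite big_mkcond big_nat_recr // -big_mkcond /=.
  case: J IH => [|J] IH; first by rewrite big_nil f0 if_same Rplus_0_l Rabs_R0; apply: pos_INR.
  apply: Rle_trans (Rabs_triang _ _) _; case: ifP => JN.
    have JN' := dvdn_leq N0 JN.
    have := hr J.+1; move: IH; rewrite (minn_idPl JN') /= (minn_idPl (ltnW JN')).
    move=> h1 h2; rewrite -/(INR J.+1) S_INR; lra.
  rewrite Rabs_R0 Rplus_0_r; apply: Rle_trans IH _; apply: le_INR; apply/leP => /=.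
  by rewrite leq_min geq_minr andbT (leq_trans (geq_minl _ _)).
have [] := tannery (F := eventually) _ h g _ ex_series_ntn _ _ (filter_forall _ hS).
- apply: filter_forall => J N; rewrite /h; case: posnP => [->|N0].
    by rewrite Cmod_0 /= Rmult_0_l; lra.
  have p : 0 < t ^ N by apply: pow_lt; lra.
  rewrite Cmod_R Rabs_mult (Rabs_pos_eq (t ^ N)) 1?[INR N * _]Rmult_comm; last lra.
  apply: Rmult_le_compat_l; first lra.
  apply: Rle_trans (cnt J N N0) _; apply: le_INR; apply/leP; exact: geq_minr.
- move=> N; apply: (Ccvg_ext _ _ (g N) _ (Ccvg_const _)); exists N.+1 => J /leP NJ.
  rewrite /g /h; case: posnP => // N0; congr (RtoC (_ * _)).
  rewrite /rdiv -[RHS]big_filter; apply: perm_big; apply: uniq_perm.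
  + exact: divisors_uniq.
  + by apply: filter_uniq; apply: iota_uniq.
  + move=> n; rewrite mem_filter mem_index_iota /= -dvdn_divisors //.
    case: (boolP (n %| N)%N) => //= /(dvdn_leq N0) nN.
    by rewrite (leq_ltn_trans nN NJ).
move=> sg; split=> //.
apply: (Ccvg_unique (F := eventually)) b; exact: (Csummable_ex _ lambert_summable).
Qed.

(** The coefficients [rdiv] are nonnegative and at least 1 at squares. *)
Lemma lambert_lower k :
  \rsum_(0 <= m < k) t ^ (m.+1 * m.+1) <= Cmod (Csum (fun n => f n * lambert n)%C).
Proof.
have [sg ->] := lambert_rearrange.
apply: Rle_trans (_ : Re (Csum g) <= _); last by have := re_le_Cmod (Csum g);
  move/Rabs_le_between; lra.
have g0 N : 0 <= Re (g N).
  rewrite /g; case: posnP => [_|N0] /=; first lra.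
  apply: Rmult_le_pos; [apply: pow_le; lra|exact: (rdiv_ge0 f)].
apply: Rle_trans (Csum_Re_ge _ _ (k * k).+1 g0 (Csummable_ex _ sg)).
have mono N N' : (N <= N')%N -> Re (\csum_(0 <= i < N) g i) <= Re (\csum_(0 <= i < N') g i).
  move/subnKC <-; elim: (N' - N)%N => [|j IH]; first by rewrite addn0; lra.
  rewrite addnS Re_csum_recr; have := g0 (N + j)%N; lra.
elim: k => [|k IH].
  by rewrite big_nil muln0 big_nat1; apply: g0.
rewrite big_nat_recr //=.
apply: Rle_trans (_ : Re (\csum_(0 <= i < k.+1 * k.+1) g i) + t ^ (k.+1 * k.+1) <= _).
  apply: Rplus_le_compat_r; apply: Rle_trans IH _; apply: mono.
  by rewrite ltn_mul.
rewrite Re_csum_recr; apply: Rplus_le_compat_l.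
have -> : Re (g (k.+1 * k.+1)%N) = t ^ (k.+1 * k.+1) * rdiv r (k.+1 * k.+1) by rewrite /g muln_eq0.
have := rdiv_square f r cf f_real r_values k.+1 isT.
have : 0 < t ^ (k.+1 * k.+1) by apply: pow_lt; lra.
nra.
Qed.
End Lambert.

(** Monsky's proof: if L(1) = 0 the Lambert series stays bounded as t -> 1
    ([lambert_upper]), while its coefficients at squares make it unbounded
    ([lambert_lower]). *)
Lemma nonvanish_real f r K : cmul f -> (forall n, f n = RtoC (r n)) ->
  (forall n, r n = 0 \/ r n = 1 \/ r n = -1) ->
  (forall n, Cmod (\csum_(0 <= i < n) f i) <= K) -> Lser_at1 f <> 0%C.
Proof.
move=> cf f_real r_values fK L0.
have K0 : 0 <= K by have := fK 0%N; rewrite big_nil Cmod_0.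
have [k hk] : exists k, K + 1 < INR k.
  have [n [_ hn]] := nfloor_ex (K + 1) ltac:(lra).
  by exists n.+1; rewrite S_INR.
pose M := (2 * (k * k))%N.
have M0 := pos_INR M.
(* [u = 1 - e] is so close to 1 that each of the [k] squares contributes
   almost 1, and [k > K + 1]. *)
pose e := / (2 * (INR M + 1) * INR k).
have k0 : 1 < INR k by lra.
have d0 : 0 < 2 * (INR M + 1) * INR k by do ! apply: Rmult_lt_0_compat; lra.
have e0 : 0 < e by apply: Rinv_0_lt_compat.
have e1 : e * (2 * (INR M + 1) * INR k) = 1 by rewrite /e Rinv_l; lra.
have eM : INR k * (INR M * e) <= / 2 by nra.
have e2 : e < 1 by nra.
have hu : 0 < 1 - e < 1 by lra.
have up := lambert_upper _ hu f cf K fK L0.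
have low := lambert_lower _ hu f r cf f_real r_values k.
have : INR k * (1 - INR M * e) <= \rsum_(0 <= m < k) ((1 - e) * (1 - e)) ^ (m.+1 * m.+1).
  have -> : INR k * (1 - INR M * e) = \rsum_(0 <= m < k) (1 - INR M * e).
    by elim: (k) => [|j IH]; [rewrite big_nil /= Rmult_0_l|rewrite big_nat_recr // -IH S_INR /=;
      ring].
  rewrite !big_seq; apply: rsum_le => m; rewrite mem_index_iota => /andP [_ mk].
  have -> : (1 - e) * (1 - e) = (1 - e) ^ 2 by ring.
  rewrite -pow_mult; apply: Rle_trans (bernoulli_sub e _ ltac:(lra)).
  have : INR (2 * (m.+1 * m.+1))%coq_nat <= INR M.
    by apply: le_INR; apply/leP; rewrite multE /M leq_mul2l /= leq_mul.
  nra.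
nra.
Qed.

(** * Characters of a finite abelian group *)

Section Separation.
Import GRing.Theory.
Variables (gT : finGroupType) (N0 : nat).
Hypothesis gT_abelian : abelian [set: gT]%G.
Hypothesis expN : forall x : gT, (x ^+ N0.+2)%g = 1%g.

(** Characters are written additively, with values in Z/N as a finite type: they then
    form a finite set that can be summed over, and only [omega] turns them into complex
    numbers. *)
Definition is_hom (f : {ffun gT -> 'I_N0.+2}) : bool :=
  [forall x, forall y, f (x * y)%g == (f x + f y)%R].

Lemma is_homP (f : {ffun gT -> 'I_N0.+2}) :
  reflect (forall x y, f (x * y)%g = (f x + f y)%R) (is_hom f).
Proof.
apply: (iffP forallP) => [h x y|h x]; first by apply/eqP; move/forallP: (h x).
by apply/forallP => y; rewrite h.
Qed.

(** In an abelian group the linear characters separate points; their values are N-th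
    roots of unity in [algC], and taking exponents with respect to a primitive root turns
    such a character into a homomorphism to Z/N. *)
Lemma hom_separates (g : gT) : g != 1%g ->
  exists2 f : {ffun gT -> 'I_N0.+2}, is_hom f & f g != 0%R.
Proof.
move=> g1.
have [z zP] := @C_prim_root_exists N0.+2 isT.
have [i lin kg] : exists2 i : Iirr [set: gT]%G, ('chi_i \is a linear_char)%R & g \notin cfker
  ('chi_i)%R.
  apply/exists_inP; case: (boolP [exists (_ | _), _]) => // /exists_inPn h.
  case/negP: g1; rewrite -in_set1 -[[set 1%g]]/(gval 1%G) /= -(derG1P gT_abelian)
    -cap_cfker_lin_irr.
  by apply/bigcapP => i /h; rewrite negbK.
have in_G (x : gT) : x \in [set: gT]%G by rewrite inE.
have root x : ('chi_i x ^+ N0.+2)%R = GRing.one algC.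
  by rewrite -lin_charX // expN lin_char1.
pose f := [ffun x : gT => sval (prim_rootP zP (root x))].
have fE x : ('chi_i x = z ^+ f x)%R by rewrite ffunE; exact: (svalP (prim_rootP zP (root x))).
exists f.
  apply/is_homP => x y; apply/val_inj => /=; apply/eqP.
  rewrite -[X in X == _](modn_small (ltn_ord _)) -(eq_prim_root_expr zP).
  by rewrite -fE lin_charM // exprD -!fE.
apply/negP => /eqP f0; case/negP: kg.
rewrite cfkerEchar ?irr_char // inE in_G /= fE f0 /= expr0.
by rewrite lin_char1.
Qed.
End Separation.

Definition cis (x : R) : C := (cos x, sin x).

Lemma cis_add x y : cis (x + y) = (cis x * cis y)%C.
Proof. by rewrite /cis cos_plus sin_plus /Cmult /=; congr pair; ring. Qed.

Lemma Cmod_cis x : Cmod (cis x) = 1.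
Proof.
rewrite /Cmod /cis /= (_ : _ + _ = 1) ?sqrt_1 //.
by have := sin2_cos2 x; rewrite /Rsqr; lra.
Qed.

Section RootOfUnity.
Variable N0 : nat.
Let N := N0.+2.
Let theta := 2 * PI / INR N.
Definition omega (k : nat) : C := cis (INR k * theta).

Lemma omega_add j k : omega (j + k) = (omega j * omega k)%C.
Proof. by rewrite /omega plus_INR Rmult_plus_distr_r cis_add. Qed.

Lemma omega0 : omega 0 = 1%C.
Proof. by rewrite /omega Rmult_0_l /cis cos_0 sin_0. Qed.

Lemma omegaN : omega N = 1%C.
Proof.
rewrite /omega (_ : INR N * theta = 2 * PI); first by rewrite /cis cos_2PI sin_2PI.
by rewrite /theta; field; have := INR_gt0 N isT; lra.
Qed.

Lemma omega_mod k : omega (k %% N) = omega k.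
Proof.
rewrite [in RHS](divn_eq k N) omega_add (_ : omega (k %/ N * N) = 1%C) ?Cmult_1_l //.
by elim: (k %/ N)%N => [|q IH]; [rewrite mul0n omega0|rewrite mulSn omega_add IH omegaN Cmult_1_l].
Qed.

(** cos x = 1 - 2 sin^2 (x/2) < 1 for 0 < x < 2 pi. *)
Lemma omega_neq1 k : (0 < k < N)%N -> omega k <> 1%C.
Proof.
move=> /andP [k0 kN] [] h _.
have m0 := INR_gt0 k k0.
have m1 : INR k < INR N by apply: lt_INR; apply/ltP.
have n0 : 0 < INR N by lra.
have PI0 := PI_RGT_0.
set x := INR k * theta in h.
have e : INR N * theta = 2 * PI by rewrite /theta; field; lra.
have t0 : 0 < theta by apply: (Rmult_lt_reg_l (INR N)) => //; lra.
have x0 : 0 < x by apply: Rmult_lt_0_compat.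
have x1 : x < 2 * PI by rewrite -e; apply: Rmult_lt_compat_r.
have := sin_gt_0 (x / 2) ltac:(lra) ltac:(lra).
have := cos_2a_sin (x / 2); rewrite (_ : 2 * (x / 2) = x) ?h; last by field.
nra.
Qed.

Lemma omega_ordD (a b : 'I_N) : omega (a + b)%R = (omega a * omega b)%C.
Proof. by rewrite /= omega_mod omega_add. Qed.

Lemma Cmod_omega k : Cmod (omega k) = 1.
Proof. exact: Cmod_cis. Qed.
End RootOfUnity.

(** * Dirichlet characters *)

Section DirichletCharacters.
Variable d0 : nat.
Let d := d0.+2.
Notation U := {unit 'Z_d}.

Definition unit_of (n : nat) : U := insubd (1%g : U) (inZp n : 'Z_d).

Lemma coprime_unit n : coprime d n = ((inZp n : 'Z_d) \in GRing.unit).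
Proof. by rewrite -(unitZpE n (isT : 1 < d)%N) Zp_nat. Qed.

Lemma val_unit_of n : coprime d n -> val (unit_of n) = inZp n.
Proof. by move=> dn; rewrite /unit_of val_insubd -coprime_unit dn. Qed.

Lemma unit_of_mul m n : coprime d m -> coprime d n ->
  unit_of (m * n) = (unit_of m * unit_of n)%g.
Proof.
move=> dm dn; apply/val_inj; rewrite val_unit_of ?coprimeMr ?dm //.
rewrite -[RHS]/(GRing.mul (val (unit_of m)) (val (unit_of n))) !val_unit_of //.
by apply/val_inj; rewrite /= modnMm.
Qed.

Lemma unit_of_eq m n : coprime d m -> coprime d n ->
  (unit_of m == unit_of n) = (m == n %[mod d]).
Proof.
by move=> dm dn; rewrite -(inj_eq val_inj) !val_unit_of.
Qed.

Lemma units_abelian : abelian [set: U]%G.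
Proof. by apply/centsP => x _ y _; apply/val_inj; rewrite /= GRing.mulrC. Qed.

Lemma card_unit : #|[set: U]| = totient d.
Proof. by have := @card_units_Zp d isT; rewrite /units_Zp. Qed.

Lemma card_unit_gt0 : (0 < #|[set: U]|)%N.
Proof. by apply/card_gt0P; exists (1%g : U); rewrite inE. Qed.

(** Twice the order of the group of units is a multiple of its exponent, and doubling
    keeps it at least 2 when the group is trivial (d = 2), so that it has the form required
    in [is_hom]. *)
Definition rootn : nat := (#|[set: U]|.*2).-2.

Lemma rootnE : rootn.+2 = #|[set: U]|.*2.
Proof. by rewrite /rootn; case: #|_| card_unit_gt0. Qed.

Lemma unit_exp (x : U) : (x ^+ rootn.+2)%g = 1%g.
Proof. by rewrite rootnE -muln2 expgM (expg_cardG (G := [set: U]%G)) ?inE // expg1n. Qed.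

Notation ch := {ffun U -> 'I_rootn.+2}.

Notation om := (omega rootn).


Lemma csum_const1 (I : finType) (P : pred I) :
  \big[Cplus/RtoC 0]_(i | P i) (RtoC 1) = RtoC (INR #|P|).
Proof.
rewrite big_const; elim: #|P| => [|k IH]; first by [].
by rewrite iterS IH S_INR RtoC_plus; ring.
Qed.

(** Both orthogonality relations come from this: translating the index multiplies the
    sum by a number different from 1. *)
Lemma eq0_of_scaled_eq (S w : C) : S = (w * S)%C -> w <> 1%C -> S = 0%C.
Proof.
move=> e w1; have w0 : (1 - w)%C <> 0%C.
  by move=> h; apply: w1; transitivity (1 - (1 - w))%C; [ring|rewrite h; ring].
have : (S * (1 - w) = 0)%C by transitivity (S - w * S)%C; [ring|rewrite -e; ring].
move=> h; have -> : S = (S * (1 - w) / (1 - w))%C by field.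
by rewrite h /Cdiv Cmult_0_l.
Qed.

Lemma omega_nonzero_exponent (k : 'I_rootn.+2) : k != GRing.zero -> om k <> 1%C.
Proof.
move=> k0; apply: omega_neq1; rewrite ltn_ord andbT lt0n.
by apply: contra k0 => /eqP h; apply/eqP/val_inj.
Qed.

Lemma sum_over_chars (g : U) : g != (1%g : U) ->
  \big[Cplus/RtoC 0]_(f : ch | is_hom _ _ f) om (f g) = 0%C.
Proof.
move=> g1; have [f0 h0 f0g] := hom_separates _ _ units_abelian unit_exp _ g1.
apply: (eq0_of_scaled_eq _ (om (f0 g))); last exact: omega_nonzero_exponent.
rewrite [LHS](reindex_inj (GRing.addIr f0)) /= big_distrr /=.
apply: eq_big => [f|f _].
  apply/is_homP/is_homP => h x y; last by rewrite !ffunE h (is_homP _ _ _ h0) GRing.addrACA.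
  have := h x y; rewrite !ffunE (is_homP _ _ _ h0) GRing.addrACA; exact: GRing.addIr.
by rewrite ffunE omega_ordD Cmult_comm.
Qed.

Lemma hom1 (f : ch) : is_hom _ _ f -> f (1%g : U) = GRing.zero.
Proof.
move=> /is_homP h; have := h (1%g : U) (1%g : U); rewrite mulg1 => e.
by apply: (GRing.addrI (f (1%g : U))); rewrite GRing.addr0 -e.
Qed.

Lemma sum_over_units (f : ch) : is_hom _ _ f -> f != GRing.zero ->
  \big[Cplus/RtoC 0]_(g : U | true) om (f g) = 0%C.
Proof.
move=> hf f0.
have [g0 fg0] : exists g0, f g0 != GRing.zero.
  apply/existsP; apply: contraR f0 => /existsPn h; apply/eqP/ffunP => g.
  by rewrite ffunE; apply/eqP; rewrite -[_ == _]negbK h.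
apply: (eq0_of_scaled_eq _ (om (f g0))); last exact: omega_nonzero_exponent.
rewrite [LHS](reindex_inj (mulIg g0)) /= big_distrr /=.
by apply: eq_bigr => g _; rewrite (is_homP _ _ _ hf) omega_ordD Cmult_comm.
Qed.

Lemma is_hom0 : is_hom U rootn GRing.zero.
Proof. by apply/is_homP => x y; rewrite !ffunE GRing.addr0. Qed.

(** Count the double sum of f(g) over all characters and all units in both orders. *)
Lemma card_chars : #|[pred f : ch | is_hom _ _ f]| = totient d.
Proof.
apply: INR_eq; apply: RtoC_inj; rewrite -card_unit.
have -> : RtoC (INR #|[pred f : ch | is_hom _ _ f]|) =
  \big[Cplus/RtoC 0]_(g : U | true) \big[Cplus/RtoC 0]_(f : ch | is_hom _ _ f) om (f g).
  rewrite (bigD1 (1%g : U)) //= [X in (_ + X)%C]big1 ?Cplus_0_r; last by move=> g /sum_over_chars.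
  rewrite -csum_const1; apply: eq_bigr => f hf; rewrite hom1 // omega0 //.
rewrite exchange_big /= (bigD1 (GRing.zero : ch)) ?is_hom0 //=.
rewrite [X in (_ + X)%C]big1 ?Cplus_0_r; last by move=> f /andP [hf f0]; exact: sum_over_units.
rewrite (eq_bigr (fun _ => RtoC 1)) => [|g _]; last by rewrite ffunE omega0.
rewrite csum_const1; congr (RtoC (INR _)); apply: eq_card => x; by rewrite !inE.
Qed.

(** Indexed by natural numbers, hence periodic and supported on the integers coprime to
    d. *)
Definition chi (f : ch) (n : nat) : C := if coprime d n then om (f (unit_of n)) else RtoC 0.

Lemma coprime0 : coprime d 0 = false.
Proof. by rewrite /coprime gcdn0. Qed.

Lemma chi_cmul f : is_hom _ _ f -> cmul (chi f).
Proof.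
move=> hf; split; rewrite /chi.
- by rewrite coprime0.
- rewrite coprimen1 (_ : unit_of 1 = (1%g : U)) ?hom1 ?omega0 //.
  by apply/val_inj; rewrite val_unit_of ?coprimen1.
- move=> m n; rewrite coprimeMr; case: (boolP (coprime d m)) => dm /=; last by ring.
  case: (boolP (coprime d n)) => dn; last by ring.
  by rewrite unit_of_mul // (is_homP _ _ _ hf) omega_ordD.
- move=> n; case: ifP => _; first by rewrite Cmod_omega; lra.
  by rewrite Cmod_0; lra.
Qed.

Lemma chi_period f n : chi f (n + d) = chi f n.
Proof.
rewrite /chi /coprime gcdnDr; case: eqP => // /eqP dn; congr (om (f _)).
by apply/eqP; rewrite unit_of_eq ?modnDr // /coprime gcdnDr.
Qed.

Lemma sum_chi_units f : \csum_(0 <= n < d) chi f n = \big[Cplus/RtoC 0]_(g : U | true) om (f g).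
Proof.
rewrite big_mkord [RHS](reindex_onto (fun i : 'Z_d => insubd (1%g : U) i) val) /=; last first.
  by move=> g _; rewrite valKd.
rewrite [RHS]big_mkcond /=; apply: eq_bigr => i _.
have iE : inZp i = i :> 'Z_d by rewrite valZpK.
rewrite /chi coprime_unit /unit_of iE val_insubd.
case: ifP => iu; first by rewrite eqxx.
case: eqP => // e; by rewrite -e GRing.unitr1 in iu.
Qed.

(** A sum over a full period vanishes, so only an incomplete period remains. *)
Lemma chi_sum_bound f : is_hom _ _ f -> f != GRing.zero ->
  forall n, Cmod (\csum_(0 <= i < n) chi f i) <= INR d.
Proof.
move=> hf f0 n.
have per q i : chi f (q * d + i) = chi f i.
  by elim: q => [|q IH] //; rewrite mulSn -addnA addnC chi_period.
have block q : \csum_(0 <= i < q * d) chi f i = 0%C.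
  elim: q => [|q IH]; first by rewrite big_nil.
  rewrite mulSn addnC (big_cat_nat (n := (q * d)%N)) ?leq_addr //= IH.
  rewrite -{1}[(q * d)%N]add0n big_addn addKn.
  rewrite (eq_bigr (chi f)) => [|i _]; last by rewrite addnC per.
  by rewrite sum_chi_units sum_over_units // Cplus_0_r.
set D := INR d.
rewrite (divn_eq n d) (big_cat_nat (n := (n %/ d * d)%N)) ?leq_addr //= block Cplus_0_l.
apply: Rle_trans (Cmod_sum _ _ _ _) _.
apply: Rle_trans (rsum_le _ _ _ _ (fun _ => 1) _) _ => [i _|];
  first exact: (cmul_le1 _ (chi_cmul f hf)).
rewrite big_const_nat addKn; apply: Rle_trans (_ : INR (n %% d) <= _); last first.
  by apply: le_INR; apply/leP; apply: ltnW; rewrite ltn_mod.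
elim: (n %% d)%N => [|k IH]; first by rewrite /=; lra.
by rewrite iterS S_INR; lra.
Qed.

(** Either the square of the character is again nonprincipal, or all its values are 0, 1
    or -1. *)
Lemma chi_nonvanishing f : is_hom _ _ f -> f != GRing.zero -> Lser_at1 (chi f) <> 0%C.
Proof.
move=> hf f0; have bf := chi_sum_bound f hf f0.
have h2 : is_hom _ _ (f + f)%R.
  by apply/is_homP => x y; rewrite !ffunE (is_homP _ _ _ hf) GRing.addrACA.
have sq n : chi (f + f)%R n = (chi f n * chi f n)%C.
  by rewrite /chi; case: ifP => _; [rewrite ffunE omega_ordD|ring].
case: (eqVneq (f + f)%R GRing.zero) => ff.
  have val n : chi f n = 0%C \/ chi f n = 1%C \/ chi f n = (- (1))%C.
    rewrite /chi; case: ifP => _; [right|by left].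
    set w := om _; have : (w * w)%C = 1%C.
      by rewrite /w -omega_ordD; have /ffunP/(_ (unit_of n)) := ff; rewrite !ffunE => ->;
        rewrite omega0.
    move=> ww; have : ((w - 1) * (w + 1) = 0)%C by transitivity (w * w - 1)%C; [ring|rewrite ww;
      ring].
    move/(f_equal Cmod); rewrite Cmod_mult Cmod_0 => /Rmult_integral [/Cmod_eq_0 h|/Cmod_eq_0 h];
      [left|right].
      by transitivity (w - 1 + 1)%C; [ring|rewrite h; ring].
    by transitivity (w + 1 - 1)%C; [ring|rewrite h; ring].
  apply: (nonvanish_real _ (fun n => Re (chi f n)) _ (chi_cmul f hf) _ _ bf) => n.
    by case: (val n) => [->|[->|->]] //; rewrite /Re /Copp /RtoC /=; congr pair; ring.
  by case: (val n) => [->|[->|->]]; rewrite /Re /=; lra.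
apply: (nonvanish_complex _ _ (INR d) (chi_cmul f hf) bf) => n.
rewrite (eq_bigr (chi (f + f)%R)) => [|i _]; last by rewrite sq.
exact: chi_sum_bound.
Qed.

(** Detects the class of a among the integers coprime to d. *)
Lemma residue_orthogonality a n : coprime d a ->
  (\big[Cplus/RtoC 0]_(f : ch | is_hom _ _ f) (om (f (unit_of a)^-1%g) * chi f n))%C =
  if (n == a %[mod d]) then RtoC (INR (totient d)) else RtoC 0.
Proof.
move=> da; case: (boolP (coprime d n)) => dn; last first.
  rewrite big1 => [|f _]; last by rewrite /chi (negbTE dn) Cmult_0_r.
  case: eqP => // e; case/negP: dn; by rewrite -coprime_modr e coprime_modr.
rewrite (eq_bigr (fun f : ch => om (f ((unit_of a)^-1 * unit_of n)%g))) => [|f hf]; last first.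
  by rewrite /chi dn (is_homP _ _ _ hf) omega_ordD.
rewrite -unit_of_eq //; case: eqP => [->|/eqP ne].
  rewrite mulVg (eq_bigr (fun _ => RtoC 1)) => [|f hf]; last by rewrite hom1 // omega0.
  by rewrite csum_const1 -card_chars.
apply: sum_over_chars; apply: contra ne => /eqP e.
by rewrite -[unit_of n](mulKVg (unit_of a)) e mulg1.
Qed.
End DirichletCharacters.

(** * Primes in a residue class *)

Lemma has_pole_plus k1 k2 p1 p2 : has_pole k1 p1 -> has_pole k2 p2 ->
  has_pole (k1 + k2)%C (fun s => p1 s + p2 s)%C.
Proof.
move=> [l1 h1] [l2 h2]; exists (l1 + l2)%C.
apply: Ccvg_ext (Ccvg_plus _ _ _ _ h1 h2); apply: filter_imp (at_right_lt 1 Rlt_0_1) => s hs.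
by field; move/RtoC_inj; lra.
Qed.

Lemma has_pole_scal c k p : has_pole k p -> has_pole (c * k)%C (fun s => c * p s)%C.
Proof.
move=> [l h]; exists (c * l)%C.
apply: Ccvg_ext (Ccvg_mult _ _ _ _ (Ccvg_const c) h); apply: filter_imp (at_right_lt 1 Rlt_0_1) =>
  s hs.
by field; move/RtoC_inj; lra.
Qed.

Lemma has_pole_lim p l : Ccvg (at_right 1) p l -> has_pole 0 p.
Proof.
move=> h; exists l; apply: Ccvg_ext h; apply: filter_imp (at_right_lt 1 Rlt_0_1) => s hs.
by field; move/RtoC_inj; lra.
Qed.

Lemma has_pole_ext k p q : at_right 1 (fun s => p s = q s) -> has_pole k p -> has_pole k q.
Proof.
move=> pq [l h]; exists l; apply: Ccvg_ext h.
by apply: filter_imp pq => s ->.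
Qed.

Lemma has_pole_sum (I : Type) (r : seq I) (P : pred I) (k : I -> C) (p : I -> R -> C) :
  (forall i, P i -> has_pole (k i) (p i)) ->
  has_pole (\big[Cplus/RtoC 0]_(i <- r | P i) k i)
    (fun s => \big[Cplus/RtoC 0]_(i <- r | P i) p i s).
Proof.
move=> h; elim: r => [|i r IH].
  rewrite big_nil; apply: (has_pole_lim _ (RtoC 0)); apply: Ccvg_ext (Ccvg_const (RtoC 0)).
  by apply: filter_forall => s; rewrite big_nil.
rewrite big_cons; case: ifP => Pi.
  apply: has_pole_ext (has_pole_plus _ _ _ _ (h i Pi) IH).
  by apply: filter_forall => s; rewrite big_cons Pi.
by apply: has_pole_ext IH; apply: filter_forall => s; rewrite big_cons Pi.
Qed.

Definition Tterm (f : nat -> C) (s : R) (p : nat) : C :=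
  if prime p then (f p * RtoC (ln (INR p) * npow p s))%C else RtoC 0.
(** The part of [Qser] that is linear in [f]; linearity is what allows the decomposition
    into characters. *)
Definition Tser (f : nat -> C) (s : R) : C := Csum (Tterm f s).

Section TQ.
Variables (f : nat -> C) (f1 : forall n, Cmod (f n) <= 1).

Lemma Tser_sum s : 1 < s -> Csum_to (Tterm f s) (Tser f s).
Proof.
move=> s1; apply: Csummable_ex; apply: Csummable_le (ex_series_ln_npow s s1) => p; rewrite /Tterm.
case: ifP => _; first by apply: Cmod_le1_mult => //; apply: ln_npow_ge0.
by rewrite Cmod_0; apply: ln_npow_ge0.
Qed.

(** The difference is a sum of ln p w^2/(1 - w) with |w| <= p^(-s), dominated by ln p /
    p^2. *)
Lemma Qser_sub_Tser_cvg : exists l, Ccvg (at_right 1) (fun s => Qser f s - Tser f s)%C l.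
Proof.
pose u (s : R) (p : nat) : C := (Qterm f s p - Tterm f s p)%C.
have [] // := tannery (F := at_right 1) (fun p => 2 * (ln (INR p) * npow p 2)) u (u 1) (fun s =>
  Qser f s - Tser f s)%C.
- by apply: ex_series_scalR; apply: ex_series_ln_npow; lra.
- apply: at_right_le2 => s hs p; rewrite /u /Qterm /Tterm.
  have l0 := ln_INR_ge0 p; have q0 := ln_npow_ge0 p 2.
  case: ifP => pp; last by rewrite (_ : RtoC 0 - RtoC 0 = 0)%C ?Cmod_0; [lra|ring].
  have w := Cmod_fp f f1 p s pp ltac:(lra); have w2 := one_minus_ge _ w.
  have w0 := one_minus_neq0 _ w.
  have -> : (ln (INR p) * (f p * npow p s / (1 - f p * npow p s)) - f p * RtoC (ln (INR p) * npow
    p s)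
    = ln (INR p) * ((f p * npow p s) * (f p * npow p s) / (1 - f p * npow p s)))%C.
    by rewrite RtoC_mult; field.
  rewrite Cmod_mult Cmod_R Rabs_pos_eq // Cmod_div // Cmod_mult.
  have -> : 2 * (ln (INR p) * npow p 2) = ln (INR p) * (npow p 2 / / 2) by field.
  apply: Rmult_le_compat_l => //.
  have c : Cmod (f p * npow p s)%C <= npow p 1.
    apply: Rle_trans (npow_le p 1 s ltac:(lra)).
    by apply: Cmod_le1_mult => //; apply: npow_ge0.
  have c0 := Cmod_ge_0 (f p * npow p s)%C.
  apply: Rmult_le_compat.
  + by apply: Rmult_le_pos.
  + by left; apply: Rinv_0_lt_compat; lra.
  + by rewrite (_ : 2 = 1 + 1) // npow_add; apply: Rmult_le_compat.
  + by apply: Rinv_le_contravar; lra.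
- move=> p; rewrite /u /Qterm /Tterm; case: ifP => pp; last exact: Ccvg_const.
  have h : Ccvg (at_right 1) (fun s => RtoC (npow p s)) (npow p 1) by apply: Ccvg_RtoC;
    apply: npow_cont.
  apply: Ccvg_minus; apply: Ccvg_mult (Ccvg_const _) _; last first.
    apply: Ccvg_RtoC; apply: (continuous_at_right (fun s => ln (INR p) * npow p s)).
    by rewrite /npow /Rpower; auto_derive.
  have hf : Ccvg (at_right 1) (fun s => f p * npow p s)%C (f p * npow p 1)%C by apply: Ccvg_mult
    (Ccvg_const _) h.
  apply: Ccvg_mult (hf) _; apply: Ccvg_inv; first by apply: one_minus_neq0; apply: Cmod_fp => //;
    lra.
  by apply: Ccvg_minus (Ccvg_const _) hf.
- apply: at_right_le2 => s hs; apply: Csum_to_minus; last by apply: Tser_sum; lra.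
  by apply: Csummable_ex; apply: (Qser_summable f f1); lra.
by move=> _ h; eexists; exact: h.
Qed.
End TQ.

Lemma Tser_one_pole : has_pole 1 (Tser one_seq).
Proof.
have o1 := cmul_le1 _ one_cmul.
have [l h] := Qser_sub_Tser_cvg one_seq o1.
have := has_pole_plus _ _ _ _ Qser_one_pole (has_pole_scal (- (1))%C _ _ (has_pole_lim _ _ h)).
rewrite (_ : 1 + - (1) * 0 = 1)%C; last by ring.
by apply: has_pole_ext; apply: filter_forall => s; ring.
Qed.

Definition residue (d a n : nat) : C := if n == a %[mod d] then RtoC 1 else RtoC 0.

Lemma residue_le1 d a n : Cmod (residue d a n) <= 1.
Proof. by rewrite /residue; case: ifP => _; rewrite ?Cmod_1 ?Cmod_0; lra. Qed.

Section Progression.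
Variable d0 : nat.
Let d := d0.+2.
Notation U := {unit 'Z_d}.
Notation ch := {ffun U -> 'I_(rootn d0).+2}.
Notation om := (omega (rootn d0)).
Notation is_h := (is_hom U (rootn d0)).

(** The principal character differs from the constant sequence 1 only at the finitely
    many primes dividing d. For the other characters [Qser] is the quotient of [Dser] by
    [Lser], whose denominator does not vanish at 1. *)
Lemma Tser_chi_pole (f : ch) : is_h f ->
  has_pole (if f == GRing.zero then RtoC 1 else RtoC 0) (Tser (chi d0 f)).
Proof.
move=> hf; have cf := chi_cmul d0 f hf; have f1 := cmul_le1 _ cf.
case: ifP => [/eqP f0|/negbT f0].
  have o1 := cmul_le1 _ one_cmul.
  have e n : chi d0 f n = if coprime d n then RtoC 1 else RtoC 0.
    by rewrite /chi f0 ffunE omega0.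
  (* Only primes p <= d occur, for which p^(-1) <= d p^(-2). *)
  have [] := tannery (F := at_right 1) (fun p => INR d * (ln (INR p) * npow p 2))
    (fun s p => Tterm one_seq s p - Tterm (chi d0 f) s p)%C
    (fun p => Tterm one_seq 1 p - Tterm (chi d0 f) 1 p)%C
    (fun s => Tser one_seq s - Tser (chi d0 f) s)%C.
  - by apply: ex_series_scalR; apply: ex_series_ln_npow; lra.
  - apply: at_right_le2 => s hs p; rewrite /Tterm e.
    have b0 : 0 <= INR d * (ln (INR p) * npow p 2).
      by apply: Rmult_le_pos; [apply: pos_INR|apply: ln_npow_ge0].
    case: ifP => pp; last by rewrite (_ : RtoC 0 - RtoC 0 = 0)%C ?Cmod_0 //; ring.
    have -> : one_seq p = 1%C by rewrite /one_seq; case: eqP pp => // ->.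
    case: ifP => dp.
      by rewrite (_ : _ - _ = 0)%C ?Cmod_0 //; ring.
    have pd : (p %| d)%N by rewrite -[_ %| _]negbK -prime_coprime // coprime_sym dp.
    have pld : INR p <= INR d by apply: le_INR; apply/leP; apply: dvdn_leq.
    rewrite (_ : _ - _ = RtoC (ln (INR p) * npow p s))%C; last by ring.
    have q0 := ln_INR_ge0 p; have p0 := INR_gt0 p (prime_gt0 pp).
    rewrite Cmod_R Rabs_pos_eq; last exact: ln_npow_ge0.
    have -> : INR d * (ln (INR p) * npow p 2) = ln (INR p) * (INR d * npow p 2) by ring.
    apply: Rmult_le_compat_l => //; apply: Rle_trans (npow_le p 1 s ltac:(lra)) _.
    rewrite (_ : 2 = 1 + 1) // npow_add npow_s1 ?prime_gt0 //.
    have i0 : 0 < / INR p by apply: Rinv_0_lt_compat.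
    have : INR p * / INR p = 1 by rewrite Rinv_r; lra.
    have := Rmult_le_compat_r (/ INR p) _ _ ltac:(lra) pld; nra.
  - move=> p; have h g : Ccvg (at_right 1) ((Tterm g)^~ p) (Tterm g 1 p).
      rewrite /Tterm; case: ifP => _; last exact: Ccvg_const.
      apply: Ccvg_mult (Ccvg_const _) _; apply: Ccvg_RtoC.
      apply: (continuous_at_right (fun s => ln (INR p) * npow p s)).
      by rewrite /npow /Rpower; auto_derive.
    by apply: Ccvg_minus.
  - by apply: at_right_le2 => s hs; apply: Csum_to_minus; apply: Tser_sum => //; lra.
  move=> _ h.
  have := has_pole_plus _ _ _ _ Tser_one_pole (has_pole_scal (- (1))%C _ _ (has_pole_lim _ _ h)).
  rewrite (_ : 1 + - (1) * 0 = 1)%C; last by ring.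
  by apply: has_pole_ext; apply: filter_forall => s; ring.
have bf := chi_sum_bound d0 f hf f0.
have L0 := chi_nonvanishing d0 f hf f0.
have hL := Lser_limit _ f1 _ bf; have hD := Dser_limit _ f1 _ bf.
have hQ : Ccvg (at_right 1) (Qser (chi d0 f)) (Dser_at1 (chi d0 f) / Lser_at1 (chi d0 f))%C.
  apply: Ccvg_ext (Ccvg_mult _ _ _ _ hD (Ccvg_inv _ _ L0 hL)).
  have /CcvgP/(_ (Cmod (Lser_at1 (chi d0 f))) (proj1 (Cmod_gt_0 _) L0)) near := hL.
  apply: filter_imp (filter_and _ _ near (at_right_lt 1 Rlt_0_1)) => s [hs s1].
  rewrite -(Lser_mul_Qser _ cf s ltac:(lra)); field => e; move: hs.
  rewrite e (_ : 0 - Lser_at1 (chi d0 f) = - Lser_at1 (chi d0 f))%C; last by ring.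
  by rewrite Cmod_opp; lra.
have [l h] := Qser_sub_Tser_cvg _ f1.
have := has_pole_plus _ _ _ _ (has_pole_lim _ _ hQ) (has_pole_scal (- (1))%C _ _ (has_pole_lim _
  _ h)).
rewrite (_ : 0 + - (1) * 0 = 0)%C; last by ring.
by apply: has_pole_ext; apply: filter_forall => s; ring.
Qed.

(** Dirichlet's theorem with a constant term: only the principal character contributes
    to the pole. *)
Lemma Qser_residue_pole a : coprime d a ->
  has_pole (RtoC (/ INR (totient d))) (Qser (residue d a)).
Proof.
move=> da; have phi0 : 0 < INR (totient d) by apply: INR_gt0; rewrite totient_gt0.
have [l h] := Qser_sub_Tser_cvg _ (residue_le1 d a).
have phiC : RtoC (INR (totient d)) <> 0%C by move/RtoC_inj; lra.
have hT : has_pole (RtoC (/ INR (totient d))) (Tser (residue d a)).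
  have := has_pole_scal (/ RtoC (INR (totient d)))%C _ _ (has_pole_sum _ (index_enum _) (fun f :
    ch => is_h f) _ _
    (fun f hf => has_pole_scal (om (f (unit_of d0 a)^-1%g)) _ _ (Tser_chi_pole f hf))).
  rewrite (bigD1 (GRing.zero : ch)) ?is_hom0 //= [X in (_ + X)%C]big1; last first.
    by move=> f /andP [_ /negbTE ->]; rewrite Cmult_0_r.
  rewrite eqxx ffunE omega0 Cmult_1_r Cplus_0_r Cmult_1_r -RtoC_inv; last lra.
  apply: has_pole_ext; apply: filter_imp (at_right_lt 1 Rlt_0_1) => s hs.
  symmetry; apply: Csum_unique.
  apply: Csum_to_ext (Csum_to_scal _ _ _ (Csum_to_sum _ _ _ _ _ (fun f hf => Csum_to_scal _ _ _
    (Tser_sum (chi d0 f) (cmul_le1 _ (chi_cmul d0 f hf)) s ltac:(lra))))) => p.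
  rewrite /Tterm; case: ifP => _; last first.
    by rewrite big1 ?Cmult_0_r // => f _; rewrite Cmult_0_r.
  rewrite (eq_bigr (fun f : ch => (om (f (unit_of d0 a)^-1%g) * chi d0 f p * RtoC (ln (INR p) *
    npow p s))%C)); last first.
    by move=> f _; rewrite Cmult_assoc.
  rewrite -big_distrl /= residue_orthogonality // /residue; case: ifP => _; last by ring.
  by rewrite -/d RtoC_inv; [field|lra].
have := has_pole_plus _ _ _ _ hT (has_pole_lim _ _ h).
rewrite Cplus_0_r; apply: has_pole_ext; apply: filter_forall => s; ring.
Qed.
End Progression.

(** * The logarithm of zeta_{d,a} on the real axis *)

Lemma Cexp_R (r : R) : Cexp (RtoC r) = RtoC (exp r).
Proof. by rewrite /Cexp /RtoC /= cos_0 sin_0; congr pair; ring. Qed.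

Lemma Clog_R (r : R) : 0 < r -> Clog (RtoC r) = RtoC (ln r).
Proof.
move=> r0; rewrite /Clog /Carg Cmod_R Rabs_pos_eq; last lra.
case: Rle_dec => [_|[]] /=; last lra.
by rewrite /Rdiv Rinv_r ?acos_1; last lra.
Qed.

Lemma nat_Cpow_R (n : nat) (x : R) : nat_Cpow n (- RtoC x)%C = RtoC (npow n x).
Proof. by rewrite /nat_Cpow -RtoC_opp -RtoC_mult Cexp_R. Qed.

Section LogZeta.
Variables (d a : nat).

Definition log_factor (x : R) (p : nat) : R :=
  if prime_mod d a p then - ln (1 - npow p x) else 0.

Definition log_zeta (x : R) : R := Series (log_factor x).

Lemma one_minus_npow p x : prime_mod d a p -> 1 <= x -> / 2 <= 1 - npow p x < 1.
Proof.
move=> /andP [pp _] x1; have := npow_prime_half p x pp x1; have := npow_gt0 p x; lra.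
Qed.

Lemma log_factor_derive p x : 1 <= x -> is_derive (log_factor^~ p) x
  (if prime_mod d a p then - (ln (INR p) * (npow p x / (1 - npow p x))) else 0).
Proof.
move=> x1; rewrite /log_factor; case: ifP => pp; last exact: is_derive_const.
have h := one_minus_npow p x pp x1; have hn := npow_derive p x.
auto_derive; first by do ! split=> //; [eexists; exact: hn|lra].
have -> : Derive (fun x => npow p x) x = - ln (INR p) * npow p x by apply: is_derive_unique.
by field; lra.
Qed.

Lemma log_factor_bound p x : 1 <= x -> 0 <= log_factor x p <= 2 * npow p x.
Proof.
move=> x1; rewrite /log_factor; case: ifP => pp; last by have := npow_ge0 p x; lra.
have h := one_minus_npow p x pp x1; set w := npow p x in h *; split.
  by have := ln_le (1 - w) 1 ltac:(lra) ltac:(lra); rewrite ln_1; lra.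
rewrite -ln_Rinv; last lra.
have := exp_ineq1_le (2 * w) => e.
have : / (1 - w) <= exp (2 * w).
  apply: Rle_trans e; apply: (Rmult_le_reg_r (1 - w)); first lra.
  by rewrite Rinv_l; nra.
have i0 : 0 < / (1 - w) by apply: Rinv_0_lt_compat; lra.
by move=> /(ln_le _ _ i0); rewrite ln_exp.
Qed.

Lemma ex_series_log_factor x : 1 < x -> ex_series (log_factor x).
Proof.
move=> x1; apply: (ex_series_leR _ _ (fun p => log_factor_bound p x ltac:(lra))).
by apply: ex_series_scalR; apply: ex_series_npow.
Qed.

Lemma Csum_to_R (u : nat -> R) : ex_series u -> Csum_to (fun n => RtoC (u n)) (RtoC (Series u)).
Proof.
move=> /Series_correct h; apply/Ccvg_shift.
apply: Ccvg_ext (Ccvg_RtoC _ _ h); apply: filter_forall => N; rewrite sum_n_rsum.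
by rewrite (big_morph RtoC RtoC_plus (erefl (RtoC 0))).
Qed.

Lemma log_zeta_daE x : 1 < x -> log_zeta_da d a (RtoC x) = RtoC (log_zeta x).
Proof.
move=> x1; have h := Csum_to_R _ (ex_series_log_factor x x1).
rewrite /log_zeta_da (_ : Clim _ _ = - RtoC (log_zeta x))%C; first by ring.
apply: Clim_unique; apply: Ccvg_ext (Ccvg_opp _ _ h).
apply: filter_forall => N; rewrite [RHS]big_mkcond /=.
elim: N => [|N IH]; first by rewrite !big_nil; ring.
rewrite !big_nat_recr //= -IH /log_factor; case: ifP => pN; last by ring.
have hN := one_minus_npow N x pN ltac:(lra).
by rewrite nat_Cpow_R -RtoC_minus Clog_R ?RtoC_opp; [ring|lra].
Qed.

(** The partial products are exponentials of the partial sums of [log_zeta]. *)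
Lemma zeta_daE x : 1 < x -> zeta_da d a (RtoC x) = RtoC (exp (log_zeta x)).
Proof.
move=> x1; apply: Clim_unique.
have h : filterlim (fun N => exp (\rsum_(0 <= p < N.+1) log_factor x p)) eventually (locally (exp
  (log_zeta x))).
  have hs := Series_correct _ (ex_series_log_factor x x1).
  have hs' : filterlim (fun N => \rsum_(0 <= p < N.+1) log_factor x p) eventually (locally
    (log_zeta x)).
    by apply: filterlim_ext hs => n; rewrite sum_n_rsum.
  apply: filterlim_comp hs' _; apply: continuous_exp.
apply/Ccvg_shift; apply: Ccvg_ext (Ccvg_RtoC _ _ h).
apply: filter_forall => N; move: N.+1 => {}N.
rewrite [RHS]big_mkcond /=.
elim: N => [|N IH]; first by rewrite !big_nil exp_0.
rewrite !big_nat_recr //= exp_plus RtoC_mult -IH /log_factor; congr Cmult; case: ifP => pN;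
  last by rewrite exp_0.
have hN := one_minus_npow N x pN ltac:(lra).
rewrite nat_Cpow_R -RtoC_minus exp_Ropp exp_ln; last lra.
by rewrite /Cdiv Cmult_1_l RtoC_inv //; lra.
Qed.

(** Termwise differentiation; the derivative of -ln(1 - p^(-t)) is -ln p p^(-t)/(1 -
    p^(-t)). *)
Lemma log_zeta_Cderiv x : 1 < x -> Cderiv (fun t => RtoC (log_zeta t)) x (- Qser (residue d a) x)%C.
Proof.
move=> x1; set dl := (x - 1) / 2; have d0 : 0 < dl by rewrite /dl; lra.
have r1 := residue_le1 d a.
have dE p t : 1 <= t -> RtoC (if prime_mod d a p then - (ln (INR p) * (npow p t / (1 - npow p
  t))) else 0) =
   (- Qterm (residue d a) t p)%C.
  move=> t1; rewrite /Qterm /prime_mod /residue; case: (boolP (prime p)) => pp /=; last by ring.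
  case: ifP => pa; last by rewrite /Cdiv; ring.
  have := npow_prime_half p t pp t1 => h.
  rewrite RtoC_opp RtoC_mult RtoC_div ?RtoC_minus; last by lra.
  by rewrite Cmult_1_l.
have -> : (- Qser (residue d a) x)%C = Csum (fun p => (- Qterm (residue d a) x p)%C).
  symmetry; apply: Csum_unique.
  have := Csum_to_scal (- (1))%C _ _ (Csummable_ex _ (Qser_summable (residue d a) r1 x x1)).
  rewrite (_ : - (1) * Csum (Qterm (residue d a) x) = - Qser (residue d a) x)%C;
    last by rewrite /Qser; ring.
  by apply: Csum_to_ext => n; ring.
apply: (Cderiv_Csum (fun p t => RtoC (log_factor t p)) _ _ (fun p =>
  2 * (ln (INR p) * npow p (x - dl))) x dl d0).
- by apply: ex_series_scalR; apply: ex_series_ln_npow; rewrite /dl; lra.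
- move=> t /Rabs_def2 ht; apply: Csum_to_R; apply: ex_series_log_factor; move: ht; rewrite /dl; lra.
- move=> p; rewrite -dE; last lra.
  by apply: is_derive_Cderiv; apply: log_factor_derive; lra.
- move=> p t /Rabs_def2 ht; rewrite -RtoC_minus Cmod_R.
  have x1' : 1 <= x - dl by rewrite /dl; lra.
  apply: (mvt_bound_sym (log_factor^~ p) (fun t => if prime_mod d a p then - (ln (INR p) * (npow
    p t / (1 - npow p t))) else 0) (x - dl) (x + dl)).
  + by move=> y hy; apply: log_factor_derive; lra.
  + move=> y hy; rewrite -Cmod_R dE; last lra.
    rewrite Cmod_opp; apply: Rle_trans (Qterm_bound (residue d a) r1 y p ltac:(lra)) _.
    apply: Rmult_le_compat_l; first lra.
    apply: Rmult_le_compat_l; first exact: ln_INR_ge0.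
    by apply: npow_le; lra.
  + lra.
  + lra.
Qed.

Lemma log_zeta_derive x : 1 < x ->
  exists2 q, (- Qser (residue d a) x)%C = RtoC q & is_derive log_zeta x q.
Proof.
move=> x1; have h := log_zeta_Cderiv x x1.
have [hr _] := Cderiv_is_derive _ _ _ h.
exists (Re (- Qser (residue d a) x)%C) => //.
exact: (Ccvg_unique _ _ _ h (is_derive_Cderiv _ _ _ hr)).
Qed.

(** [log_zeta] is a logarithm of zeta_{d,a} on the real axis, whatever the branch
    elsewhere. *)
Lemma zeta_da_logderiv x : 1 < x ->
  (C_derive (zeta_da d a) x / zeta_da d a x)%C = (- Qser (residue d a) x)%C.
Proof.
move=> x1; have [q eq hq] := log_zeta_derive x x1.
have hd : is_derive (fun t => exp (log_zeta t)) x (q * exp (log_zeta x)).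
  exact: (is_derive_comp exp log_zeta x _ _ (is_derive_exp _) hq).
rewrite (C_derive_Cderiv _ _ (RtoC (q * exp (log_zeta x)))).
  rewrite zeta_daE // eq RtoC_mult; field; move/RtoC_inj; have := exp_pos (log_zeta x); lra.
apply: Cderiv_ext_loc (is_derive_Cderiv _ _ _ hd).
have h : 0 < x - 1 by lra.
exists (mkposreal _ h) => t; rewrite /ball /= /AbsRing_ball /abs /minus /plus /opp /= =>
  /Rabs_def2 ht.
by rewrite zeta_daE //; lra.
Qed.
End LogZeta.

Lemma gamma_da_limit d a : (2 <= d)%N -> coprime d a ->
  Ccvg (at_right 1)
    (fun x : R => (- Qser (residue d a) x + 1 / (INR (totient d) * (x - 1)))%C)
    (gamma_da d a).
Proof.
case: d => [|[|d]] // _ da; have [l h] := Qser_residue_pole d a da.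
have phi0 : 0 < INR (totient d.+2) by apply: INR_gt0; rewrite totient_gt0.
have h2 : Ccvg (at_right 1) (fun x : R => (- Qser (residue d.+2 a) x + 1 / (INR (totient d.+2) *
  (x - 1)))%C) (- l)%C.
  apply: Ccvg_ext (Ccvg_opp _ _ h); apply: filter_imp (at_right_lt 1 Rlt_0_1) => s hs.
  rewrite RtoC_inv ?RtoC_minus; last lra.
  field; split.
    by rewrite -RtoC_minus; move/RtoC_inj; lra.
  by move/RtoC_inj; lra.
have -> : gamma_da d.+2 a = (- l)%C => //.
apply: Clim_unique; apply: Ccvg_ext h2; apply: filter_imp (at_right_lt 1 Rlt_0_1) => s hs.
by rewrite zeta_da_logderiv //; lra.
Qed.

(** * The complex exponential and integrals along segments *)

(** Complex differentiability in terms of [Cmod]. The two normed modules over the field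
    [C] with carrier [C] yield derivatives of different types; this is their common content. *)
Definition Cdiff (g : C -> C) (z l : C) : Prop :=
  forall eps, 0 < eps -> exists2 dl, 0 < dl &
    forall w, Cmod (w - z)%C < dl -> Cmod (g w - g z - l * (w - z))%C <= eps * Cmod (w - z)%C.

Local Notation C_derivative := (is_derive (K := C_AbsRing) (V := AbsRing_NormedModule C_AbsRing)).

Lemma Cdiff_is_derive g z l : Cdiff g z l -> C_derivative g z l.
Proof.
move=> h; split; first exact: is_linear_scal_l.
move=> x hx eps; have <- := is_filter_lim_locally_unique _ _ hx.
have [dl d0 hd] := h eps (cond_pos eps).
exists (mkposreal dl d0) => y hy.
have := hd y hy; congr (_ <= _); congr Cmod.
rewrite /minus /plus /opp /scal /= /mult /=; ring.
Qed.

Lemma is_derive_Cdiff g z l : C_derivative g z l -> Cdiff g z l.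
Proof.
move=> [_ h] eps e0; have [dl hd] := h z (fun P H => H) (mkposreal eps e0).
exists dl; first exact: cond_pos.
move=> w hw; have := hd w hw; congr (_ <= _); congr Cmod.
rewrite /minus /plus /opp /scal /= /mult /=; ring.
Qed.

Lemma is_derive_C_Cdiff g z l :
  is_derive (K := C_AbsRing) (V := C_NormedModule) g z l -> Cdiff g z l.
Proof.
move=> [_ h] eps e0; have [dl hd] := h z (fun P H => H) (mkposreal eps e0).
exists dl; first exact: cond_pos.
move=> w hw; have := hd w hw; congr (_ <= _); congr Cmod.
rewrite /minus /plus /opp /scal /= /mult /=; ring.
Qed.

Lemma sin_le b : Rabs (sin b) <= Rabs b.
Proof.
have := mvt_bound_sym sin cos (- Rabs b) (Rabs b) 1 0 b.
rewrite sin_0 !Rminus_0_r Rmult_1_l; apply.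
- by move=> x _; apply: is_derive_sin.
- by move=> x _; apply: Rabs_le; have := COS_bound x; lra.
- by have := Rabs_pos b; lra.
- by apply/Rabs_le_between; lra.
Qed.

Lemma cos_sub1 b : Rabs (cos b - 1) <= Rabs b * Rabs b.
Proof.
have := mvt_bound_sym cos (fun x => - sin x) (- Rabs b) (Rabs b) (Rabs b) 0 b.
rewrite cos_0 !Rminus_0_r; apply.
- by move=> x _; apply: is_derive_cos.
- move=> x hx; rewrite Rabs_Ropp; apply: Rle_trans (sin_le x) _.
  by apply: Rabs_le; lra.
- by have := Rabs_pos b; lra.
- by apply/Rabs_le_between; lra.
Qed.

Lemma sin_sub b : Rabs (sin b - b) <= Rabs b * Rabs b * Rabs b.
Proof.
have := mvt_bound_sym (fun x => sin x - x) (fun x => cos x - 1) (- Rabs b) (Rabs b) (Rabs b *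
  Rabs b) 0 b.
rewrite sin_0 !Rminus_0_r; apply.
- by move=> x _; auto_derive => //; ring.
- move=> x hx; apply: Rle_trans (cos_sub1 x) _.
  have := Rabs_le x (Rabs b) ltac:(lra); have := Rabs_pos x; nra.
- by have := Rabs_pos b; lra.
- by apply/Rabs_le_between; lra.
Qed.

Lemma exp_sub1 a : Rabs a <= 1 -> Rabs (exp a - 1) <= 3 * Rabs a.
Proof.
move=> a1; have := mvt_bound_sym exp exp (- Rabs a) (Rabs a) 3 0 a.
rewrite exp_0 Rminus_0_r; apply.
- by move=> x _; apply: is_derive_exp.
- move=> x hx; rewrite Rabs_pos_eq; last by left; exact: exp_pos.
  by apply: Rle_trans exp_le_3; apply: exp_mono; lra.
- by have := Rabs_pos a; lra.
- by apply/Rabs_le_between; lra.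
Qed.

Lemma exp_sub2 a : Rabs a <= 1 -> Rabs (exp a - 1 - a) <= 3 * Rabs a * Rabs a.
Proof.
move=> a1; have := mvt_bound_sym (fun x => exp x - 1 - x) (fun x =>
  exp x - 1) (- Rabs a) (Rabs a) (3 * Rabs a) 0 a.
rewrite exp_0 !Rminus_0_r Rminus_diag Rminus_0_r; apply.
- by move=> x _; auto_derive => //; ring.
- move=> x hx; have hx' := Rabs_le x (Rabs a) ltac:(lra).
  by apply: Rle_trans (exp_sub1 x ltac:(lra)) _; lra.
- by have := Rabs_pos a; lra.
- by apply/Rabs_le_between; lra.
Qed.

Lemma Cmod_le_sum (z : C) : Cmod z <= Rabs (Re z) + Rabs (Im z).
Proof.
rewrite {1}(_ : z = (RtoC (Re z) + Ci * RtoC (Im z))%C); last first.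
  by case: z => a b; rewrite /RtoC /Ci /Cplus /Cmult /=; congr pair; ring.
apply: Rle_trans (Cmod_triangle _ _) _; rewrite Cmod_mult Cmod_Ci !Cmod_R Rmult_1_l.
exact: Rle_refl.
Qed.

(** Any bound of order |h|^2 would do; it only serves to differentiate [Cexp]. *)
Lemma Cexp_taylor (h : C) : Cmod h <= 1 -> Cmod (Cexp h - 1 - h)%C <= 20 * (Cmod h * Cmod h).
Proof.
move=> h1; have ha := re_le_Cmod h; have hb := im_le_Cmod h.
have h0 := Cmod_ge_0 h; set m := Cmod h in h0 h1 ha hb *.
set a := Re h in ha; set b := Im h in hb.
have A0 := Rabs_pos a; have B0 := Rabs_pos b.
apply: Rle_trans (Cmod_le_sum _) _.
have -> : Re (Cexp h - 1 - h)%C = (exp a - 1 - a) + exp a * (cos b - 1).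
  by rewrite /a /b /Cexp /Re /Im /Cminus /Cplus /Copp /RtoC /=; ring.
have -> : Im (Cexp h - 1 - h)%C = exp a * (sin b - b) + (exp a - 1) * b.
  by rewrite /a /b /Cexp /Re /Im /Cminus /Cplus /Copp /RtoC /=; ring.
have t1 := Rabs_triang (exp a - 1 - a) (exp a * (cos b - 1)).
have t2 := Rabs_triang (exp a * (sin b - b)) ((exp a - 1) * b).
rewrite !Rabs_mult in t1 t2.
have e0 : 0 < exp a by apply: exp_pos.
have e3 : exp a <= 3.
  by apply: Rle_trans exp_le_3; apply: exp_mono; have := Rle_abs a; lra.
rewrite (Rabs_pos_eq (exp a)) in t1 t2; try lra.
have s1 := exp_sub2 a ltac:(lra); have s2 := cos_sub1 b.
have s3 := sin_sub b; have s4 := exp_sub1 a ltac:(lra).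
have mm : 0 <= m * m by apply: Rmult_le_pos.
have q1 : Rabs a * Rabs a <= m * m by apply: Rmult_le_compat.
have q2 : Rabs b * Rabs b <= m * m by apply: Rmult_le_compat.
have q3 : Rabs a * Rabs b <= m * m by apply: Rmult_le_compat.
have q4 : Rabs b * Rabs b * Rabs b <= m * m * 1.
  by apply: Rmult_le_compat => //; [apply: Rmult_le_pos|lra].
have p1 : exp a * Rabs (cos b - 1) <= 3 * (m * m).
  by apply: Rmult_le_compat; [lra|exact: Rabs_pos|lra|lra].
have p2 : exp a * Rabs (sin b - b) <= 3 * (m * m).
  by apply: Rmult_le_compat; [lra|exact: Rabs_pos|lra|lra].
have p3 : Rabs (exp a - 1) * Rabs b <= 3 * Rabs a * Rabs b by apply: Rmult_le_compat_r.
lra.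
Qed.

Lemma Cexp_plus (z w : C) : Cexp (z + w)%C = (Cexp z * Cexp w)%C.
Proof.
case: z w => [a b] [c d]; rewrite /Cexp /Cplus /Cmult /Re /Im /= exp_plus cos_plus sin_plus.
by congr pair; ring.
Qed.

Lemma Cmod_Cexp (z : C) : Cmod (Cexp z) = exp (Re z).
Proof.
rewrite /Cmod /Cexp /= (_ : _ + _ = exp (Re z) * exp (Re z)).
  by apply: sqrt_square; left; exact: exp_pos.
by have := sin2_cos2 (Im z); rewrite /Rsqr; nra.
Qed.

Lemma Cexp_derivative (z : C) : C_derivative Cexp z (Cexp z).
Proof.
apply: Cdiff_is_derive => eps e0.
have m0 : 0 < Cmod (Cexp z) by rewrite Cmod_Cexp; exact: exp_pos.
have k0 : 0 < 20 * Cmod (Cexp z) by lra.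
exists (Rmin 1 (eps / (20 * Cmod (Cexp z)))); first by apply: Rmin_glb_lt;
  [lra|apply: Rdiv_lt_0_compat].
move=> w hw.
have h1 := Rle_trans _ _ _ (Rlt_le _ _ hw) (Rmin_l _ _).
have h2 := Rle_trans _ _ _ (Rlt_le _ _ hw) (Rmin_r _ _).
set h := (w - z)%C in hw h1 h2 *.
have -> : w = (z + h)%C by rewrite /h; ring.
have -> : (Cexp (z + h) - Cexp z - Cexp z * h = Cexp z * (Cexp h - 1 - h))%C by rewrite Cexp_plus;
  ring.
rewrite Cmod_mult; have := Cexp_taylor h h1; have c0 := Cmod_ge_0 h => T.
have h3 : 20 * Cmod (Cexp z) * Cmod h <= eps.
  have := Rmult_le_compat_l _ _ _ (Rlt_le _ _ k0) h2.
  by have -> : 20 * Cmod (Cexp z) * (eps / (20 * Cmod (Cexp z))) = eps by field; lra.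
have := Rmult_le_compat_r _ _ _ c0 h3.
have := Rmult_le_compat_l _ _ _ (Rlt_le _ _ m0) T; lra.
Qed.

(** Componentwise integral of a complex function of a real variable; real integrals then
    give all its properties, at the cost of a factor 2 in [Cint_bound]. *)
Definition Cint (f : R -> C) (a b : R) : C :=
  (RInt (fun x => Re (f x)) a b, RInt (fun x => Im (f x)) a b).

Definition Ccont (f : R -> C) (a b : R) : Prop :=
  forall x, a <= x <= b ->
  continuous (fun x => Re (f x)) x /\ continuous (fun x => Im (f x)) x.

Lemma Ccont_ex f a b : a <= b -> Ccont f a b ->
  ex_RInt (fun x => Re (f x)) a b /\ ex_RInt (fun x => Im (f x)) a b.
Proof.
by move=> ab h; split; apply: (ex_RInt_continuous (V := R_CompleteNormedModule)) => x;
  rewrite Rmin_left // Rmax_right // => /h [].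
Qed.

Lemma Ccont_sub f a b c d : a <= c -> d <= b -> Ccont f a b -> Ccont f c d.
Proof. by move=> ac db h x hx; apply: h; lra. Qed.

Lemma Cint_Chasles f a b c : a <= b <= c -> Ccont f a c ->
  (Cint f a b + Cint f b c)%C = Cint f a c.
Proof.
move=> [ab bc] h.
have [r1 i1] := Ccont_ex f a b ab (Ccont_sub _ _ _ _ _ (Rle_refl _) bc h).
have [r2 i2] := Ccont_ex f b c bc (Ccont_sub _ _ _ _ _ ab (Rle_refl _) h).
by rewrite /Cint /Cplus /=; congr pair; apply: (RInt_Chasles (V := R_CompleteNormedModule)).
Qed.

Lemma Cint_minus f g a b : a <= b -> Ccont f a b -> Ccont g a b ->
  Cint (fun x => f x - g x)%C a b = (Cint f a b - Cint g a b)%C.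
Proof.
move=> ab hf hg; have [r1 i1] := Ccont_ex f a b ab hf; have [r2 i2] := Ccont_ex g a b ab hg.
by rewrite /Cint; congr pair; apply: (RInt_minus (V := R_CompleteNormedModule)).
Qed.

Lemma Cint_bound f a b K : a <= b -> Ccont f a b -> (forall x, a <= x <= b -> Cmod (f x) <= K) ->
  Cmod (Cint f a b) <= 2 * K * (b - a).
Proof.
move=> ab h hK; have [r1 i1] := Ccont_ex f a b ab h.
apply: Rle_trans (Cmod_le_sum _) _.
have b1 := abs_RInt_le_const _ _ _ K ab r1 (fun x hx => Rle_trans _ _ _ (re_le_Cmod _) (hK x hx)).
have b2 := abs_RInt_le_const _ _ _ K ab i1 (fun x hx => Rle_trans _ _ _ (im_le_Cmod _) (hK x hx)).
rewrite /Cint /Re /Im /=; rewrite /Re /Im in b1 b2; lra.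
Qed.

Lemma Cint_ext f g a b : (forall x, f x = g x) -> Cint f a b = Cint g a b.
Proof.
by move=> fg; rewrite /Cint; congr pair; apply: (RInt_ext (V := R_CompleteNormedModule)) => x _;
  rewrite fg.
Qed.

Lemma Cint_const c a b : Cint (fun _ => c) a b = (c * RtoC (b - a))%C.
Proof.
rewrite /Cint !RInt_const /scal /= /mult /= /Cmult /RtoC /= /Re /Im; congr pair; ring.
Qed.

Lemma RInt_affine A B a b : RInt (fun x => A + B * x) a b = A * (b - a) + B * (b * b - a * a) / 2.
Proof.
apply: is_RInt_unique.
have -> : A * (b - a) + B * (b * b - a * a) / 2 =
  minus (G := R_AbelianGroup) (A * b + B * b * b / 2) (A * a + B * a * a / 2).
  by rewrite /minus /plus /opp /=; field.
apply: (is_RInt_derive (V := R_CompleteNormedModule) (fun x => A * x + B * x * x / 2)) => x _.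
  by auto_derive => //; field.
apply: (ex_derive_continuous (V := R_NormedModule)); by auto_derive.
Qed.

(** * Goursat's theorem on a rectangle *)

Lemma Cdiff_line g (gam : R -> C) t0 l : Cdiff g (gam t0) l ->
  (forall t, Cmod (gam t - gam t0)%C <= Rabs (t - t0)) ->
  continuous (fun t => Re (g (gam t))) t0 /\ continuous (fun t => Im (g (gam t))) t0.
Proof.
move=> h hg; apply: (Ccvg_proj (F := locally t0) (fun t => g (gam t)) (g (gam t0))).
apply/CcvgP => eps e0.
have [dl d0 hd] := h 1 Rlt_0_1.
have l0 := Cmod_ge_0 l.
have m0 : 0 < Rmin dl (eps / (2 + Cmod l)) by apply: Rmin_glb_lt => //; apply: Rdiv_lt_0_compat;
  lra.
exists (mkposreal _ m0) => t ht.
have {}ht : Rabs (t - t0) < Rmin dl (eps / (2 + Cmod l)) by [].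
have h1 := Rlt_le_trans _ _ _ ht (Rmin_l _ _); have h2 := Rlt_le_trans _ _ _ ht (Rmin_r _ _).
have hw := hg t; set w := gam t in hw *; set z := gam t0 in hw hd *.
have := hd w ltac:(lra).
have := Cmod_triangle (g w - g z - l * (w - z)) (l * (w - z)).
rewrite (_ : g w - g z - l * (w - z) + l * (w - z) = g w - g z)%C; last by ring.
rewrite Cmod_mult => t1 t2.
have : (2 + Cmod l) * Rabs (t - t0) < eps.
  have := Rmult_lt_compat_l (2 + Cmod l) _ _ ltac:(lra) h2.
  by have -> : (2 + Cmod l) * (eps / (2 + Cmod l)) = eps by field; lra.
have := Rabs_pos (t - t0); nra.
Qed.

(** The integral of [g] along the boundary of [a,b] x [c,d], counterclockwise. *)
Definition rect_int (g : C -> C) (a b c d : R) : C :=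
  (Cint (fun x => g (x, c)) a b + Ci * Cint (fun y => g (b, y)) c d
   - Cint (fun x => g (x, d)) a b - Ci * Cint (fun y => g (a, y)) c d)%C.

Definition holo_rect (g : C -> C) (a b c d : R) : Prop :=
  forall x y, a <= x <= b -> c <= y <= d -> exists l, Cdiff g (x, y) l.

Definition cont_rect (g : C -> C) (a b c d : R) : Prop :=
  (forall y, c <= y <= d -> Ccont (fun x => g (x, y)) a b) /\
  (forall x, a <= x <= b -> Ccont (fun y => g (x, y)) c d).

Lemma holo_cont g a b c d : holo_rect g a b c d -> cont_rect g a b c d.
Proof.
move=> h; split=> [y hy x hx|x hx y hy]; have [l hl] := h x y ltac:(lra) ltac:(lra).
  apply: (Cdiff_line g (fun x => (x, y)) x l hl) => t.
  rewrite (_ : (t, y) - (x, y) = RtoC (t - x))%C ?Cmod_R; first exact: Rle_refl.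
  by rewrite /RtoC /Cminus /Cplus /Copp /=; congr pair; ring.
apply: (Cdiff_line g (fun y => (x, y)) y l hl) => t.
rewrite (_ : (x, t) - (x, y) = Ci * RtoC (t - y))%C ?Cmod_mult ?Cmod_Ci ?Cmod_R ?Rmult_1_l.
  exact: Rle_refl.
by rewrite /Ci /RtoC /Cmult /Cminus /Cplus /Copp /=; congr pair; ring.
Qed.

Lemma cont_rect_sub g a b c d a' b' c' d' : a <= a' -> b' <= b -> c <= c' -> d' <= d ->
  cont_rect g a b c d -> cont_rect g a' b' c' d'.
Proof.
move=> h1 h2 h3 h4 [hx hy]; split=> [y hy'|x hx'].
  by apply: (Ccont_sub _ a b); [|lra|apply: hx; lra]; lra.
by apply: (Ccont_sub _ c d); [|lra|apply: hy; lra]; lra.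
Qed.

Lemma rect_int_quarter g a m b c n d : a <= m <= b -> c <= n <= d -> cont_rect g a b c d ->
  rect_int g a b c d =
  (rect_int g a m c n + rect_int g m b c n + rect_int g a m n d + rect_int g m b n d)%C.
Proof.
move=> hm hn [hx hy]; rewrite /rect_int.
rewrite -(Cint_Chasles (fun x => g (x, c)) a m b hm (hx c ltac:(lra))).
rewrite -(Cint_Chasles (fun x => g (x, d)) a m b hm (hx d ltac:(lra))).
rewrite -(Cint_Chasles (fun y => g (a, y)) c n d hn (hy a ltac:(lra))).
rewrite -(Cint_Chasles (fun y => g (b, y)) c n d hn (hy b ltac:(lra))).
ring.
Qed.

Lemma rect_int_minus g p a b c d : a <= b -> c <= d -> cont_rect g a b c d -> cont_rect p a b c d ->
  rect_int (fun z => g z - p z)%C a b c d = (rect_int g a b c d - rect_int p a b c d)%C.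
Proof.
move=> ab cd [gx gy] [px py]; rewrite /rect_int !Cint_minus //; try ring.
all: by [apply: gx; lra|apply: gy; lra|apply: px; lra|apply: py; lra].
Qed.

Lemma rect_int_bound g a b c d K : a <= b -> c <= d -> cont_rect g a b c d ->
  (forall x y, a <= x <= b -> c <= y <= d -> Cmod (g (x, y)) <= K) ->
  Cmod (rect_int g a b c d) <= 4 * K * ((b - a) + (d - c)).
Proof.
move=> ab cd [hx hy] hK.
have b1 := Cint_bound (fun x => g (x, c)) a b K ab (hx c ltac:(lra)) (fun x h =>
  hK x c h ltac:(lra)).
have b2 := Cint_bound (fun x => g (x, d)) a b K ab (hx d ltac:(lra)) (fun x h =>
  hK x d h ltac:(lra)).
have b3 := Cint_bound (fun y => g (a, y)) c d K cd (hy a ltac:(lra)) (fun y h =>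
  hK a y ltac:(lra) h).
have b4 := Cint_bound (fun y => g (b, y)) c d K cd (hy b ltac:(lra)) (fun y h =>
  hK b y ltac:(lra) h).
rewrite /rect_int; move: b1 b2 b3 b4.
move: (Cint (fun x => g (x, c)) a b) (Cint (fun x => g (x, d)) a b) (Cint (fun y => g (a,
  y)) c d) (Cint (fun y => g (b, y)) c d) => w1 w2 w3 w4 b1 b2 b3 b4.
have t1 := Cmod_triangle (w1 + Ci * w4 - w2) (- (Ci * w3)).
have t2 := Cmod_triangle (w1 + Ci * w4) (- w2).
have t3 := Cmod_triangle w1 (Ci * w4).
rewrite !Cmod_opp !Cmod_mult !Cmod_Ci !Rmult_1_l in t1 t2 t3.
rewrite /Cminus in t1 t2 *; lra.
Qed.

Lemma continuous_affine A B x : continuous (fun t : R => A + B * t) x.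
Proof. by apply: (ex_derive_continuous (V := R_NormedModule)); auto_derive. Qed.

Lemma affine_h (al be : C) x y : (al + be * (x, y))%C =
  (Re al - Im be * y + Re be * x, Im al + Re be * y + Im be * x).
Proof.
by case: al be => [p q] [s t]; rewrite /Cplus /Cmult /Re /Im /=; congr pair; ring.
Qed.

Lemma affine_v (al be : C) x y : (al + be * (x, y))%C =
  (Re al + Re be * x + - Im be * y, Im al + Im be * x + Re be * y).
Proof.
by case: al be => [p q] [s t]; rewrite /Cplus /Cmult /Re /Im /=; congr pair; ring.
Qed.

Lemma cont_rect_affine al be a b c d : cont_rect (fun z => al + be * z)%C a b c d.
Proof.
split=> [y _ x _|x _ y _]; split.
- apply: (continuous_ext (fun t => Re al - Im be * y + Re be * t)) => [t|];
    last exact: continuous_affine.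
  by rewrite affine_h.
- apply: (continuous_ext (fun t => Im al + Re be * y + Im be * t)) => [t|];
    last exact: continuous_affine.
  by rewrite affine_h.
- apply: (continuous_ext (fun t => Re al + Re be * x + - Im be * t)) => [t|];
    last exact: continuous_affine.
  by rewrite affine_v.
- apply: (continuous_ext (fun t => Im al + Im be * x + Re be * t)) => [t|];
    last exact: continuous_affine.
  by rewrite affine_v.
Qed.

(** Affine functions have primitives; here both components are integrated explicitly. *)
Lemma rect_int_affine al be a b c d : rect_int (fun z => al + be * z)%C a b c d = 0%C.
Proof.
have hh y : Cint (fun x => al + be * (x, y))%C a b =
  ((Re al - Im be * y) * (b - a) + Re be * (b * b - a * a) / 2,
   (Im al + Re be * y) * (b - a) + Im be * (b * b - a * a) / 2).
  by rewrite (Cint_ext _ _ _ _ (fun x => affine_h al be x y)) /Cint /Re /Im /= !RInt_affine.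
have hv x : Cint (fun y => al + be * (x, y))%C c d =
  ((Re al + Re be * x) * (d - c) + - Im be * (d * d - c * c) / 2,
   (Im al + Im be * x) * (d - c) + Re be * (d * d - c * c) / 2).
  by rewrite (Cint_ext _ _ _ _ (fun y => affine_v al be x y)) /Cint /Re /Im /= !RInt_affine.
rewrite /rect_int !hh !hv /Ci /Cminus /Cplus /Cmult /Copp /RtoC /=.
by congr pair; field.
Qed.

(** The supremum of the left endpoints. *)
Lemma nested_point (u v : nat -> R) : (forall n, u n <= u n.+1) -> (forall n, v n.+1 <= v n) ->
  (forall n, u n <= v n) -> exists x, forall n, u n <= x <= v n.
Proof.
move=> hu hv uv.
have hu' m k : u m <= u (m + k)%N.
  by elim: k => [|k IH]; rewrite ?addn0 ?addnS; [lra|have := hu (m + k)%N; lra].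
have hv' m k : v (m + k)%N <= v m.
  by elim: k => [|k IH]; rewrite ?addn0 ?addnS; [lra|have := hv (m + k)%N; lra].
have cmp m n : u m <= v n.
  by have := hu' m n; have := hv' n m; rewrite [(n + m)%N]addnC; have := uv (m + n)%N; lra.
have [|| x [hx1 hx2]] := completeness (fun x => exists n, x = u n).
- by exists (v 0%N) => _ [n ->].
- by exists (u 0%N), 0%N.
exists x => n; split; first by apply: hx1; exists n.
by apply: hx2 => _ [m ->].
Qed.

(** If the integral is nonzero, its modulus exceeds eta (l1^2 + l2^2) for some eta > 0,
    where l1 and l2 are the side lengths. This bound is divided by 4 in each quarter of the
    rectangle, so the integral over some quarter again exceeds it, and so on. At the common
    point z of the nested rectangles g is affine up to eta/16 |w - z|; as affine functions
    have zero integral, the integral over a small rectangle around z is at most eta (l1 +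
    l2)^2 / 4 <= eta (l1^2 + l2^2), a contradiction. The sum of squares, unlike the area,
    needs no control on the shape of the rectangle. *)
Lemma goursat g a b c d : a <= b -> c <= d -> holo_rect g a b c d -> rect_int g a b c d = 0%C.
Proof.
move=> ab cd hol; have con := holo_cont _ _ _ _ _ hol.
apply: Cmod_eq_0; apply: Rle_antisym; last exact: Cmod_ge_0.
apply: Rnot_lt_le => E0.
pose l1 := b - a; pose l2 := d - c.
have hl1 : 0 <= l1 by rewrite /l1; lra.
have hl2 : 0 <= l2 by rewrite /l2; lra.
pose eta := Cmod (rect_int g a b c d) / (2 * (l1 * l1 + l2 * l2 + 1)).
have q0 : 0 <= l1 * l1 + l2 * l2 by nra.
have eta0 : 0 < eta by apply: Rdiv_lt_0_compat; lra.
pose pw n := (/ 2) ^ n.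
have pw0 n : 0 < pw n by apply: pow_lt; lra.
have pwS n : pw n.+1 = pw n / 2 by rewrite /pw -tech_pow_Rmult; field.
(* A rectangle of the n-th stage is given by its lower left corner [s]. *)
pose bad n (s : R * R) := eta * ((l1 * l1 + l2 * l2) * (pw n * pw n)) <
  Cmod (rect_int g s.1 (s.1 + l1 * pw n) s.2 (s.2 + l2 * pw n)).
have bad_dec n s : {bad n s} + {~ bad n s} by apply: Rlt_dec.
pose nxt n (s : R * R) : R * R :=
  let m := l1 * pw n.+1 in let k := l2 * pw n.+1 in
  if bad_dec n.+1 s then s else
  if bad_dec n.+1 (s.1 + m, s.2) then (s.1 + m, s.2) else
  if bad_dec n.+1 (s.1, s.2 + k) then (s.1, s.2 + k) else (s.1 + m, s.2 + k).
pose st := fix st n := if n is m.+1 then nxt m (st m) else (a, c).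
pose inside n (s : R * R) := [/\ a <= s.1, s.1 + l1 * pw n <= b, c <= s.2 & s.2 + l2 * pw n <= d].
have nxt_pos n s : s.1 <= (nxt n s).1 <= s.1 + l1 * pw n.+1 /\ s.2 <= (nxt n s).2 <=
  s.2 + l2 * pw n.+1.
  have m0 : 0 <= l1 * pw n.+1 by apply: Rmult_le_pos => //; left.
  have k0 : 0 <= l2 * pw n.+1 by apply: Rmult_le_pos => //; left.
  rewrite /nxt; case: (bad_dec _ _) => _ /=; first lra.
  by case: (bad_dec _ _) => _ /=; [lra|case: (bad_dec _ _) => _ /=; lra].
have inv n : inside n (st n) /\ bad n (st n).
  elim: n => [|n [[i1 i2 i3 i4] bn]].
    split; first by split; rewrite /= /pw /= /l1 /l2; lra.
    rewrite /bad /= /pw /= !Rmult_1_r.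
    have -> : a + l1 = b by rewrite /l1; ring.
    have -> : c + l2 = d by rewrite /l2; ring.
    have <- : eta * (2 * (l1 * l1 + l2 * l2 + 1)) = Cmod (rect_int g a b c d) by rewrite /eta;
      field; lra.
    by apply: Rmult_lt_compat_l => //; lra.
  have [[p1 p2] [p3 p4]] := nxt_pos n (st n).
  split.
    by rewrite pwS in p2 p4; split => /=; rewrite ?pwS; lra.
  apply: (Classical_Prop.NNPP) => nb; move: bn; apply: Rle_not_lt.
  set x := (st n).1 in i1 i2 p1 p2 *; set y := (st n).2 in i3 i4 p3 p4 *.
  have sE : st n = (x, y) by rewrite /x /y; case: (st n).
  have m0 := pw0 n.
  have k1 : 0 <= l1 * pw n.+1 by apply: Rmult_le_pos => //; left.
  have k2 : 0 <= l2 * pw n.+1 by apply: Rmult_le_pos => //; left.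
  rewrite (rect_int_quarter g x (x + l1 * pw n.+1) _ y (y + l2 * pw n.+1)); first last.
  - by apply: cont_rect_sub con; lra.
  - by rewrite pwS in k2 *; lra.
  - by rewrite pwS in k1 *; lra.
  have -> : x + l1 * pw n = x + l1 * pw n.+1 + l1 * pw n.+1 by rewrite pwS; field.
  have -> : y + l2 * pw n = y + l2 * pw n.+1 + l2 * pw n.+1 by rewrite pwS; field.
  have -> : eta * ((l1 * l1 + l2 * l2) * (pw n * pw n)) =
    4 * (eta * ((l1 * l1 + l2 * l2) * (pw n.+1 * pw n.+1))).
    by rewrite pwS; field.
  set K := eta * _.
  have nbE : ~ bad n.+1 (nxt n (x, y)) by rewrite -sE.
  have good s : ~ bad n.+1 s -> Cmod (rect_int g s.1 (s.1 + l1 * pw n.+1) s.2 (s.2 + l2 * pw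
    n.+1)) <= K.
    exact: Rnot_lt_le.
  move: nbE; rewrite /nxt; case: (bad_dec _ _) => [//|/= h1].
  case: (bad_dec _ _) => [//|/= h2]; case: (bad_dec _ _) => [//|/= h3 h4].
  have b1 := good _ h1; have b2 := good _ h2; have b3 := good _ h3; have b4 := good _ h4.
  move: b1 b2 b3 b4 => /=.
  set e1 := rect_int g x _ y _; set e2 := rect_int g _ _ y _; set e3 := rect_int g x _ _ _;
    set e4 := rect_int g _ _ _ _.
  have := Cmod_triangle (e1 + e2 + e3) e4; have := Cmod_triangle (e1 + e2) e3;
    have := Cmod_triangle e1 e2.
  lra.
have [x hx] : exists x, forall n, (st n).1 <= x <= (st n).1 + l1 * pw n.
  apply: nested_point => n.
  - by have [[]] := nxt_pos n (st n).
  - by have [[_ h] _] := nxt_pos n (st n); rewrite /= pwS in h *; lra.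
  - by have := Rmult_le_pos _ _ hl1 (Rlt_le _ _ (pw0 n)); lra.
have [y hy] : exists y, forall n, (st n).2 <= y <= (st n).2 + l2 * pw n.
  apply: nested_point => n.
  - by have [_ []] := nxt_pos n (st n).
  - by have [_ [_ h]] := nxt_pos n (st n); rewrite /= pwS in h *; lra.
  - by have := Rmult_le_pos _ _ hl2 (Rlt_le _ _ (pw0 n)); lra.
have [[i1 i2 i3 i4] _] := inv 0%N.
have [l hl] : exists l, Cdiff g (x, y) l.
  by apply: hol; [have := hx 0%N|have := hy 0%N]; lra.
have [dl d0 hd] := hl (eta / 16) ltac:(lra).
(* From some stage on, the rectangle lies in the disc where [g] is nearly affine. *)
have [n hn] : exists n, (l1 + l2) * pw n < dl.
  have /is_lim_seq_geom/filterlim_locally h : Rabs (/ 2) < 1 by rewrite Rabs_pos_eq; lra.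
  have k0 : 0 < dl / (l1 + l2 + 1) by apply: Rdiv_lt_0_compat; lra.
  have [n hn] := h (mkposreal _ k0); exists n.
  have := hn n (Nat.le_refl n); rewrite /ball /= /AbsRing_ball /abs /minus /plus /opp /= Ropp_0
    Rplus_0_r -/(pw n).
  rewrite Rabs_pos_eq; last by left.
  move=> h1; have := Rmult_lt_compat_l (l1 + l2 + 1) _ _ ltac:(lra) h1.
  have -> : (l1 + l2 + 1) * (dl / (l1 + l2 + 1)) = dl by field; lra.
  have := pw0 n; lra.
have [[{}i1 {}i2 {}i3 {}i4]] := inv n; apply: Rle_not_lt.
have := hx n; have := hy n; have m0 := pw0 n.
set u := (st n).1 in i1 i2 *; set v := (st n).2 in i3 i4 * => hv hu.
set m := l1 * pw n in i2 hu *; set k := l2 * pw n in i4 hv *.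
have m1 : 0 <= m by lra.
have k1 : 0 <= k by lra.
have con' : cont_rect g u (u + m) v (v + k) by apply: cont_rect_sub con; lra.
pose al := (g (x, y) - l * (x, y))%C.
have e : rect_int g u (u + m) v (v + k) = rect_int (fun z =>
  g z - (al + l * z))%C u (u + m) v (v + k).
  rewrite rect_int_minus ?rect_int_affine //; try lra; first by ring.
  exact: cont_rect_affine.
rewrite e; apply: Rle_trans (rect_int_bound _ _ _ _ _ (eta / 16 * (m + k)) _ _ _ _) _; try lra.
- split=> [t ht s hs|s hs t ht].
    have [c1 c2] := proj1 con' t ht s hs; have [a1 a2] :=
      proj1 (cont_rect_affine al l u (u + m) v (v + k)) t ht s hs.
    by split; apply: (continuous_minus (V := R_NormedModule)).
  have [c1 c2] := proj2 con' s hs t ht; have [a1 a2] := proj2 (cont_rect_affine al l u (u + m) v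
    (v + k)) s hs t ht.
  by split; apply: (continuous_minus (V := R_NormedModule)).
- move=> s t hs ht.
  have near : Cmod ((s, t) - (x, y))%C <= m + k.
    apply: Rle_trans (Cmod_le_sum _) _.
    rewrite /Re /Im /Cminus /Cplus /Copp /=.
    by apply: Rplus_le_compat; apply: Rabs_le; lra.
  have mk : m + k < dl by rewrite /m /k; lra.
  have := hd (s, t) ltac:(lra).
  rewrite (_ : g (s, t) - g (x, y) - l * ((s, t) - (x, y)) = g (s, t) - (al + l * (s, t)))%C;
    last by rewrite /al; ring.
  have := Rmult_le_compat_l (eta / 16) _ _ ltac:(lra) near; lra.
- have -> : 4 * (eta / 16 * (m + k)) * (u + m - u + (v + k - v)) =
    eta * ((m + k) * (m + k) / 4) by field.
  apply: Rmult_le_compat_l; first lra.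
  have -> : (l1 * l1 + l2 * l2) * (pw n * pw n) = m * m + k * k by rewrite /m /k; ring.
  have := Rle_0_sqr (m - k); rewrite /Rsqr.
  nra.
Qed.

(** * Continuity of the derivative of a holomorphic function *)

Lemma Cdiff_Cderiv g (x y : R) l : Cdiff g (x, y) l -> Cderiv (fun t => g (t, y)) x l.
Proof.
move=> h; apply/CcvgP => eps e0; have [dl d0 hd] := h (eps / 2) ltac:(lra).
apply: (locally'P _ _ _ d0) => t tx td.
have e : ((t, y) - (x, y) = RtoC (t - x))%C by rewrite /RtoC /Cminus /Cplus /Copp /=; congr pair;
  ring.
have := hd (t, y); rewrite e Cmod_R => /(_ td) {}hd.
have t0 : 0 < Rabs (t - x) by apply: Rabs_pos_lt; lra.
have tC : RtoC (t - x) <> 0%C by move/RtoC_inj; lra.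
rewrite (_ : (g (t, y) - g (x, y)) / RtoC (t - x) - l = (g (t, y) - g (x,
  y) - l * RtoC (t - x)) / RtoC (t - x))%C; last by field.
rewrite Cmod_div // Cmod_R; apply: Rle_lt_trans (_ : eps / 2 < eps); last lra.
apply: (Rmult_le_reg_r (Rabs (t - x))) => //.
by rewrite /Rdiv Rmult_assoc Rinv_l ?Rmult_1_r //; lra.
Qed.

Lemma horizontal_lip g (a b y K : R) :
  (forall x, a <= x <= b -> exists2 l, Cdiff g (x, y) l & Cmod l <= K) ->
  forall x x', a <= x <= b -> a <= x' <= b ->
  Cmod (g (x', y) - g (x, y))%C <= 2 * K * Rabs (x' - x).
Proof.
move=> h x x' hx hx'.
pose D t := C_derive (fun z => g (Re z, y)) t.
have hD t : a <= t <= b -> Cderiv (fun t => g (t, y)) t (D t) /\ Cmod (D t) <= K.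
  move=> ht; have [l hl lK] := h t ht.
  have := Cdiff_Cderiv _ _ _ _ hl => hc.
  by rewrite /D (C_derive_Cderiv (fun z => g (Re z, y)) t l hc).
have b1 := mvt_bound_sym (fun t => Re (g (t, y))) (fun t => Re (D t)) a b K x x' _ _ hx hx'.
have b2 := mvt_bound_sym (fun t => Im (g (t, y))) (fun t => Im (D t)) a b K x x' _ _ hx hx'.
apply: Rle_trans (Cmod_le_sum _) _.
suff [s1 s2] : Rabs (Re (g (x', y)) - Re (g (x, y))) <= K * Rabs (x' - x) /\
  Rabs (Im (g (x', y)) - Im (g (x, y))) <= K * Rabs (x' - x).
  move: s1 s2; case: (g (x', y)) (g (x, y)) => [p q] [s t]; rewrite /Re /Im /Cminus /Cplus /Copp /=.
  by rewrite /Rminus; lra.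
split; [apply: b1|apply: b2] => t ht; have [hc hK] := hD t ht.
- by have [] := Cderiv_is_derive _ _ _ hc.
- by apply: Rle_trans (re_le_Cmod _) hK.
- by have [] := Cderiv_is_derive _ _ _ hc.
- by apply: Rle_trans (im_le_Cmod _) hK.
Qed.

(** In the coordinate w = log (z - z0), the difference quotient of [f] at [z0]: circles
    around [z0] become vertical segments of length 2 pi, and an annulus becomes a rectangle. *)
Definition polar_quotient (f : C -> C) (z0 w : C) : C := ((f (z0 + Cexp w) - f z0) * Cexp (- w))%C.

Lemma CexpNK w : (Cexp w * Cexp (- w) = 1)%C.
Proof.
rewrite -Cexp_plus (_ : w + - w = RtoC 0)%C; last by ring.
by rewrite /Cexp /= exp_0 cos_0 sin_0 /RtoC; congr pair; ring.
Qed.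

Section Disc.
Variables (f : C -> C) (z0 : C) (r : R) (l : C).
Hypothesis r0 : 0 < r.
Hypothesis f_holo : forall w, Cmod (w - z0)%C <= r -> exists l, Cdiff f w l.
Hypothesis f_l : Cdiff f z0 l.

Lemma polar_quotient_holo u : holo_rect (polar_quotient f z0) u (ln r) 0 (2 * PI).
Proof.
move=> x y hx hy; set w : C := (x, y).
have [m hm] : exists m, Cdiff f (z0 + Cexp w)%C m.
  apply: f_holo; rewrite (_ : z0 + Cexp w - z0 = Cexp w)%C; last by ring.
  by rewrite Cmod_Cexp -[X in _ <= X](exp_ln r) //; apply: exp_mono; rewrite /w /=; lra.
have hm' := Cdiff_is_derive _ _ _ hm.
pose V := AbsRing_NormedModule C_AbsRing.
have d1 : is_derive (K := C_AbsRing) (V := V) (fun w => z0 + Cexp w)%C w (plus (zero (G :=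
  V)) (Cexp w)).
  exact: (is_derive_plus (V := V) _ _ _ _ _ (is_derive_const (V := V) z0 w) (Cexp_derivative w)).
have d2 := is_derive_comp (K := C_AbsRing) (V := V) f (fun w => z0 + Cexp w)%C w _ _ hm' d1.
have d3 := is_derive_minus (V := V) _ _ _ _ _ d2 (is_derive_const (V := V) (f z0) w).
have d4 : is_derive (K := C_AbsRing) (V := V) (fun w => Cexp (- w))%C w (- (1) * Cexp (- w))%C.
  apply: (is_derive_comp (K := C_AbsRing) (V := V) Cexp (fun w => - w)%C w _ _ (Cexp_derivative _)).
  exact: (is_derive_opp (V := V) _ _ _ (is_derive_id (K := C_AbsRing) w)).
have d5 := is_derive_mult (K := C_AbsRing) _ _ w _ _ d3 d4 Cmult_comm.
by eexists; apply: is_derive_Cdiff; exact: d5.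
Qed.

Lemma polar_period x : polar_quotient f z0 (x, 2 * PI) = polar_quotient f z0 (x, 0).
Proof.
pose w1 : C := (x, 2 * PI); pose w2 : C := (x, 0).
have e1 : Cexp w1 = Cexp w2 by rewrite /Cexp /= cos_2PI sin_2PI cos_0 sin_0.
have e2 : Cexp (- w1)%C = Cexp (- w2)%C.
  by rewrite /Cexp /= !cos_neg !sin_neg cos_2PI sin_2PI cos_0 sin_0.
by rewrite -/w1 -/w2 /polar_quotient e1 e2.
Qed.

Lemma PI2_gt0 : 0 < 2 * PI.
Proof. by have := PI_RGT_0; lra. Qed.

(** [goursat] on the rectangle between the abscissas u and ln r; by periodicity its
    horizontal sides cancel. *)
Lemma circle_int_const u : u <= ln r ->
  Cint (fun y => polar_quotient f z0 (u, y)) 0 (2 * PI) =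
  Cint (fun y => polar_quotient f z0 (ln r, y)) 0 (2 * PI).
Proof.
move=> ur; have PI0 := PI2_gt0.
have := goursat _ u (ln r) 0 (2 * PI) ur ltac:(lra) (polar_quotient_holo u).
rewrite /rect_int (Cint_ext _ _ _ _ polar_period).
set A := Cint _ u _; set B := Cint _ 0 _; set D := Cint _ 0 _ => h.
have e : (Ci * (B - D) = 0)%C by rewrite -h; ring.
have : (Ci * (Ci * (B - D)) = 0)%C by rewrite e; ring.
rewrite Cmult_assoc (_ : Ci * Ci = - (1))%C; last by rewrite /Ci /Cmult /Copp /RtoC /=;
  congr pair; ring.
move=> h2; transitivity (B + - (1) * (B - D))%C; first by ring.
by rewrite h2; ring.
Qed.

(** By [circle_int_const] the radius may shrink to 0, where the difference quotient
    tends uniformly to l. On the circle of radius r, only values of [f] at distance r from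
    [z0] and at [z0] itself are involved. *)
Lemma derivative_circle_int :
  Cint (fun y => polar_quotient f z0 (ln r, y)) 0 (2 * PI) = (l * RtoC (2 * PI))%C.
Proof.
have PI0 := PI2_gt0.
suff : Cmod (Cint (fun y => polar_quotient f z0 (ln r, y)) 0 (2 * PI) - l * RtoC (2 * PI))%C = 0.
  move=> /Cmod_eq_0; set A := Cint _ _ _; set B := (l * _)%C => h.
  by transitivity (A - B + B)%C; [ring|rewrite h; ring].
apply: Rle_antisym; last exact: Cmod_ge_0.
apply: Rnot_lt_le; set X := Cmod _ => X0.
have [dl d0 hd] := f_l (X / (8 * PI)) ltac:(apply: Rdiv_lt_0_compat; lra).
(* a circle inside the disc where the difference quotient is near [l] *)
pose u := Rmin (ln r) (ln (dl / 2)).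
have ur : u <= ln r by apply: Rmin_l.
have ud : exp u < dl.
  apply: Rle_lt_trans (_ : dl / 2 < dl); last lra.
  by rewrite -[X in _ <= X]exp_ln; [apply: exp_mono; apply: Rmin_r|lra].
have [_ cv] := holo_cont _ _ _ _ _ (polar_quotient_holo u).
have con : Ccont (fun y => polar_quotient f z0 (u, y)) 0 (2 * PI) by apply: cv; lra.
have conl : Ccont (fun _ => l) 0 (2 * PI).
  by move=> t _; split; apply: continuous_const.
suff : X <= X / 2 by lra.
rewrite {1}/X -(circle_int_const u ur).
have -> : (l * RtoC (2 * PI))%C = Cint (fun _ => l) 0 (2 * PI) by rewrite Cint_const Rminus_0_r.
rewrite -Cint_minus //; last lra.
apply: Rle_trans (Cint_bound _ _ _ (X / (8 * PI)) _ _ _) _; first lra.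
- move=> t ht; have [c1 c2] := con t ht; have [a1 a2] := conl t ht.
  by split; apply: (continuous_minus (V := R_NormedModule)).
- move=> y hy; set w : C := (u, y).
  have m : Cmod (Cexp w) = exp u by rewrite Cmod_Cexp.
  have := hd (z0 + Cexp w)%C; rewrite (_ : z0 + Cexp w - z0 = Cexp w)%C; last by ring.
  rewrite m => /(_ ud) h.
  have e : (polar_quotient f z0 w - l = (f (z0 + Cexp w) - f z0 - l * Cexp w) * Cexp (- w))%C.
    transitivity ((f (z0 + Cexp w) - f z0) * Cexp (- w) - l * (Cexp w * Cexp (- w)))%C;
      last by ring.
    by rewrite CexpNK /polar_quotient; ring.
  rewrite e Cmod_mult Cmod_Cexp (_ : Re (- w)%C = - u) // exp_Ropp.
  have eu := exp_pos u.
  apply: (Rmult_le_reg_r (exp u)) => //; rewrite Rmult_assoc Rinv_l ?Rmult_1_r //; lra.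
- by rewrite Rminus_0_r; right; field; lra.
Qed.
End Disc.

Lemma Cmod_polar r y : 0 < r -> Cmod (Cexp (ln r, y)) = r.
Proof. by move=> r0; rewrite Cmod_Cexp exp_ln. Qed.

Lemma polar_cont f z0 r : 0 < r -> (forall w, Cmod (w - z0)%C <= r -> exists l, Cdiff f w l) ->
  Ccont (fun y => polar_quotient f z0 (ln r, y)) 0 (2 * PI).
Proof.
move=> r0 h; have PI0 := PI2_gt0.
have [_ cv] := holo_cont _ _ _ _ _ (polar_quotient_holo f z0 r r0 h (ln r)).
by apply: cv; lra.
Qed.

Lemma derivative_bound f z0 r l K : 0 < r ->
  (forall w, Cmod (w - z0)%C <= r -> exists l, Cdiff f w l) -> Cdiff f z0 l ->
  (forall w, Cmod (w - z0)%C <= r -> Cmod (f w) <= K) -> Cmod l <= 4 * K / r.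
Proof.
move=> r0 h hl hK; have PI0 := PI2_gt0.
have e := derivative_circle_int f z0 r l r0 h hl.
have := Cint_bound _ _ _ (2 * K / r) (Rlt_le _ _ PI0) (polar_cont f z0 r r0 h) _.
rewrite e Cmod_mult Cmod_R Rabs_pos_eq; last lra.
move=> hh; apply: (Rmult_le_reg_r (2 * PI)) => //.
apply: Rle_trans (hh _) _; last by right; field; lra.
move=> y hy; rewrite /polar_quotient Cmod_mult; set w : C := (ln r, y).
rewrite (Cmod_Cexp (- w)) (_ : Re (- w)%C = - ln r) // exp_Ropp exp_ln //.
apply: Rmult_le_compat_r; first by left; apply: Rinv_0_lt_compat.
have k1 : Cmod (f (z0 + Cexp w)%C) <= K.
  apply: hK; rewrite (_ : z0 + Cexp w - z0 = Cexp w)%C; last by ring.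
  by rewrite Cmod_polar //; exact: Rle_refl.
have k2 : Cmod (f z0) <= K.
  by apply: hK; rewrite (_ : z0 - z0 = RtoC 0)%C; [rewrite Cmod_0; lra|ring].
have := Cmod_triangle (f (z0 + Cexp w)%C) (- f z0); rewrite Cmod_opp /Cminus; lra.
Qed.

Section HalfPlane.
Variables (H : C -> C) (eps M : R).
Hypothesis eps_gt0 : 0 < eps.
Hypothesis H_holo : forall z, 1 - eps < Re z -> exists l, Cdiff H z l.
Hypothesis H_bound : forall z, 1 - eps < Re z -> Cmod (H z) <= M.

Let r := eps / 4.
Let r0 : 0 < r. Proof. by rewrite /r; lra. Qed.
Let C1 := 4 * M / r.

Lemma disc_re z w : Cmod (w - z)%C <= r -> Re z - r <= Re w.
Proof.
move=> h; have := Rle_trans _ _ _ (re_le_Cmod _) h.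
by move=> /Rabs_le_between; rewrite /Re /Cminus /Cplus /Copp /=; lra.
Qed.

Lemma half_plane_derivative_bound z l : 1 - 2 * r <= Re z -> Cdiff H z l -> Cmod l <= C1.
Proof.
move=> hz hl; apply: (derivative_bound H z r l M r0 _ hl) => w /disc_re hw.
  by apply: H_holo; move: hw hz; rewrite /r; lra.
by apply: H_bound; move: hw hz; rewrite /r; lra.
Qed.

Lemma half_plane_horizontal_lip x x' y : 1 - 2 * r <= x -> 1 - 2 * r <= x' ->
  Cmod (H (x', y) - H (x, y))%C <= 2 * C1 * Rabs (x' - x).
Proof.
move=> hx hx'; apply: (horizontal_lip H (1 - 2 * r) (Rmax x x')).
- move=> t ht; have [l hl] : exists l, Cdiff H (t, y) l by apply: H_holo; rewrite /=; move: ht;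
    rewrite /r; lra.
  by exists l => //; apply: (half_plane_derivative_bound (t, y)) => //=; lra.
- by split=> //; apply: Rmax_l.
- by split=> //; apply: Rmax_r.
Qed.

Lemma C_derive_Cdiff x l : Cdiff H (RtoC x) l -> C_derive H x = l.
Proof. by move=> h; apply: C_derive_Cderiv; exact: Cdiff_Cderiv h. Qed.

(** Compare the formulas of [derivative_circle_int] at x and at 1 with the same radius:
    the integrands differ by increments of H over |x - 1|, and H is Lipschitz along
    horizontal lines because its derivative is bounded. *)
Lemma derivative_lip_at_1 x l m : 1 <= x -> Cdiff H (RtoC x) l -> Cdiff H (RtoC 1) m ->
  Cmod (l - m)%C <= 8 * C1 / r * Rabs (x - 1).
Proof.
move=> x1 hl hm; have PI0 := PI2_gt0.
have ho t : 1 <= t -> forall w, Cmod (w - RtoC t)%C <= r -> exists l, Cdiff H w l.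
  by move=> t1 w /disc_re hw; apply: H_holo; move: hw; rewrite /r /=; lra.
have e1 := derivative_circle_int H x r l r0 (ho x x1) hl.
have e2 := derivative_circle_int H 1 r m r0 (ho 1 (Rle_refl 1)) hm.
have c1 := polar_cont H x r r0 (ho x x1); have c2 := polar_cont H 1 r r0 (ho 1 (Rle_refl 1)).
have e : ((l - m) * RtoC (2 * PI) = Cint (fun y => polar_quotient H (RtoC x) (ln r,
  y) - polar_quotient H (RtoC 1) (ln r, y)) 0 (2 * PI))%C.
  by rewrite Cint_minus ?e1 ?e2 //; [ring|lra].
apply: (Rmult_le_reg_r (2 * PI)) => //.
rewrite -{1}(Rabs_pos_eq (2 * PI)); last lra.
rewrite -Cmod_R -Cmod_mult e.
apply: Rle_trans (Cint_bound _ _ _ (4 * C1 / r * Rabs (x - 1)) _ _ _) _; first lra.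
- move=> t ht; have [b1 b2] := c1 t ht; have [b3 b4] := c2 t ht.
  by split; apply: (continuous_minus (V := R_NormedModule)).
- move=> y hy; rewrite /polar_quotient; set w : C := (ln r, y).
  set q := Cexp w; have hq : Cmod q <= r by rewrite /q Cmod_polar //; lra.
  have qr := Rle_trans _ _ _ (re_le_Cmod q) hq.
  move/Rabs_le_between: qr => qr.
  have -> : ((H (RtoC x + q) - H (RtoC x)) * Cexp (- w) - (H (RtoC 1 + q) - H (RtoC 1)) * Cexp (-
    w) =
    ((H (RtoC x + q) - H (RtoC 1 + q)) - (H (RtoC x) - H (RtoC 1))) * Cexp (- w))%C by ring.
  rewrite Cmod_mult (Cmod_Cexp (- w)) (_ : Re (- w)%C = - ln r) // exp_Ropp exp_ln //.
  have -> : 4 * C1 / r * Rabs (x - 1) = (2 * C1 * Rabs (x - 1) + 2 * C1 * Rabs (x - 1)) * / r by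
    field; lra.
  apply: Rmult_le_compat_r; first by left; apply: Rinv_0_lt_compat.
  have sE t : (RtoC t + q)%C = (t + Re q, Im q).
    by rewrite /RtoC /Cplus /Re /Im /=; congr pair; ring.
  have l1 := half_plane_horizontal_lip (1 + Re q) (x + Re q) (Im q) ltac:(lra) ltac:(lra).
  have l2 := half_plane_horizontal_lip 1 x 0 ltac:(lra) ltac:(lra).
  rewrite (_ : x + Re q - (1 + Re q) = x - 1) in l1; last by ring.
  rewrite !sE; have := Cmod_triangle (H (x + Re q, Im q) - H (1 + Re q,
    Im q)) (- (H (RtoC x) - H (RtoC 1))).
  rewrite Cmod_opp /Cminus -/(RtoC x) -/(RtoC 1) in l1 l2 *.
  rewrite /RtoC in l1 l2 *; lra.
- by rewrite Rminus_0_r; right; field; lra.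
Qed.

(** A differentiable function has no reason to have a continuous derivative over the
    reals; the circle formula provides it. *)
Lemma C_derive_right_cont : Ccvg (at_right 1) (fun x : R => C_derive H x) (C_derive H 1).
Proof.
have [m hm] : exists l, Cdiff H (RtoC 1) l by apply: H_holo => /=; lra.
rewrite (C_derive_Cdiff 1 m hm); apply/CcvgP => e e0.
have C10 : 0 <= C1 by apply: Rle_trans (half_plane_derivative_bound 1 m _ hm);
  [exact: Cmod_ge_0|rewrite /=; lra].
have K0 : 0 <= 8 * C1 / r.
  by apply: Rmult_le_pos; [lra|left; apply: Rinv_0_lt_compat].
have h : 0 < e / (8 * C1 / r + 1) by apply: Rdiv_lt_0_compat; lra.
apply: filter_imp (at_right_lt _ h) => x hx.
have [l hl] : exists l, Cdiff H (RtoC x) l by apply: H_holo => /=; lra.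
rewrite (C_derive_Cdiff x l hl); apply: Rle_lt_trans (derivative_lip_at_1 x l m _ hl hm) _;
  first lra.
rewrite Rabs_pos_eq; last lra.
have : (8 * C1 / r + 1) * (x - 1) < (8 * C1 / r + 1) * (e / (8 * C1 / r + 1)) by apply:
  Rmult_lt_compat_l; lra.
have -> : (8 * C1 / r + 1) * (e / (8 * C1 / r + 1)) = e by field; lra.
lra.
Qed.

Lemma C_derive_right_deriv x : 1 <= x -> Cderiv (fun t => H (RtoC t)) x (C_derive H x).
Proof.
move=> x1; have [l hl] : exists l, Cdiff H (RtoC x) l by apply: H_holo => /=; lra.
by rewrite (C_derive_Cdiff x l hl); exact: Cdiff_Cderiv hl.
Qed.
End HalfPlane.

(** * The Euler constant *)

Lemma Cderiv_sum (I : Type) (r : seq I) (P : pred I) (f : I -> R -> C) (l : I -> C) x :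
  (forall i, P i -> Cderiv (f i) x (l i)) ->
  Cderiv (fun t => \big[Cplus/RtoC 0]_(i <- r | P i) f i t) x
    (\big[Cplus/RtoC 0]_(i <- r | P i) l i).
Proof.
move=> h; elim: r => [|i r IH].
  rewrite big_nil; apply: Cderiv_ext_loc (Cderiv_const (RtoC 0) x).
  by apply: filter_forall => t; rewrite big_nil.
rewrite big_cons; case: ifP => Pi; last first.
  by apply: Cderiv_ext_loc IH; apply: filter_forall => t; rewrite big_cons Pi.
apply: Ccvg_ext (Ccvg_plus _ _ _ _ (h i Pi) IH).
apply: (locally'P _ _ 1 Rlt_0_1) => t tx _; rewrite !big_cons Pi; field.
by move/RtoC_inj; lra.
Qed.

Lemma Cderiv_exp (W : R -> R) x w : Cderiv (fun t => RtoC (W t)) x w ->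
  Cderiv (fun t => RtoC (exp (W t))) x (w * RtoC (exp (W x)))%C.
Proof.
move=> h; have [hr _] := Cderiv_is_derive _ _ _ h.
rewrite (Ccvg_unique _ _ _ h (is_derive_Cderiv _ _ _ hr)) -RtoC_mult.
apply: is_derive_Cderiv.
exact: (is_derive_comp exp W x _ _ (is_derive_exp _) hr).
Qed.

Lemma locally_gt1 x : 1 < x -> locally x (fun t : R => 1 < t).
Proof.
move=> x1; have h : 0 < x - 1 by lra.
exists (mkposreal _ h) => t; rewrite /ball /= /AbsRing_ball /abs /minus /plus /opp /= =>
  /Rabs_def2; lra.
Qed.

Theorem corollary1 (d : nat) (d_ge2 : (2 <= d)%N) (e : nat -> Q)
  (F H : C -> C) (eps : R) (eps_gt0 : 0 < eps)
  (F_Dirichlet : is_Dirichlet_series F)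
  (H_Dirichlet : is_Dirichlet_series H)
  (H_holomorphic : holomorphic_on (fun s : C => 1 - eps < Re s) H)
  (H_neq0 : forall s : C, 1 - eps < Re s -> H s <> RtoC 0)
  (H_bounded : exists M : R, forall s : C, 1 - eps < Re s -> Cmod (H s) <= M)
  (F_def : forall s : C, 1 < Re s ->
    F s = (H s * \big[Cmult/RtoC 1]_(1 <= a < d | coprime d a)
                    zeta_da_pow d a (e a) s)%C) :
  is_Euler_constant F
    (C_derive H 1 / H 1
       + \big[Cplus/RtoC 0]_(1 <= a < d | coprime d a)
           (Q2R (e a) * gamma_da d a))%C.
Proof.
have [M HM] := H_bounded.
have Hholo z : 1 - eps < Re z -> exists l, Cdiff H z l.
  by move=> /H_holomorphic [l hl]; exists l; exact: is_derive_C_Cdiff.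
pose W t := \big[Rplus/0]_(1 <= a < d | coprime d a) (Q2R (e a) * log_zeta d a t).
have WE t : RtoC (W t) = \big[Cplus/RtoC 0]_(1 <= a < d |
  coprime d a) (Q2R (e a) * RtoC (log_zeta d a t))%C.
  rewrite /W (big_morph RtoC RtoC_plus (erefl (RtoC 0))).
  by apply: eq_bigr => a _; rewrite RtoC_mult.
have FE (t : R) : 1 < t -> (H t * RtoC (exp (W t)))%C = F t.
  move=> t1; rewrite F_def //; congr Cmult.
  rewrite /W (big_morph (fun x => RtoC (exp x)) (id1 := RtoC 1) (op1 := Cmult)); last first.
  - by rewrite exp_0.
  - by move=> x y; rewrite exp_plus RtoC_mult.
  by apply: eq_bigr => a _; rewrite /zeta_da_pow log_zeta_daE // -RtoC_mult Cexp_R.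
pose w x := \big[Cplus/RtoC 0]_(1 <= a < d | coprime d a) (Q2R (e a) * - Qser (residue d a) x)%C.
have hW x : 1 < x -> Cderiv (fun t => RtoC (W t)) x (w x).
  move=> x1; apply: Cderiv_ext_loc (filter_forall _ (fun t => esym (WE t))) _.
  apply: Cderiv_sum => a _.
  have := Cderiv_mult _ _ _ _ _ (Cderiv_const (RtoC (Q2R (e a))) x) (log_zeta_Cderiv d a x x1).
  by rewrite Cmult_0_l Cplus_0_l.
have logder (x : R) : 1 < x -> (C_derive F x / F x = C_derive H x / H x + w x)%C.
  move=> x1.
  have hH := C_derive_right_deriv H eps eps_gt0 Hholo x ltac:(lra).
  have hF := Cderiv_mult _ _ _ _ _ hH (Cderiv_exp _ _ _ (hW x x1)).
  have Hx : H (RtoC x) <> 0%C by apply: H_neq0 => /=; lra.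
  have Ex : RtoC (exp (W x)) <> 0%C by move/RtoC_inj; have := exp_pos (W x); lra.
  rewrite -FE // (C_derive_Cderiv F x _ (Cderiv_ext_loc _ _ _ _ (filter_imp _ _ FE (locally_gt1 x
    x1)) hF)).
  by field.
(* alpha: each [-Qser] has residue [-1 / phi(d)], weighted by [e a] *)
exists (\big[Cplus/RtoC 0]_(1 <= a < d | coprime d a) (Q2R (e a) / INR (totient d))%C).
have phi0 : 0 < INR (totient d) by apply: INR_gt0; rewrite totient_gt0; exact: ltnW.
have phiC : RtoC (INR (totient d)) <> 0%C by move/RtoC_inj; lra.
have H1 : H (RtoC 1) <> 0%C by apply: H_neq0 => /=; lra.
have cH : Ccvg (at_right 1) (fun x : R => H x) (H 1).
  apply: filterlim_filter_le_1 (Cderiv_continuous _ _ _ (C_derive_right_deriv H eps eps_gt0 Hholo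
    1 (Rle_refl 1))).
  by move=> P [dl hd]; exists dl => y yb y1; apply: hd => //; lra.
have cD := C_derive_right_cont H eps M eps_gt0 Hholo HM.
have cS : Ccvg (at_right 1) (fun x => \big[Cplus/RtoC 0]_(1 <= a < d | coprime d a)
    (Q2R (e a) * (- Qser (residue d a) x + 1 / (INR (totient d) * (x - 1))))%C)
    (\big[Cplus/RtoC 0]_(1 <= a < d | coprime d a) (Q2R (e a) * gamma_da d a)%C).
  by apply: Ccvg_sum => a da; apply: Ccvg_mult (Ccvg_const _) _; exact: gamma_da_limit.
apply: (Ccvg_ext _ _ _ _ (Ccvg_plus _ _ _ _ (Ccvg_mult _ _ _ _ cD (Ccvg_inv _ _ H1 cH)) cS)).
apply: filter_imp (at_right_lt 1 Rlt_0_1) => x hx.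
have x1C : (RtoC x - 1)%C <> 0%C by rewrite -RtoC_minus; move/RtoC_inj; lra.
rewrite logder; last lra.
rewrite -/(Cdiv _ _) -Cplus_assoc; congr Cplus.
rewrite /w [(_ / (x - 1))%C]/Cdiv big_distrl -big_split /=.
by apply: eq_bigr => a _; field.
Qed.
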